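(* Let $\kappa=0$ and $1<p<2$, and let $\Omega$, $\Psi$, $g$ satisfy the standing assumptions listed in the context (with these $p$ and $\kappa$). Let $0$ be a critical point of the functional $$f(u)=\int_\Omega\Psi(\nabla u)\,dx-\int_\Omega G(x,u)\,dx,\qquad u\in W^{1,p}_0(\Omega).$$ Then $m(f,0)=m^*(f,0)=0$, and $0$ is a strict local minimum and an isolated critical point of $f$, with $$C_m(f,0)\approx\mathbb{G}\ \text{ if } m=0,\qquad C_m(f,0)=\{0\}\ \text{ if } m\ne0 .$$
   Context: Standing assumptions ($\kappa=0$, $1<p<2$). $\Omega$ is a bounded open subset of $\mathbb{R}^N$, $N\ge1$, with $\partial\Omega$ of class $C^{1,\alpha}$ for some $\alpha\in]0,1]$; $\Psi_{p,0}(\xi)=\frac1p|\xi|^p$; $G(x,s)=\int_0^s g(x,t)\,dt$. On $\Psi$: $\Psi:\mathbb{R}^N\to\mathbb{R}$ is of class $C^1$ with $\Psi(0)=0$, $\nabla\Psi(0)=0$; there exist $0<\nu\le C$ such that $\Psi-\nu\Psi_{p,0}$ and $C\Psi_{p,0}-\Psi$ are both convex; and $\Psi$ is of class $C^2$ on $\mathbb{R}^N\setminus\{0\}$. On $g$: $g:\Omega\times\mathbb{R}\to\mathbb{R}$, $g(\cdot,s)$ is measurable for every $s$, $g(x,\cdot)$ is of class $C^1$ for a.e. $x$. If $p<N$, there are $C,q>0$ with $q\le p^*-1=\frac{Np}{N-p}-1$ and $|g(x,s)|\le C(1+|s|^q)$ for a.e. $x\in\Omega$ and all $s$; if $p=N$,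 there are $C,q>0$ with $|g(x,s)|\le C(1+|s|^q)$ for a.e. $x$ and all $s$; if $p>N$, for every $S>0$ there is $C_S>0$ with $|g(x,s)|\le C_S$ for a.e. $x$ and all $|s|\le S$. Moreover, for every $S>0$ there is $\widehat C_S>0$ with $|D_sg(x,s)|\le\widehat C_S$ for a.e. $x$ and all $|s|\le S$. Critical groups. For an abelian group $\mathbb{G}$, a critical point $u_0$, $c=f(u_0)$ and $f^c=\{u\in W^{1,p}_0(\Omega): f(u)\le c\}$, $C_m(f,u_0)=C_m(f,u_0;\mathbb{G})=H^m(f^c,f^c\setminus\{u_0\};\mathbb{G})$, where $H^*$ is Alexander–Spanier cohomology. Morse indices. For a critical point $u_0$ of $f$ (which is automatically in $C^{1,\beta}(\overline\Omega)$ for some $\beta\in]0,1]$), let $Z_{u_0}=\{x\in\Omega:\nabla u_0(x)=0\}$ and $$X_{u_0}=\left\{v\in W^{1,2}_0(\Omega):\ \nabla v=0\text{ a.e. in }Z_{u_0}\text{ and }\frac{|\nabla v|^2}{|\nabla u_0|^{2-p}}\in L^1(\Omega\setminus Z_{u_0})\right\},$$ and $Q_{u_0}:X_{u_0}\to\mathbb{R}$, $Q_{u_0}(v)=\int_{\Omega\setminus Z_{u_0}}\Psi''(\nabla u_0)[\nabla v]^2\,dx-\int_\Omega D_sg(x,u_0)v^2\,dx$. Then $m(f,u_0)$ (resp. $m^*(f,u_0)$) is the supremum of the dimensions of the linear subspaces of $X_{u_0}$ on which $Q_{u_0}$ is negative definite (resp. negative semidefinite). *)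

(* Defs.v *)
From HB Require Import structures.
From mathcomp Require Import all_boot all_order all_algebra.
From mathcomp Require Import all_classical all_reals all_analysis.

Set Implicit Arguments.
Unset Strict Implicit.
Unset Printing Implicit Defensive.

Import Order.TTheory GRing.Theory Num.Theory.
Import numFieldNormedType.Exports.

Local Open Scope classical_set_scope.
Local Open Scope ring_scope.

Definition rV_display : measure_display. Proof. exact. Qed.

Section measurable_rV.
Context {R : realType} {n : nat}.

Definition rV_coord (i : 'I_n) (x : 'rV[R]_n) : measurableTypeR R := x ord0 i.

Let rV_set0 : g_sigma_preimage rV_coord set0.
Proof. exact: sigma_algebra0. Qed.

Let rV_setC A : g_sigma_preimage rV_coord A -> g_sigma_preimage rV_coord (~` A).
Proof. exact: sigma_algebraC. Qed.

Let rV_bigcup (F : (set 'rV[R]_n)^nat) :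
  (forall i, g_sigma_preimage rV_coord (F i)) ->
  g_sigma_preimage rV_coord (\bigcup_i (F i)).
Proof. exact: sigma_algebra_bigcup. Qed.

(* Product of the Borel sigma-algebras of the factors. *)
HB.instance Definition _ := @isMeasurable.Build rV_display 'rV[R]_n
  (g_sigma_preimage rV_coord) rV_set0 rV_setC rV_bigcup.

Lemma measurable_rV_coord i : measurable_fun [set: 'rV[R]_n] (rV_coord i).
Proof.
move=> _ Y mY; rewrite setTI; apply: sub_sigma_algebra => /=.
rewrite -bigcup_seq/=; exists i => /=; first by rewrite mem_index_enum.
by exists Y => //; rewrite setTI.
Qed.

Lemma measurable_fun_rVP d (T : measurableType d) (f : T -> 'rV[R]_n) :
  (forall i, measurable_fun [set: T] (rV_coord i \o f)) ->
  measurable_fun [set: T] f.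
Proof.
move=> mf _ Y mY; rewrite setTI.
pose F := image_set_system [set: T] f measurable.
have : g_sigma_preimage rV_coord `<=` F.
  apply: smallest_sub; first exact/sigma_algebra_image/sigma_algebra_measurable.
  move=> A; rewrite -bigcup_seq => -[i _ [B mB <-]].
  rewrite /F /image_set_system /= !setTI.
  by have := mf i measurableT B mB; rewrite setTI.
by move=> /(_ _ mY); rewrite /F /image_set_system /= setTI.
Qed.

End measurable_rV.

Section lebesgue_rV.
Context {R : realType}.

Definition cons_rV n (z : measurableTypeR R * 'rV[R]_n) : 'rV[R]_n.+1 :=
  \row_j oapp (z.2 ord0) z.1 (unlift ord0 j).

Definition uncons_rV n (x : 'rV[R]_n.+1) : measurableTypeR R * 'rV[R]_n :=
  (x ord0 ord0, \row_j x ord0 (lift ord0 j)).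

Lemma uncons_rVK n : cancel (@uncons_rV n) (@cons_rV n).
Proof.
move=> x; apply/rowP => j; rewrite !mxE.
by case: unliftP => [k|] -> //=; rewrite mxE.
Qed.

Lemma cons_rVK n : cancel (@cons_rV n) (@uncons_rV n).
Proof.
case=> t y; rewrite /uncons_rV /cons_rV mxE unlift_none /=; congr pair.
by apply/rowP => j; rewrite !mxE liftK.
Qed.

Lemma measurable_cons_rV n : measurable_fun [set: _] (@cons_rV n).
Proof.
apply: measurable_fun_rVP => i.
case: (unliftP ord0 i) => [k ->|->].
  rewrite (_ : _ \o _ = rV_coord k \o snd).
    by apply: measurableT_comp => //; exact: measurable_rV_coord.
  by apply/funext => z; rewrite /rV_coord /= mxE liftK.
rewrite (_ : _ \o _ = fst) //.
by apply/funext => z; rewrite /rV_coord /= mxE unlift_none.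
Qed.

Lemma measurable_uncons_rV n : measurable_fun [set: _] (@uncons_rV n).
Proof.
apply: measurable_fun_pair; first exact: (@measurable_rV_coord _ _ ord0).
apply: measurable_fun_rVP => i.
rewrite (_ : _ \o _ = rV_coord (lift ord0 i)); first exact: measurable_rV_coord.
by apply/funext => z; rewrite /rV_coord /= mxE.
Qed.

Section cons_measure.
Variables (n : nat) (mu : {sigma_finite_measure set 'rV[R]_n -> \bar R}).
Local Open Scope ereal_scope.

Definition cons_measure : set 'rV[R]_n.+1 -> \bar R :=
  pushforward (lebesgue_measure \x mu) (@cons_rV n).

Let mpre A : measurable A -> measurable (@cons_rV n @^-1` A).
Proof.
by move=> mA; rewrite -[X in measurable X]setTI; exact: measurable_cons_rV.
Qed.

Let cons_measure0 : cons_measure set0 = 0.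
Proof. by rewrite /cons_measure /pushforward preimage_set0 measure0. Qed.

Let cons_measure_ge0 A : 0 <= cons_measure A.
Proof. by rewrite /cons_measure /pushforward measure_ge0. Qed.

Let cons_measure_sigma_additive : semi_sigma_additive cons_measure.
Proof.
move=> F mF tF mUF; rewrite /cons_measure /pushforward preimage_bigcup.
apply: measure_semi_sigma_additive.
- by move=> k; exact: mpre.
- apply/trivIsetP => /= i j _ _ ij; rewrite -preimage_setI.
  by move/trivIsetP : tF => /(_ _ _ _ _ ij) ->//; rewrite preimage_set0.
- by rewrite -preimage_bigcup; exact: mpre.
Qed.

HB.instance Definition _ := isMeasure.Build _ _ _ cons_measure
  cons_measure0 cons_measure_ge0 cons_measure_sigma_additive.

Let cons_measure_sigma_finite : sigma_finite setT cons_measure.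
Proof.
have /sigma_finiteP[F [TF ndF Foo]] := sigma_finiteT (@lebesgue_measure R).
have /sigma_finiteP[G [TG ndG Goo]] := sigma_finiteT mu.
exists (fun k => @uncons_rV n @^-1` (F k `*` G k)).
  rewrite -preimage_bigcup -(preimage_setT (@uncons_rV n)); congr (_ @^-1` _).
  rewrite -setXTT TF TG predeqE => -[x y]; split.
    move=> [/= [k _ Fkx] [l _ Gly]]; exists (maxn k l) => //; split.
    - by move: x Fkx; exact/subsetPset/ndF/leq_maxl.
    - by move: y Gly; exact/subsetPset/ndG/leq_maxr.
  by move=> [k _ []/= ? ?]; split; exists k.
move=> k; have [mF Fk] := Foo k; have [mG Gk] := Goo k; split.
  rewrite -[X in measurable X]setTI; apply: measurable_uncons_rV => //.
  exact: measurableX.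
rewrite /cons_measure /pushforward -comp_preimage.
rewrite (_ : _ \o _ = id) ?preimage_id; last first.
  by apply/funext => z /=; rewrite cons_rVK.
by rewrite product_measure1E// lte_mul_pinfty// ge0_fin_numE.
Qed.

HB.instance Definition _ := Measure_isSigmaFinite.Build _ _ _ cons_measure
  cons_measure_sigma_finite.

End cons_measure.

Fixpoint lebesgue_rV n : {sigma_finite_measure set 'rV[R]_n -> \bar R} :=
  if n is m.+1 then cons_measure (lebesgue_rV m) else dirac (0 : 'rV[R]_0).

End lebesgue_rV.

Record seminorm (R : realType) (V : lmodType R) := Seminorm {
  seminorm_fun :> V -> R ;
  seminormD : forall u v, seminorm_fun (u + v) <= seminorm_fun u + seminorm_fun v ;
  seminormZ : forall a u, seminorm_fun (a *: u) = `|a| * seminorm_fun u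
}.

Section seminorm_quotient.
Context {R : realType} {V : lmodType R} (nu : seminorm V).
Local Open Scope quotient_scope.

Lemma seminorm0 : nu 0 = 0.
Proof. by rewrite -(scale0r 0) seminormZ normr0 mul0r. Qed.

Lemma seminormN v : nu (- v) = nu v.
Proof. by rewrite -scaleN1r seminormZ normrN1 mul1r. Qed.

Lemma seminorm_ge0 v : 0 <= nu v.
Proof.
have := seminormD nu v (- v); rewrite subrr seminorm0 seminormN.
by rewrite -mulr2n pmulrn_lge0.
Qed.

Definition seminorm_ker : {pred V} := [pred v | nu v == 0].

Let ker_zmod_closed : zmod_closed seminorm_ker.
Proof.
split=> [|u v]; first by rewrite inE seminorm0.
rewrite !inE => /eqP u0 /eqP v0; rewrite eq_le seminorm_ge0 andbT.
by rewrite (le_trans (seminormD _ _ _))// seminormN u0 v0 addr0.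
Qed.

HB.instance Definition _ := GRing.isZmodClosed.Build V seminorm_ker
  ker_zmod_closed.

Definition seminorm_quot : Type := Quotient.quot seminorm_ker.
HB.instance Definition _ := GRing.Zmodule.on seminorm_quot.
HB.instance Definition _ := EqQuotient.on seminorm_quot.

Let Q := seminorm_quot.
Definition to_quot (v : V) : Q := \pi_Q v.

Lemma to_quotD u v : to_quot (u + v) = to_quot u + to_quot v.
Proof. exact: raddfD. Qed.

Lemma to_quotP u v : reflect (to_quot u = to_quot v) (nu (u - v) == 0).
Proof. by apply: (iffP idP) => [|] h; [apply/eqP|move/eqP: h]; rewrite eqmodE. Qed.

Definition quot_scale (a : R) (x : Q) : Q := to_quot (a *: repr x).

Let scale_to_quot a v : quot_scale a (to_quot v) = to_quot (a *: v).
Proof.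
apply/to_quotP; rewrite -scalerBr seminormZ; apply/eqP.
suff /eqP -> : nu (repr (to_quot v) - v) == 0 by rewrite mulr0.
by apply/to_quotP; rewrite /to_quot reprK.
Qed.

Lemma to_quot_surj x : exists v, x = to_quot v.
Proof. by exists (repr x); rewrite /to_quot reprK. Qed.

Let scaleA a b x : quot_scale a (quot_scale b x) = quot_scale (a * b) x.
Proof. by have [v ->] := to_quot_surj x; rewrite !scale_to_quot scalerA. Qed.

Let scale1 : left_id 1 quot_scale.
Proof. by move=> x; have [v ->] := to_quot_surj x; rewrite scale_to_quot scale1r. Qed.

Let scaleDr : right_distributive quot_scale +%R.
Proof.
move=> a x y; have [v ->] := to_quot_surj x; have [w ->] := to_quot_surj y.
by rewrite -to_quotD !scale_to_quot scalerDr to_quotD.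
Qed.

Let scaleDl x : {morph quot_scale^~ x : a b / a + b}.
Proof. by move=> a b /=; have [v ->] := to_quot_surj x; rewrite !scale_to_quot scalerDl to_quotD. Qed.

HB.instance Definition _ := GRing.Zmodule_isLmodule.Build R seminorm_quot
  scaleA scale1 scaleDr scaleDl.

Definition quot_norm (x : Q) : R := nu (repr x).

Lemma norm_to_quot v : quot_norm (to_quot v) = nu v.
Proof.
have /to_quotP/eqP h : to_quot (repr (to_quot v)) = to_quot v by rewrite /to_quot reprK.
have h' : nu (v - repr (to_quot v)) = 0 by rewrite -seminormN opprB.
rewrite /quot_norm; apply/eqP; rewrite eq_le; apply/andP; split.
  by rewrite -[leLHS](congr1 nu (subrK v _)) (le_trans (seminormD _ _ _))// h add0r.
by rewrite -[leLHS](congr1 nu (subrK (repr (to_quot v)) _)) (le_trans (seminormD _ _ _))// h' add0r.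
Qed.

Let quot_normD x y : quot_norm (x + y) <= quot_norm x + quot_norm y.
Proof.
have [v ->] := to_quot_surj x; have [w ->] := to_quot_surj y.
by rewrite -to_quotD !norm_to_quot seminormD.
Qed.

Let quot_normZ a x : quot_norm (a *: x) = `|a| * quot_norm x.
Proof.
have [v ->] := to_quot_surj x; rewrite [a *: _]scale_to_quot !norm_to_quot; exact: seminormZ.
Qed.

Let quot_norm0 x : quot_norm x = 0 -> x = 0.
Proof.
have [v ->] := to_quot_surj x; rewrite norm_to_quot => v0.
have -> : 0 = to_quot 0 by rewrite /to_quot raddf0.
by apply/to_quotP; rewrite subr0 v0.
Qed.

HB.instance Definition _ := @Lmodule_isNormed.Build R seminorm_quot
  quot_norm quot_normD quot_normZ quot_norm0.

Lemma to_quotZ a v : to_quot (a *: v) = a *: to_quot v.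
Proof. by rewrite -scale_to_quot. Qed.

Lemma to_quot_norm v : `|to_quot v| = nu v.
Proof. exact: norm_to_quot. Qed.

End seminorm_quotient.

Section calculus.
Context {R : realType} {N : nat}.
Implicit Types (f : 'rV[R]_N -> R) (x v : 'rV[R]_N).

Definition enorm v : R := Num.sqrt (\sum_i v ord0 i ^+ 2).

Definition partial (i : 'I_N) f : 'rV[R]_N -> R := 'D_(delta_mx ord0 i) f.

Definition grad f x : 'rV[R]_N := \row_i partial i f x.

Fixpoint smooth_upto (k : nat) f : Prop :=
  (forall x, differentiable f x) /\
  if k is k'.+1 then forall i, smooth_upto k' (partial i f) else True.

Definition smooth f := forall k, smooth_upto k f.

Definition support f : set 'rV[R]_N := closure [set x | f x != 0].

Definition test_function (Omega : set 'rV[R]_N) f :=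
  [/\ smooth f, compact (support f) & support f `<=` Omega].

Lemma partialP a f g i :
  (forall x, differentiable f x) -> (forall x, differentiable g x) ->
  partial i (a *: f + g) = a *: partial i f + partial i g.
Proof.
move=> df dg; apply/funext => x; rewrite /partial.
have dfx : derivable f x (delta_mx ord0 i) by exact: diff_derivable.
have dgx : derivable g x (delta_mx ord0 i) by exact: diff_derivable.
by rewrite deriveD//; [rewrite deriveZ|exact: derivableZ].
Qed.

Lemma smooth_uptoP a f g k :
  smooth_upto k f -> smooth_upto k g -> smooth_upto k (a *: f + g).
Proof.
elim: k f g => [|k IH] f g /= [df kf] [dg kg]; split => //.
- by move=> x; apply: differentiableD => //; exact: differentiableZ.
- by move=> x; apply: differentiableD => //; exact: differentiableZ.
- by move=> i; rewrite partialP//; exact: IH.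
Qed.

Lemma smooth_upto0 k : smooth_upto k (0 : 'rV[R]_N -> R).
Proof.
have p0 i : partial i 0 = 0.
  by apply/funext => x; rewrite /partial (_ : 0 = cst 0)// derive_cst.
elim: k => [|k IH] /=; split => //; try by move=> x; exact: differentiable_cst.
by move=> i; rewrite p0.
Qed.

Lemma test_function0 Omega : test_function Omega (0 : 'rV[R]_N -> R).
Proof.
have -> : test_function Omega (0 : 'rV[R]_N -> R) =
  [/\ smooth (0 : 'rV[R]_N -> R), compact (@set0 'rV[R]_N) & set0 `<=` Omega].
  rewrite /test_function /support.
  by rewrite (_ : [set x | _ ] = set0) ?closure0// -subset0 => x /=; rewrite eqxx.
split => //; [exact: smooth_upto0|exact: compact0].
Qed.

Lemma test_functionP Omega a f g : test_function Omega f -> test_function Omega g ->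
  test_function Omega (a *: f + g).
Proof.
move=> [sf cf fO] [sg cg gO].
have sub : support (a *: f + g) `<=` support f `|` support g.
  rewrite /support -closureU; apply: closure_subset => x /= h.
  have [fx0|] := eqVneq (f x) 0; last by left.
  right; apply: contra_neq h => gx0.
  by rewrite -[LHS]/(a *: f x + g x) fx0 gx0 scaler0 addr0.
split.
- by move=> k; apply: smooth_uptoP.
- apply: (subclosed_compact _ (compactU cf cg) sub); exact: closed_closure.
- by move=> x /sub[/fO|/gO].
Qed.

End calculus.

Section sobolev.
Context {R : realType} {N : nat}.
Variables (Omega : set 'rV[R]_N) (p : R) (p1 : 1 <= p).

Let p1E : (1 <= p%:E)%E. Proof. by rewrite lee_fin. Qed.

Let mu := @lebesgue_rV R N.

(* L^p(Omega): functions are defined on R^N, only their values on Omega matter *)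
Definition in_Lp (u : 'rV[R]_N -> R) : bool := u \_ Omega \in Lfun mu p%:E.

Definition normLp (u : 'rV[R]_N -> R) : R :=
  fine 'N[mu]_p%:E[EFin \o (u \_ Omega)].

Notation fun_grad := (('rV[R]_N -> R) * ('rV[R]_N -> 'rV[R]_N))%type.

Definition coordf (i : 'I_N) (U : 'rV[R]_N -> 'rV[R]_N) (x : 'rV[R]_N) : R :=
  U x ord0 i.

Definition in_LpW (w : fun_grad) : Prop :=
  in_Lp w.1 /\ forall i, in_Lp (coordf i w.2).

(* For bounded Omega this norm is equivalent, on the closure of the test functions,
   to the L^p norm of the gradient (Poincare). *)
Definition normW (w : fun_grad) : R :=
  normLp w.1 + \sum_i normLp (coordf i w.2).

Definition graph (phi : 'rV[R]_N -> R) : fun_grad := (phi, grad phi).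

Let restrictP a (u v : 'rV[R]_N -> R) :
  (a *: u + v) \_ Omega = a *: (u \_ Omega) + v \_ Omega.
Proof.
apply/funext => x; transitivity (a *: (u \_ Omega) x + (v \_ Omega) x) => //.
by rewrite /patch; case: ifPn => // _; rewrite [point]/(0 : R) scaler0 addr0.
Qed.

Let restrictZ a (u : 'rV[R]_N -> R) : (a *: u) \_ Omega = a *: (u \_ Omega).
Proof.
apply/funext => x; transitivity (a *: (u \_ Omega) x) => //.
by rewrite /patch; case: ifPn => // _; rewrite [point]/(0 : R) scaler0.
Qed.

Let restrictD (u v : 'rV[R]_N -> R) : (u + v) \_ Omega = u \_ Omega + v \_ Omega.
Proof. by have := restrictP 1 u v; rewrite !scale1r. Qed.

Lemma in_Lp0 : in_Lp 0.
Proof.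
have [+ _] := @Lfun_submod_closed _ _ R mu p%:E p1E.
rewrite /in_Lp (_ : (0 : 'rV[R]_N -> R) \_ Omega = 0)//.
by apply/funext => x; rewrite /patch; case: ifP.
Qed.

Lemma in_LpP a u v : in_Lp u -> in_Lp v -> in_Lp (a *: u + v).
Proof.
have [_ h] := @Lfun_submod_closed _ _ R mu p%:E p1E.
by rewrite /in_Lp restrictP; exact: h.
Qed.

Lemma normLpK u : in_Lp u -> (normLp u)%:E = ('N[mu]_p%:E[EFin \o (u \_ Omega)])%E.
Proof. by move=> hu; exact: (finite_norm_fine (Lfun_Sub p1E hu)). Qed.

Let in_Lp_measurable u : in_Lp u -> measurable_fun setT (u \_ Omega).
Proof. by move=> /sub_Lfun_mfun; rewrite inE. Qed.

Lemma normLpD u v : in_Lp u -> in_Lp v -> normLp (u + v) <= normLp u + normLp v.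
Proof.
move=> hu hv; rewrite -lee_fin EFinD !normLpK//; last first.
  by rewrite -[u]scale1r; exact: in_LpP.
by rewrite restrictD; apply: eminkowski; rewrite ?lee_fin//; exact: in_Lp_measurable.
Qed.

Lemma normLpZ a u : in_Lp u -> normLp (a *: u) = `|a| * normLp u.
Proof.
move=> hu; rewrite /normLp restrictZ.
by rewrite (LnormZ (Lfun_Sub p1E hu) a) /= -normLpK.
Qed.

Lemma in_LpW0 : in_LpW 0.
Proof.
split=> [|i]; first exact: in_Lp0.
by rewrite (_ : coordf i _ = 0) ?in_Lp0//; apply/funext => x; rewrite /coordf mxE.
Qed.

Let coordfP i a (U V : 'rV[R]_N -> 'rV[R]_N) :
  coordf i (a *: U + V) = a *: coordf i U + coordf i V.
Proof. by apply/funext => x; rewrite /coordf !mxE. Qed.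

Let coordfZ i a (U : 'rV[R]_N -> 'rV[R]_N) : coordf i (a *: U) = a *: coordf i U.
Proof. by apply/funext => x; rewrite /coordf !mxE. Qed.

Let coordfD i (U V : 'rV[R]_N -> 'rV[R]_N) :
  coordf i (U + V) = coordf i U + coordf i V.
Proof. by apply/funext => x; rewrite /coordf !mxE. Qed.

Lemma in_LpWP a w z : in_LpW w -> in_LpW z -> in_LpW (a *: w + z).
Proof.
move=> [w1 w2] [z1 z2]; split=> [|i]; first exact: in_LpP.
by rewrite coordfP; exact: in_LpP.
Qed.

Lemma normWD w z : in_LpW w -> in_LpW z -> normW (w + z) <= normW w + normW z.
Proof.
move=> [w1 w2] [z1 z2]; rewrite /normW addrACA -big_split /= lerD//.
  exact: normLpD.
by apply: ler_sum => i _; rewrite coordfD; exact: normLpD.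
Qed.

Lemma normWZ a w : in_LpW w -> normW (a *: w) = `|a| * normW w.
Proof.
move=> [w1 w2]; rewrite /normW mulrDr mulr_sumr normLpZ//; congr (_ + _).
by apply: eq_bigr => i _; rewrite coordfZ normLpZ.
Qed.

(* Closure of the test functions in the graph norm.  The second component of
   a member of the closure is an L^p limit of gradients of test functions
   converging to the first one, i.e. it is the weak gradient.  The graph of a
   test function is always in L^p. *)
Definition W0_pred : {pred fun_grad} := [pred w | `[< in_LpW w /\
  forall e, 0 < e -> exists phi, [/\ test_function Omega phi,
    in_LpW (graph phi) & normW (w - graph phi) < e] >]].

Let graphP a phi psi : test_function Omega phi -> test_function Omega psi ->
  graph (a *: phi + psi) = a *: graph phi + graph psi.
Proof.
move=> [sphi _ _] [spsi _ _]; congr pair; apply/funext => x; apply/rowP => i.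
have [dphi _] := sphi 0%N; have [dpsi _] := spsi 0%N.
by rewrite !mxE partialP.
Qed.

Let graph0 : graph 0 = 0.
Proof.
congr pair; apply/funext => x; apply/rowP => i; rewrite !mxE.
by rewrite /partial (_ : 0 = cst 0)// derive_cst.
Qed.

Let W0_submod_closed : submod_closed W0_pred.
Proof.
split.
  apply/asboolP; split; first exact: in_LpW0.
  move=> e e0; exists 0; rewrite graph0 subr0; split.
  - exact: test_function0.
  - exact: in_LpW0.
  - by rewrite -(scale0r 0) normWZ ?normr0 ?mul0r//; exact: in_LpW0.
move=> a w z /asboolP[Lw hw] /asboolP[Lz hz]; apply/asboolP; split.
  exact: in_LpWP.
move=> e e0.
have e1 : 0 < e / 2 / (`|a| + 1) by rewrite !divr_gt0// ltr_wpDl.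
have [phi [tphi Lphi wphi]] := hw _ e1.
have [psi [tpsi Lpsi zpsi]] := hz _ (divr_gt0 e0 (ltr0Sn _ 1)).
exists (a *: phi + psi); rewrite graphP//; split.
- exact: test_functionP.
- exact: in_LpWP.
have subW w' z' : in_LpW w' -> in_LpW z' -> in_LpW (w' - z').
  by move=> ? ?; rewrite addrC -scaleN1r; exact: in_LpWP.
have -> : a *: w + z - (a *: graph phi + graph psi) =
    a *: (w - graph phi) + (z - graph psi).
  by rewrite scalerBr opprD addrACA.
have Lwphi := subW _ _ Lw Lphi.
have La : in_LpW (a *: (w - graph phi)).
  by rewrite -[_ *: _]addr0; apply: in_LpWP => //; exact: in_LpW0.
rewrite (le_lt_trans (normWD La (subW _ _ Lz Lpsi)))// (splitr e) ler_ltD//.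
rewrite normWZ//.
have a1 : `|a| / (`|a| + 1) <= 1 by rewrite ler_pdivrMr ?mul1r ?lerDl// ltr_wpDl.
rewrite (le_trans (ler_wpM2l _ (ltW wphi)))// mulrCA.
by rewrite ler_piMr// divr_ge0// ltW.
Qed.

HB.instance Definition _ := GRing.isSubmodClosed.Build R _ W0_pred
  W0_submod_closed.

Definition W0_pre : Type := {w : fun_grad | w \in W0_pred}.
HB.instance Definition _ := SubChoice.on W0_pre.
HB.instance Definition _ := [SubChoice_isSubLmodule of W0_pre by <:].

Let W0_preP (w : W0_pre) : in_LpW (val w).
Proof. by have /asboolP[] := valP w. Qed.

Definition W0_seminorm : seminorm W0_pre :=
  @Seminorm R W0_pre (fun w => normW (val w))
    (fun w z => normWD (W0_preP w) (W0_preP z))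
    (fun a w => normWZ a (W0_preP w)).

Definition W0 : normedModType R := seminorm_quot W0_seminorm.

(* [fun_of u] and [nabla u] are representatives, determined up to equality almost
   everywhere in Omega and arbitrary outside Omega. *)
Definition fun_of (u : W0) : 'rV[R]_N -> R :=
  (val (repr (u : seminorm_quot W0_seminorm))).1.

Definition nabla (u : W0) : 'rV[R]_N -> 'rV[R]_N :=
  (val (repr (u : seminorm_quot W0_seminorm))).2.

End sobolev.

(* H^q(X, A; G) for A `<=` X in an ambient space T, both with the induced
   topology.  A q-cochain of X is represented by a function on tuples of points
   of T: its values outside X are discarded since it only matters modulo the
   functions that are locally zero on X. *)
Section alexander_spanier.
Context {T : topologicalType} {G : zmodType}.

Definition cochain (q : nat) : Type := ('I_q.+1 -> T) -> G.
HB.instance Definition _ q := GRing.Zmodule.on (cochain q).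

Definition locally_zero (X : set T) q (phi : cochain q) : Prop :=
  forall x, X x -> exists2 U, nbhs x U &
    forall t : 'I_q.+1 -> T, (forall i, X (t i) /\ U (t i)) -> phi t = 0.

Definition differential q (phi : cochain q) : cochain q.+1 :=
  fun t => \sum_(i < q.+2) phi (t \o lift i) *~ (-1) ^+ i.

Lemma locally_zero0 X q : locally_zero X (0 : cochain q).
Proof. by move=> x _; exists setT => //; exact: filterT. Qed.

Lemma locally_zeroB X q (phi psi : cochain q) :
  locally_zero X phi -> locally_zero X psi -> locally_zero X (phi - psi).
Proof.
move=> h k x Xx; have [U xU hU] := h _ Xx; have [V xV kV] := k _ Xx.
exists (U `&` V); first exact: filterI.
move=> t tUV; rewrite -[LHS]/(phi t - psi t) hU ?kV ?subr0//.
- by move=> i; have [? []] := tUV i.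
- by move=> i; have [? []] := tUV i.
Qed.

Lemma differential0 q : differential (0 : cochain q) = 0.
Proof. by apply/funext => t; rewrite /differential big1// => i _; rewrite mul0rz. Qed.

Lemma differentialB q (phi psi : cochain q) :
  differential (phi - psi) = differential phi - differential psi.
Proof.
apply/funext => t; rewrite -[RHS]/(differential phi t - differential psi t).
by rewrite /differential -sumrB; apply: eq_bigr => i _; rewrite -mulrzBl.
Qed.

Section cohomology.
Variables (X A : set T) (q : nat).

(* The relative cochains C^q(X, A) are the kernel of C^q(X) -> C^q(A), i.e. the
   cochains that are locally zero on A. *)
Definition cocycle : {pred cochain q} :=
  [pred phi | `[< locally_zero A phi /\ locally_zero X (differential phi) >]].

Let cocycle_zmod_closed : zmod_closed cocycle.
Proof.
split=> [|phi psi].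
  by apply/asboolP; rewrite differential0; split; exact: locally_zero0.
move=> /asboolP[? ?] /asboolP[? ?]; apply/asboolP.
by rewrite differentialB; split; exact: locally_zeroB.
Qed.

HB.instance Definition _ := GRing.isZmodClosed.Build (cochain q) cocycle
  cocycle_zmod_closed.

Definition cocycle_type : Type := {phi : cochain q | phi \in cocycle}.
HB.instance Definition _ := SubChoice.on cocycle_type.
HB.instance Definition _ := [SubChoice_isSubZmodule of cocycle_type by <:].

End cohomology.

Definition is_coboundary (X A : set T) q : cochain q -> Prop :=
  match q with
  | 0 => fun phi => locally_zero X phi
  | q'.+1 => fun phi => exists psi : cochain q',
      locally_zero A psi /\ locally_zero X (phi - differential psi)
  end.

Section cohomology.
Variables (X A : set T) (q : nat).

Definition coboundary : {pred cocycle_type X A q} :=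
  [pred phi | `[< is_coboundary X A (val phi) >]].

Let coboundary_zmod_closed : zmod_closed coboundary.
Proof.
rewrite /coboundary; split=> [|phi psi].
  apply/asboolP; case: q => [|k] /=; first exact: locally_zero0.
  exists 0; rewrite differential0 subr0; split; exact: locally_zero0.
move=> /asboolP h /asboolP k; apply/asboolP.
rewrite (_ : val (phi - psi) = val phi - val psi)//.
move: (val phi) (val psi) h k => {phi psi}; case: q => [|n] phi psi /=.
  exact: locally_zeroB.
move=> [a [a0 ha]] [b [b0 hb]]; exists (a - b); split; first exact: locally_zeroB.
have := locally_zeroB ha hb.
by rewrite differentialB opprD addrACA opprD.
Qed.

HB.instance Definition _ := GRing.isZmodClosed.Build _ coboundary
  coboundary_zmod_closed.

Definition AS_cohomology : zmodType := Quotient.quot coboundary.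

End cohomology.

End alexander_spanier.
Arguments AS_cohomology {T} G X A q.

Section critical.
Context {R : realType} {V : normedModType R}.
Implicit Types (f : V -> R) (u : V).

Definition critical_point f u := differentiable f u /\ forall v, 'd f u v = 0.

Definition strict_local_min f u :=
  exists2 e, 0 < e & forall v, v != u -> `|v - u| < e -> f u < f v.

Definition isolated_critical_point f u :=
  critical_point f u /\
  exists2 e, 0 < e & forall v, `|v - u| < e -> critical_point f v -> v = u.

Definition sublevel f (c : R) : set V := [set u | f u <= c].

Definition critical_group (G : zmodType) f u (m : nat) : zmodType :=
  AS_cohomology G (sublevel f (f u)) (sublevel f (f u) `\ u) m.

End critical.

Definition zmod_isomorphic (G H : zmodType) :=
  exists h : {additive G -> H}, bijective h.

Section dimension.
Context {R : realType} {V : lmodType R}.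
Local Open Scope ereal_scope.

Definition is_subspace (S : set V) :=
  S 0%R /\ forall (a : R) u v, S u -> S v -> S (a *: u + v)%R.

Definition lin_indep k (e : 'I_k -> V) :=
  forall a : 'I_k -> R, (\sum_i a i *: e i = 0 -> forall i, a i = 0)%R.

(* Supremum of the sizes of the independent families, +oo in infinite dimension. *)
Definition dimension (S : set V) : \bar R :=
  ereal_sup [set k%:R%:E | k in
    [set k : nat | exists2 e : 'I_k -> V, lin_indep e & forall i, S (e i)]].

Definition morse_index (X : set V) (Q : V -> R) : \bar R :=
  ereal_sup [set dimension S | S in [set S | [/\ is_subspace S, S `<=` X &
    forall v, S v -> v != 0%R -> (Q v < 0)%R]]].

Definition large_morse_index (X : set V) (Q : V -> R) : \bar R :=
  ereal_sup [set dimension S | S in [set S | [/\ is_subspace S, S `<=` X &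
    forall v, S v -> (Q v <= 0)%R]]].

End dimension.

Section assumptions.
Context {R : realType} {N : nat}.
Implicit Types (Omega : set 'rV[R]_N) (Psi : 'rV[R]_N -> R)
  (g : 'rV[R]_N -> R -> R).

(* Hoelder continuity is required globally: it can be achieved by a cut-off, as
   only the values of gamma near one point matter below. *)
Definition class_C1alpha n (alpha : R) (gamma : 'rV[R]_n -> R) :=
  (forall y, differentiable gamma y) /\
  exists C, forall y z,
    enorm (grad gamma y - grad gamma z) <= C * enorm (y - z) `^ alpha.

(* Near each boundary point, after relabelling and reorienting the axes, Omega
   is the region above the graph of a C^{1,alpha} function of N - 1 variables. *)
Definition C1alpha_boundary alpha Omega :=
  forall x0, (closure Omega `\` interior Omega) x0 ->
  exists (i : 'I_N) (s : bool) (gamma : 'rV[R]_N.-1 -> R),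
    class_C1alpha alpha gamma /\
    \forall x \near x0,
      Omega x <-> 0 < (-1) ^+ s * (x ord0 i - gamma (col' i x)).

Definition Psi_p0 (p : R) (xi : 'rV[R]_N) : R := p^-1 * enorm xi `^ p.

Definition class_C1 Psi :=
  (forall xi, differentiable Psi xi) /\ forall i, continuous (partial i Psi).

Definition class_C2_off0 Psi :=
  forall xi, xi != 0 -> forall i, differentiable (partial i Psi) xi /\
    forall j, {for xi, continuous (partial j (partial i Psi))}.

Definition Psi_assumptions (p : R) Psi :=
  [/\ class_C1 Psi, Psi 0 = 0, grad Psi 0 = 0,
      exists nu C : R, [/\ 0 < nu, nu <= C,
        convex_function setT (fun xi => Psi xi - nu * Psi_p0 p xi) &
        convex_function setT (fun xi => C * Psi_p0 p xi - Psi xi)] &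
      class_C2_off0 Psi].

Definition ae_in Omega (P : 'rV[R]_N -> Prop) :=
  {ae @lebesgue_rV R N, forall x, Omega x -> P x}.

(* Measurability w.r.t. the completed sigma-algebra: equal almost everywhere to
   a Borel function. *)
Definition lebesgue_measurable Omega (h : 'rV[R]_N -> R) :=
  exists2 h0 : 'rV[R]_N -> R, measurable_fun Omega h0 &
    ae_in Omega (fun x => h x = h0 x).

Definition g_growth (p : R) Omega g :=
  [/\ p < N%:R -> exists C q : R, [/\ 0 < C, 0 < q,
        q <= N%:R * p / (N%:R - p) - 1 &
        ae_in Omega (fun x => forall s, `|g x s| <= C * (1 + `|s| `^ q))],
      p = N%:R -> exists C q : R, [/\ 0 < C, 0 < q &
        ae_in Omega (fun x => forall s, `|g x s| <= C * (1 + `|s| `^ q))] &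
      N%:R < p -> forall S, 0 < S -> exists2 CS : R, 0 < CS &
        ae_in Omega (fun x => forall s, `|s| <= S -> `|g x s| <= CS)].

Definition g_assumptions (p : R) Omega g :=
  [/\ forall s, lebesgue_measurable Omega (g ^~ s),
      ae_in Omega (fun x =>
        (forall s, derivable (g x) s 1) /\ continuous (derive1 (g x))),
      g_growth p Omega g &
      forall S, 0 < S -> exists2 CS : R, 0 < CS &
        ae_in Omega (fun x => forall s, `|s| <= S -> `|derive1 (g x) s| <= CS)].

Definition primitive (h : R -> R) (s : R) : R :=
  if 0 <= s then \int[lebesgue_measure]_(t in `[0, s]) h t
  else - \int[lebesgue_measure]_(t in `[s, 0]) h t.

End assumptions.

Section functional.
Context {R : realType} {N : nat}.
Variables (Omega : set 'rV[R]_N) (p : R) (p1 : 1 <= p).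
Variables (Psi : 'rV[R]_N -> R) (g : 'rV[R]_N -> R -> R).

Let mu := @lebesgue_rV R N.

(* The second integrand is measurable for the completed sigma-algebra only; the
   integral, a supremum over Borel simple functions below the positive and
   negative parts, is then the Lebesgue integral. *)
Definition energy (u : W0 Omega p1) : R :=
  \int[mu]_(x in Omega) Psi (nabla u x)
  - \int[mu]_(x in Omega) primitive (g x) (fun_of u x).

Definition one_le2 : 1 <= 2 :> R := ler1n R 2.

Definition Z_set (u0 : W0 Omega p1) : set 'rV[R]_N :=
  Omega `&` [set x | nabla u0 x = 0].

Definition X_space (u0 : W0 Omega p1) : set (W0 Omega one_le2) :=
  [set v | ae_in (Z_set u0) (fun x => nabla v x = 0) /\
    mu.-integrable (Omega `\` Z_set u0)
      (fun x => (enorm (nabla v x) ^+ 2 / enorm (nabla u0 x) `^ (2 - p))%:E)].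

Definition hessian_form (xi v : 'rV[R]_N) : R :=
  \sum_i \sum_j partial j (partial i Psi) xi * v ord0 i * v ord0 j.

Definition Q_form (u0 : W0 Omega p1) (v : W0 Omega one_le2) : R :=
  \int[mu]_(x in Omega `\` Z_set u0) hessian_form (nabla u0 x) (nabla v x)
  - \int[mu]_(x in Omega) (derive1 (g x) (fun_of u0 x) * fun_of v x ^+ 2).

Definition morse (u0 : W0 Omega p1) : \bar R :=
  morse_index (X_space u0) (Q_form u0).

Definition large_morse (u0 : W0 Omega p1) : \bar R :=
  large_morse_index (X_space u0) (Q_form u0).

End functional.

Arguments energy {R N} Omega {p} p1 Psi g u.
Arguments morse {R N} Omega {p} p1 Psi g u0.
Arguments large_morse {R N} Omega {p} p1 Psi g u0.

(* Main.v *)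
Require Import Defs.
From HB Require Import structures.
From mathcomp Require Import all_boot all_order all_algebra.
From mathcomp Require Import all_classical all_reals all_analysis measurable_realfun.
From mathcomp Require Import ring lra.
Set Implicit Arguments.
Unset Strict Implicit.
Unset Printing Implicit Defensive.
Import Order.TTheory GRing.Theory Num.Theory.
Import numFieldNormedType.Exports.
Local Open Scope classical_set_scope.
Local Open Scope ring_scope.

(** Shrinking a small function [u != 0] towards zero decreases the energy [E] at a
    definite rate; all assertions but those on the Morse indices follow from that.

    The convexity of [Psi - nu * Psi_p0] gives
    [nu * t * |xi| ^ p <= Psi xi - Psi ((1 - t) *: xi)] up to a constant factor
    ([Psi_bounds]). On the other hand the primitive term is of higher order in the
    gradient norm [T] of [u]. Indeed, expanding [E] along multiples of a test
    function shows that [g x 0 = 0] for almost every [x], because zero is critical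
    and [p > 1] ([ae_source_at0_eq0]). The bound on the derivative of [g] then makes
    [g x s] at most linear for small [s], which is better than [|s| ^ (p - 1)]
    since [p < 2]; for large [s] its growth is critical at worst. With the Sobolev
    inequality, or a uniform bound in dimension one, this bounds the change of the
    primitive term between [u] and [(1 - t) *: u] by [t * K * T ^ r] for some
    [r > p] ([superlinear_majorant]).
    Hence, for [T] small and positive,
    [t * c <= E u - E ((1 - t) *: u)] for all [t] in [[0, 1]], with [c > 0]
    ([energy_ray], [energy_gap]).

    At [t = 1] this says that zero is a strict local minimum. As [t] tends to zero
    it says that the derivative of [E] at [u] in the direction of [u] is positive,
    so that zero is an isolated critical point. Strictness makes zero an isolated
    point of its sublevel set, whose relative cohomology is that of a point
    ([AS_cohomology_isolated0], [AS_cohomology_isolatedS]). Finally the gradient of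
    the zero function vanishes everywhere, so the space on which the quadratic form
    is defined contains only functions with zero gradient. By the Poincare
    inequality it is trivial, and both Morse indices are zero.

    The Sobolev and Poincare inequalities are derived from the Gagliardo-Nirenberg
    inequality, proved by induction on the dimension in a dual form
    ([gns_dual_holds]), and carried over from test functions to their closure by
    almost everywhere convergence and Fatou's lemma. The integrands that involve [g]
    agree with Borel functions only almost everywhere, hence the comparison of
    integrals up to null sets and the Borel versions of primitives
    ([primitive_measurable_version]). *)

(** * Borel sets and Lebesgue measure on row vectors *)

(* Simplification would expose the pushforward that the measure is made of. *)
#[global] Arguments lebesgue_rV {R} n : simpl never.

Lemma rV_norm_lt {R : realType} n (x : 'rV[R]_n) (e : R) : 0 < e ->
  (`|x| < e) <-> forall i, `|x ord0 i| < e.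
Proof.
move=> e0; rewrite [`|x|]mx_normrE; split=> [h i|h].
  by apply: le_lt_trans h; exact: (le_bigmax _ (fun ij => `|x ij.1 ij.2|) (ord0, i)).
by apply/bigmax_ltP; split=> // -[i j] _ /=; rewrite (ord1 i).
Qed.

Section rV_measurability.
Context {R : realType} {n : nat}.
Implicit Types A : set 'rV[R]_n.

Definition open_box (a b : 'rV[R]_n) : set 'rV[R]_n :=
  [set x | forall i, a ord0 i < x ord0 i < b ord0 i].

Lemma measurable_rV_coordwise (P : 'I_n -> set R) : (forall i, measurable (P i)) ->
  measurable [set x : 'rV[R]_n | forall i, P i (x ord0 i)].
Proof.
move=> mP; rewrite (_ : [set x | _] = \bigcap_(i in [set: 'I_n]) (rV_coord i @^-1` P i)).
  apply: fin_bigcap_measurable => // i _; rewrite -[X in measurable X]setTI.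
  exact: (@measurable_rV_coord R n i measurableT _ (mP i)).
by apply/seteqP; split=> x /= h i; [move=> _|]; exact: h.
Qed.

Lemma measurable_open_box a b : measurable (open_box a b).
Proof.
apply: (@measurable_rV_coordwise (fun i => `]a ord0 i, b ord0 i[%classic)) => i.
exact: measurable_itv.
Qed.

(** Countably many boxes, used to cover open sets; the free factor [c] gives
    each centre two concentric boxes. *)
Definition rat_box (q : 'rV[rat]_n) (m : nat) (c : R) : set 'rV[R]_n :=
  open_box (\row_i (ratr (q ord0 i) - c * m.+1%:R^-1)) (\row_i (ratr (q ord0 i) + c * m.+1%:R^-1)).

Lemma rat_boxP q m c x :
  rat_box q m c x <-> forall i, `|x ord0 i - ratr (q ord0 i)| < c * m.+1%:R^-1.
Proof.
by split=> h i; have := h i; rewrite !mxE ltr_distl.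
Qed.

(** The larger box leaves room around the smaller one, so that closed boxes
    inside the latter stay inside [A]. *)
Lemma open_rat_box A x : open A -> A x ->
  exists q m, rat_box q m 1 x /\ rat_box q m 2 `<=` A.
Proof.
move=> oA Ax.
have /nbhs_ballP[e /= e0 hA] : nbhs x A by exact: open_nbhs_nbhs.
have [m me] : exists m : nat, m.+1%:R^-1 < e / 3.
  have e3 : 0 < e / 3 by rewrite divr_gt0.
  exists (Num.truncn (e / 3)^-1); rewrite -[ltRHS]invrK ltf_pV2 ?posrE ?invr_gt0//.
  exact: truncnS_gt.
have mi0 : 0 < m.+1%:R^-1 :> R by rewrite invr_gt0.
have hq i : exists q : rat, `|x ord0 i - ratr q| < m.+1%:R^-1.
  have /rat_in_itvoo[q /andP[q1 q2]] : x ord0 i - m.+1%:R^-1 < x ord0 i + m.+1%:R^-1.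
    by rewrite ltrD2l gtrN.
  by exists q; rewrite distrC ltr_distl; apply/andP.
have [q hq'] := choice hq.
exists (\row_i q i), m; split; first by apply/rat_boxP => i; rewrite mxE mul1r.
move=> y /rat_boxP hy; apply: hA; rewrite -ball_normE /=; apply/rV_norm_lt => // i.
have := hy i; rewrite !mxE => hyi; have := hq' i => hxi.
rewrite (_ : _ - _ = (x ord0 i - ratr (q i)) - (y ord0 i - ratr (q i))); last by ring.
rewrite (le_lt_trans (ler_normB _ _))//.
by move: hyi hxi me; move: (m.+1%:R^-1) => c; lra.
Qed.

Lemma open_bigcup_rat_box A : open A ->
  A = \bigcup_(qm in [set qm : 'rV[rat]_n * nat | rat_box qm.1 qm.2 2 `<=` A])
        rat_box qm.1 qm.2 1.
Proof.
move=> oA; apply/seteqP; split=> [x Ax|x [[q m] /= qmA xqm]].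
  by have [q [m [h1 h2]]] := open_rat_box oA Ax; exists (q, m).
apply: qmA; apply/rat_boxP => i; move/rat_boxP : xqm => /(_ i) h.
by rewrite (lt_le_trans h)// ler_wpM2r// ?invr_ge0// ler1n.
Qed.

Lemma open_measurable_rV A : open A -> measurable A.
Proof.
move=> oA; rewrite (open_bigcup_rat_box oA) bigcup_mkcond.
apply: countable_bigcupT_measurable => // -[q m].
by case: ifP => // _; exact: measurable_open_box.
Qed.

Lemma continuous_measurable_rV (f : 'rV[R]_n -> R) : continuous f ->
  measurable_fun [set: 'rV[R]_n] f.
Proof.
move=> /continuousP cf; apply: (measurability _ (RGenOpens.measurableE R)).
move=> _ [_ [a [b ->] <-]]; rewrite setTI; apply: open_measurable_rV.
by apply: cf; exact: interval_open.
Qed.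

End rV_measurability.

Section lebesgue_rV_integration.
Context {R : realType}.
Local Open Scope ereal_scope.
Notation leb := (@lebesgue_measure R).

(** The measure is the image of a product measure, so this is Tonelli's
    theorem; [lebesgue_rV] is handled below through this recursion only. *)
Lemma ge0_integral_rVS n (f : 'rV[R]_n.+1 -> \bar R) : measurable_fun [set: 'rV[R]_n.+1] f ->
  (forall x, 0 <= f x) ->
  \int[lebesgue_rV n.+1]_x f x =
  \int[leb]_t \int[lebesgue_rV n]_y f (cons_rV (t, y)).
Proof.
move=> mf f0; rewrite /lebesgue_rV -/lebesgue_rV.
transitivity (\int[pushforward (leb \x lebesgue_rV n) (@cons_rV R n)]_x f x).
  by [].
rewrite (ge0_integral_pushforward (@measurable_cons_rV R n))//.
rewrite preimage_setT fubini_tonelli1//.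
by apply: measurableT_comp => //; exact: measurable_cons_rV.
by move=> x /=.
Qed.

Lemma ge0_integral_rVS_swap n (f : 'rV[R]_n.+1 -> \bar R) : measurable_fun [set: 'rV[R]_n.+1] f ->
  (forall x, 0 <= f x) ->
  \int[lebesgue_rV n.+1]_x f x =
  \int[lebesgue_rV n]_y \int[leb]_t f (cons_rV (t, y)).
Proof.
move=> mf f0; rewrite ge0_integral_rVS//.
apply: (@fubini_tonelli _ _ _ _ _ leb (lebesgue_rV n) (f \o @cons_rV R n)) => //.
  by apply: measurableT_comp => //; exact: measurable_cons_rV.
by move=> x /=.
Qed.

Lemma measurable_cube k (M : R) :
  measurable [set x : 'rV[R]_k | forall i, (- M <= x ord0 i <= M)%R].
Proof.
rewrite (_ : [set x | _] = [set x : 'rV[R]_k | forall i, `[(- M)%R, M]%classic (x ord0 i)]).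
  by apply: (@measurable_rV_coordwise _ _ (fun=> `[(- M)%R, M]%classic)) => i; exact: measurable_itv.
by apply/seteqP; split=> x /= h i; have := h i; rewrite in_itv.
Qed.

Lemma lebesgue_rV_cube_lty n (M : R) :
  lebesgue_rV n [set x : 'rV[R]_n | forall i, (- M <= x ord0 i <= M)%R] < +oo.
Proof.
elim: n => [|n IH].
  rewrite -[lebesgue_rV 0 _]/(dirac (0%R : 'rV[R]_0) _) diracE; by case: (_ \in _) => /=; rewrite ltry.
rewrite /lebesgue_rV -/lebesgue_rV /= /cons_measure /pushforward.
rewrite (_ : _ @^-1` _ = `[(- M)%R, M]%classic `*`
   [set x : 'rV[R]_n | forall i, (- M <= x ord0 i <= M)%R]).
  rewrite product_measure1E//; last exact: measurable_cube.
  have hl : leb `[(- M)%R, M]%classic < +oo.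
    by rewrite lebesgue_measure_itv/=; case: ifP => // _; rewrite ltry.
  apply: lte_mul_pinfty => //.
  by rewrite ge0_fin_numE.
apply/seteqP; split=> [[t y] /= h|[t y] /= [h1 h2] i].
  split; first by have := h ord0; rewrite mxE unlift_none/= in_itv.
  by move=> i; have := h (lift ord0 i); rewrite mxE liftK/=.
rewrite mxE; case: unliftP => [j|] _ /=; first exact: h2.
by move: h1; rewrite in_itv.
Qed.

Lemma bounded_rV_cube n (A : set 'rV[R]_n) : bounded_set A ->
  exists2 M : R, (0 < M)%R & A `<=` [set x : 'rV[R]_n | forall i, (- M <= x ord0 i <= M)%R].
Proof.
move=> [M0 [_ hM]]; pose M := (`|M0| + 1)%R.
have M0M : (M0 < M)%R by rewrite (le_lt_trans (ler_norm _))// ltrDl.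
have M1 : (0 < M + 1)%R by rewrite addr_gt0// ltr_wpDl.
exists (M + 1)%R => // x Ax i; rewrite -ler_norml.
apply/ltW; move: i; apply/rV_norm_lt => //.
by rewrite (le_lt_trans (hM _ M0M _ Ax))// ltrDl.
Qed.

Lemma lebesgue_rV_bounded_lty n (A : set 'rV[R]_n) : measurable A -> bounded_set A ->
  lebesgue_rV n A < +oo.
Proof.
move=> mA /bounded_rV_cube[M M0 AM]; apply: le_lt_trans (lebesgue_rV_cube_lty n M).
apply: le_measure; rewrite ?inE//.
exact: measurable_cube.
Qed.

End lebesgue_rV_integration.

(** * Integrals up to null sets *)

Section nonmeasurable_integrands.
Local Open Scope ereal_scope.
Context d (T : measurableType d) (R : realType).
Variables (mu : {measure set T -> \bar R}) (D : set T).
Import HBNNSimple.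

(** The integral is a supremum over simple functions lying below the integrand;
    multiplying such a function by the indicator of the complement of a null
    set keeps its integral and brings it below [g]. Hence comparison holds for
    arbitrary integrands, such as superpositions with [g x] that are measurable
    for the completed sigma-algebra only. *)
Lemma ge0_le_integral_ae (f g : T -> \bar R) : (forall x, D x -> 0 <= f x) ->
  (forall x, D x -> 0 <= g x) -> {ae mu, forall x, D x -> f x <= g x} ->
  \int[mu]_(x in D) f x <= \int[mu]_(x in D) g x.
Proof.
move=> f0 g0 [A [mA A0 hA]]; rewrite (ge0_integralE _ f0) (ge0_integralE _ g0).
apply: ub_ereal_sup => _ [h hf <-].
pose h' := mul_nnsfun h (indic_nnsfun R (measurableC mA)).
have h'E x : h' x = (h x * \1_(~` A) x)%R by [].
have hh' : sintegral mu h = sintegral mu h'.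
  rewrite -!integralT_nnsfun; apply: ge0_ae_eq_integral => //.
  - exact/measurable_EFinP.
  - exact/measurable_EFinP.
  - by move=> x _; rewrite lee_fin.
  - by move=> x _; rewrite lee_fin.
  exists A; split => // x hx; apply: contrapT => Ax; apply: hx => _.
  by apply: (congr1 EFin); rewrite h'E indicE mem_set// mulr1.
rewrite hh'; apply: ereal_sup_ubound; exists h' => // x.
rewrite h'E indicE; have [Ax|Ax] := pselect (A x).
  rewrite memNset ?mulr0; last by move=> /(_ Ax).
  by rewrite /patch; case: ifPn => //; rewrite inE => /g0.
rewrite mem_set// mulr1; apply: le_trans (hf x) _.
rewrite /patch; case: ifPn => //; rewrite inE => Dx.
by apply: contrapT => fg; apply: Ax; apply: hA => /= /(_ Dx).
Qed.

Lemma eq_integral_ae (f g : T -> \bar R) : {ae mu, forall x, D x -> f x = g x} ->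
  \int[mu]_(x in D) f x = \int[mu]_(x in D) g x.
Proof.
move=> fg; rewrite integralE [RHS]integralE; congr (_ - _);
  apply/eqP; rewrite eq_le; apply/andP; split; apply: ge0_le_integral_ae => //;
  apply: filterS fg => x h /h; rewrite ?funeposE ?funenegE => ->; exact: lexx.
Qed.

End nonmeasurable_integrands.

Section ae_in.
Context {R : realType} {N : nat}.
Variables (Omega : set 'rV[R]_N).
Implicit Types P Q S : 'rV[R]_N -> Prop.

Lemma ae_in_all P : (forall x, Omega x -> P x) -> ae_in Omega P.
Proof. by move=> h; apply: aeW. Qed.

Lemma ae_inS P Q : (forall x, Omega x -> P x -> Q x) -> ae_in Omega P -> ae_in Omega Q.
Proof. rewrite /ae_in; move=> h; apply: filterS => x Px Ox; apply: h => //; exact: Px. Qed.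

Lemma ae_inS2 P Q S : (forall x, Omega x -> P x -> Q x -> S x) ->
  ae_in Omega P -> ae_in Omega Q -> ae_in Omega S.
Proof.
rewrite /ae_in; move=> h; apply: filterS2 => x Px Qx Ox; apply: h => //; [exact: Px|exact: Qx].
Qed.

Lemma ae_inS3 P Q S T : (forall x, Omega x -> P x -> Q x -> S x -> T x) ->
  ae_in Omega P -> ae_in Omega Q -> ae_in Omega S -> ae_in Omega T.
Proof.
rewrite /ae_in; move=> h; apply: filterS3 => x Px Qx Sx Ox; apply: h => //; [exact: Px|exact: Qx|exact: Sx].
Qed.

Lemma ae_in_forall (I : finType) (P : I -> 'rV[R]_N -> Prop) :
  (forall i, ae_in Omega (P i)) -> ae_in Omega (fun x => forall i, P i x).
Proof.
move=> h; have this : {ae @lebesgue_rV R N, forall x, forall i, Omega x -> P i x} by exact: filter_forall.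
rewrite /ae_in; move: this; apply: filterS => x Px Ox i; exact: Px.
Qed.

Lemma ae_in_forallN (P : nat -> 'rV[R]_N -> Prop) :
  (forall i, ae_in Omega (P i)) -> ae_in Omega (fun x => forall i, P i x).
Proof.
move=> h; have this : {ae @lebesgue_rV R N, forall x, forall i, Omega x -> P i x} by exact/ae_foralln.
rewrite /ae_in; move: this; apply: filterS => x Px Ox i; exact: Px.
Qed.

End ae_in.

(** * The Gagliardo-Nirenberg inequality *)

Section gagliardo_nirenberg.
Context {R : realType}.
Local Open Scope ereal_scope.
Notation leb := (@lebesgue_measure R).

Definition upd n (x : 'rV[R]_n) (i : 'I_n) (t : R) : 'rV[R]_n :=
  \row_j (if j == i then t else x ord0 j).

Definition cube_supported n (f : 'rV[R]_n -> R) := exists M L : R,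
  [/\ 0 <= M, 0 <= L, forall x, 0 <= f x <= M &
      forall x, f x != 0 -> forall i, `|x ord0 i| <= L]%R.

(** For a compactly supported function [u] with [w] a norm of its gradient, this
    is the fundamental theorem of calculus on every coordinate line. *)
Definition line_bounded n (u w : 'rV[R]_n -> R) := forall i x,
  (u x)%:E <= \int[leb]_t (w (upd x i t))%:E.

Lemma upd_cons0 n (y : 'rV[R]_n) (t s : R) :
  upd (cons_rV (t, y)) ord0 s = cons_rV (s, y).
Proof.
by apply/rowP => j; rewrite !mxE; case: unliftP => [k ->|->] //=; rewrite eqxx.
Qed.

Lemma upd_consS n (y : 'rV[R]_n) (t s : R) i :
  upd (cons_rV (t, y)) (lift ord0 i) s = cons_rV (t, upd y i s).
Proof.
apply/rowP => j; rewrite !mxE; case: unliftP => [k ->|->] //=.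
by rewrite mxE.
Qed.

Lemma cons_rV_coord0 n (z : R * 'rV[R]_n) : cons_rV z ord0 ord0 = z.1.
Proof. by rewrite mxE unlift_none. Qed.

Lemma cons_rV_coordS n (z : R * 'rV[R]_n) i : cons_rV z ord0 (lift ord0 i) = z.2 ord0 i.
Proof. by rewrite mxE liftK. Qed.

Lemma measurable_slice n d (T : measurableType d) (f : 'rV[R]_n.+1 -> T) (t : R) :
  measurable_fun [set: 'rV[R]_n.+1] f ->
  measurable_fun [set: 'rV[R]_n] (fun y => f (cons_rV (t, y))).
Proof.
move=> mf; apply: (measurableT_comp mf).
exact: (measurableT_comp (@measurable_cons_rV R n) (pair1_measurable t)).
Qed.

Lemma measurable_line n d (T : measurableType d) (f : 'rV[R]_n.+1 -> T) (y : 'rV[R]_n) :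
  measurable_fun [set: 'rV[R]_n.+1] f ->
  measurable_fun [set: measurableTypeR R] (fun t => f (cons_rV (t, y))).
Proof.
move=> mf; apply: (measurableT_comp mf).
exact: (measurableT_comp (@measurable_cons_rV R n) (pair2_measurable y)).
Qed.

Lemma integral_line_le (h : R -> R) (M L : R) : measurable_fun [set: R] h ->
  (0 <= L)%R -> (forall t, 0 <= h t <= M)%R -> (forall t, h t != 0 -> `|t| <= L)%R ->
  \int[leb]_t (h t)%:E <= (M * (2 * L))%:E.
Proof.
move=> mh L0 hM hL.
have M0 : (0 <= M)%R by have /andP[h0] := hM 0%R; exact: le_trans.
have -> : (M * (2 * L))%:E = \int[leb]_(t in `[(- L)%R, L]%classic) M%:E.
  rewrite integral_cst/=; last exact: measurable_itv.
  rewrite lebesgue_measure_itv/= lte_fin; case: ifPn => [_|].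
    by rewrite -EFinD -EFinM; congr EFin; ring.
  rewrite -leNgt => LL; have -> : L = 0%R by lra.
  by rewrite mulr0 mulr0 mule0.
rewrite [leRHS]integral_mkcond/=; apply: ge0_le_integral => //.
- by move=> t _; rewrite lee_fin; have /andP[] := hM t.
- exact/measurable_EFinP.
- apply/(measurable_restrictT _ _).1 => //; exact: measurable_itv.
- move=> t _; rewrite /patch; case: ifPn => [_|].
    by rewrite lee_fin; have /andP[] := hM t.
  rewrite notin_setE /= in_itv /= -ler_norml => htL.
  have -> : h t = 0%R by apply: contrapT => /eqP /hL.
  by rewrite lexx.
Qed.

Section slices.
Variable n : nat.
Let a : R := (n.+1%:R)^-1.

Variables (w : 'rV[R]_n.+2 -> R).
Hypothesis mw : measurable_fun [set: 'rV[R]_n.+2] w.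
Hypothesis cw : cube_supported w.

Let w0 x : (0 <= w x)%R.
Proof. by have [M [L [_ _ h _]]] := cw; have /andP[] := h x. Qed.

Definition line_integral (y : 'rV[R]_n.+1) : R := fine (\int[leb]_s (w (cons_rV (s, y)))%:E).

Lemma line_integralE y : (line_integral y)%:E = \int[leb]_s (w (cons_rV (s, y)))%:E.
Proof.
rewrite fineK// ge0_fin_numE; last by apply: integral_ge0 => s _; rewrite lee_fin.
have [M [L [M0 L0 h1 h2]]] := cw.
apply: le_lt_trans (ltry (M * (2 * L))%R); apply: integral_line_le => //.
  exact: measurable_line.
by move=> t /h2 /(_ ord0); rewrite cons_rV_coord0.
Qed.

Lemma measurable_line_integral : measurable_fun [set: 'rV[R]_n.+1] line_integral.
Proof.
apply: (measurableT_comp (fine_measurable measurableT)).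
apply: (@measurable_fun_fubini_tonelli_G _ _ _ _ _ leb
   (fun z => (w (@cons_rV R _ z))%:E)) => //.
  by apply/measurable_EFinP; apply: measurableT_comp => //; exact: measurable_cons_rV.
by move=> z; rewrite lee_fin.
Qed.

Lemma cube_supported_line_integral : cube_supported line_integral.
Proof.
have [M [L [M0 L0 h1 h2]]] := cw.
exists (M * (2 * L))%R, L; split=> //; first by rewrite mulr_ge0// mulr_ge0.
  move=> y; rewrite -!lee_fin line_integralE; apply/andP; split.
    by apply: integral_ge0 => s _; rewrite lee_fin.
  apply: integral_line_le => //; first exact: measurable_line.
  by move=> t /h2 /(_ ord0); rewrite cons_rV_coord0.
move=> y y0 i; rewrite leNgt; apply/negP => Ly; move/negP: y0; apply; apply/eqP.
rewrite /line_integral integral0_eq// => t _; congr EFin.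
apply: contrapT => /eqP /h2 /(_ (lift ord0 i)).
by rewrite cons_rV_coordS/= leNgt Ly.
Qed.

Lemma integral_line_integral :
  \int[lebesgue_rV n.+1]_y (line_integral y)%:E = \int[lebesgue_rV n.+2]_x (w x)%:E.
Proof.
rewrite [RHS]ge0_integral_rVS_swap; last 2 first.
- exact/measurable_EFinP.
- by move=> x; rewrite lee_fin.
by apply: eq_integral => y _; rewrite line_integralE.
Qed.

End slices.

(** Dual form of the Gagliardo-Nirenberg inequality: the power of [u] is replaced
    by a test against a power of an arbitrary [f]. In this form the inequality
    starts from dimension one and goes up by induction, since [f] can be taken
    to be a line integral in the dimension below. *)
Definition gns_dual n := forall u w f : 'rV[R]_n.+1 -> R,
  measurable_fun [set: 'rV[R]_n.+1] u -> measurable_fun [set: 'rV[R]_n.+1] w ->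
  measurable_fun [set: 'rV[R]_n.+1] f ->
  (forall x, 0 <= u x)%R -> cube_supported w -> cube_supported f -> line_bounded u w ->
  \int[lebesgue_rV n.+1]_x (u x * f x `^ (n.+1%:R)^-1)%:E <=
  (\int[lebesgue_rV n.+1]_x (w x)%:E) * (\int[lebesgue_rV n.+1]_x (f x)%:E) `^ (n.+1%:R)^-1.

(** Along the first axis [u] is bounded by the line integral [F] of [w], so that
    [u ^ (1 + a) <= u * F ^ a] on each slice [t]; the dual inequality of one
    dimension less bounds the slice integral by that of [w] times [W ^ a], as
    [F] and [w] have the same integral [W]. Integrating in [t] gives the claim. *)
Lemma gns_from_dual n (u w : 'rV[R]_n.+2 -> R) : gns_dual n ->
  measurable_fun [set: 'rV[R]_n.+2] u -> measurable_fun [set: 'rV[R]_n.+2] w ->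
  (forall x, 0 <= u x)%R -> cube_supported w -> line_bounded u w ->
  \int[lebesgue_rV n.+2]_x (u x `^ (1 + (n.+1%:R)^-1))%:E <=
  (\int[lebesgue_rV n.+2]_x (w x)%:E) `^ (1 + (n.+1%:R)^-1).
Proof.
move=> K mu mw u0 cw uw; set a : R := (n.+1%:R^-1)%R.
have a0 : (0 < a)%R by rewrite invr_gt0.
have w0 x : (0 <= w x)%R by have [M [L [_ _ h _]]] := cw; have /andP[] := h x.
pose F := line_integral w.
have F0 y : (0 <= F y)%R.
  by have [M [L [_ _ h _]]] := cube_supported_line_integral mw cw; have /andP[] := h y.
have mF := measurable_line_integral mw cw.
have cF := cube_supported_line_integral mw cw.
have uF t y : (u (cons_rV (t, y)) <= F y)%R.
  rewrite -lee_fin /F line_integralE//.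
  apply: le_trans (uw ord0 (cons_rV (t, y))) _.
  by under eq_integral do rewrite upd_cons0.
have mpa : measurable_fun [set: R] (@powR R ^~ a) by exact: measurable_powR.
rewrite ge0_integral_rVS; last 2 first.
- by apply/measurable_EFinP; apply: (measurableT_comp (measurable_powR _)).
- by move=> x; rewrite lee_fin powR_ge0.
set W := \int[_]_x (w x)%:E.
have W0 : 0 <= W by apply: integral_ge0 => x _; rewrite lee_fin.
apply: (@le_trans _ _ (\int[leb]_t ((\int[lebesgue_rV n.+1]_y (w (cons_rV (t, y)))%:E) * W `^ a))).
  apply: ge0_le_integral => //.
  - by move=> t _; apply: integral_ge0 => y _; rewrite lee_fin powR_ge0.
  - apply: (@measurable_fun_fubini_tonelli_F _ _ _ _ _ (lebesgue_rV n.+1)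
      (fun z => (u (@cons_rV R _ z) `^ (1 + a))%:E)) => //.
      apply/measurable_EFinP; apply: (measurableT_comp (measurable_powR _)).
      by apply: measurableT_comp => //; exact: measurable_cons_rV.
    by move=> z; rewrite lee_fin powR_ge0.
  - apply: emeasurable_funM => //.
    apply: (@measurable_fun_fubini_tonelli_F _ _ _ _ _ (lebesgue_rV n.+1)
      (fun z => (w (@cons_rV R _ z))%:E)) => //.
      by apply/measurable_EFinP; apply: measurableT_comp => //; exact: measurable_cons_rV.
    by move=> z; rewrite lee_fin.
  - move=> t _.
    apply: (@le_trans _ _ (\int[lebesgue_rV n.+1]_y (u (cons_rV (t, y)) * F y `^ a)%:E)).
      apply: ge0_le_integral => //.
      + by move=> y _; rewrite lee_fin powR_ge0.
      + apply/measurable_EFinP; apply: (measurableT_comp (measurable_powR _)).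
        exact: measurable_slice.
      + apply/measurable_EFinP; apply: measurable_funM; first exact: measurable_slice.
        exact: (measurableT_comp (measurable_powR _)).
      + move=> y _; rewrite lee_fin powRD; last first.
          by apply/implyP; rewrite gt_eqF// addr_gt0.
        rewrite powRr1// ler_wpM2l// ge0_ler_powR ?nnegrE//; first exact: ltW.
    rewrite /W -(integral_line_integral mw cw).
    apply: K => //.
    + exact: measurable_slice.
    + exact: measurable_slice.
    + have [M [L [M0 L0 h1 h2]]] := cw; exists M, L; split=> // x /h2 + i => /(_ (lift ord0 i)).
      by rewrite cons_rV_coordS.
    + move=> i y; apply: le_trans (uw (lift ord0 i) (cons_rV (t, y))) _.
      by under eq_integral do rewrite upd_consS.
rewrite ge0_integralZr//; last 3 first.
- apply: (@measurable_fun_fubini_tonelli_F _ _ _ _ _ (lebesgue_rV n.+1)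
      (fun z => (w (@cons_rV R _ z))%:E)) => //.
    by apply/measurable_EFinP; apply: measurableT_comp => //; exact: measurable_cons_rV.
  by move=> z; rewrite lee_fin.
- by move=> t _; apply: integral_ge0 => y _; rewrite lee_fin.
- exact: poweR_ge0.
rewrite -(@ge0_integral_rVS _ _ (fun x => (w x)%:E)); last 2 first.
- exact/measurable_EFinP.
- by move=> x; rewrite lee_fin.
rewrite -/W poweRD; last first.
  by rewrite poweRD_defE gt_eqF// addr_gt0.
by rewrite poweRe1.
Qed.

(** Hoelder's inequality with exponents [1 + 1 / n.+1] and [n.+2] reduces the dual
    form to the power form of the same dimension. *)
Lemma gns_dualS n : gns_dual n -> gns_dual n.+1.
Proof.
move=> K u w f mu mw mf u0 cw cf uw.
have f0 x : (0 <= f x)%R by have [M [L [_ _ h _]]] := cf; have /andP[] := h x.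
set a : R := (n.+1%:R^-1)%R; set b : R := (n.+2%:R^-1)%R.
have a0 : (0 < a)%R by rewrite invr_gt0.
have b0 : (0 < b)%R by rewrite invr_gt0.
have n1 : (0 < n.+1%:R :> R)%R by [].
have n2 : (0 < n.+2%:R :> R)%R by [].
have ab : ((1 + a)^-1 + n.+2%:R^-1 = 1 :> R)%R.
  rewrite /a -natr1; move: (n.+1%:R : R) n1 => c c0; field.
  by rewrite !gt_eqF// addr_gt0.
have mfb : measurable_fun [set: 'rV[R]_n.+2] (fun x => f x `^ b)%R.
  exact: (measurableT_comp (measurable_powR _)).
have W0 : 0 <= \int[lebesgue_rV n.+2]_x (w x)%:E.
  have [M [L [_ _ h _]]] := cw.
  by apply: integral_ge0 => x _; rewrite lee_fin; have /andP[] := h x.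
have := @hoelder _ _ _ (lebesgue_rV n.+2) u (fun x => f x `^ b)%R (1 + a)%R n.+2%:R
  mu mfb (addr_gt0 ltr01 a0) n2 ab.
rewrite Lnorm1; under eq_integral => x _.
  rewrite /= ger0_norm ?mulr_ge0 ?powR_ge0//. over.
move/le_trans; apply; apply: lee_pmul; rewrite ?Lnorm_ge0//.
  rewrite unlock /= (eq_integral (fun x => (u x `^ (1 + a))%:E)); last first.
    by move=> x _; rewrite /= ger0_norm.
  have -> : \int[lebesgue_rV n.+2]_x (w x)%:E =
      ((\int[lebesgue_rV n.+2]_x (w x)%:E) `^ (1 + a)) `^ (1 + a)^-1.
    by rewrite -poweRrM mulfV ?gt_eqF ?addr_gt0// poweRe1.
  apply: gt0_ler_poweR; rewrite ?in_itv/= ?andbT ?leey ?invr_ge0 ?addr_ge0 ?(ltW a0)//.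
  - by rewrite integral_ge0// => x _; rewrite lee_fin powR_ge0.
  - by rewrite poweR_ge0.
  - exact: gns_from_dual.
rewrite unlock /= (eq_integral (fun x => (f x)%:E))//.
by move=> x _; rewrite /= ger0_norm ?powR_ge0// -powRrM mulVf ?gt_eqF// powRr1.
Qed.

Lemma integral_line_rV1 (w : 'rV[R]_1 -> R) (x : 'rV[R]_1) i :
  measurable_fun [set: 'rV[R]_1] w -> (forall x, 0 <= w x)%R ->
  \int[leb]_t (w (upd x i t))%:E = \int[lebesgue_rV 1]_x (w x)%:E.
Proof.
move=> mw w0; rewrite ge0_integral_rVS; last 2 first.
- exact/measurable_EFinP.
- by move=> y; rewrite lee_fin.
apply: eq_integral => t _.
transitivity (\int[dirac (0%R : 'rV[R]_0)]_y (w (cons_rV (t, y)))%:E); last by [].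
have ms : measurable_fun [set: 'rV[R]_0] (fun y => (w (cons_rV (t, y)))%:E).
  by apply/measurable_EFinP; exact: measurable_slice.
rewrite integral_dirac// diracE in_setT mul1e; congr (_%:E); congr w.
by apply/rowP => j; rewrite !ord1 !mxE unlift_none eqxx.
Qed.

Lemma gns_dual0 : gns_dual 0.
Proof.
move=> u w f mu mw mf u0 cw cf uw.
have f0 x : (0 <= f x)%R by have [M [L [_ _ h _]]] := cf; have /andP[] := h x.
have w0 x : (0 <= w x)%R by have [M [L [_ _ h _]]] := cw; have /andP[] := h x.
rewrite invr1 poweRe1; last by apply: integral_ge0 => x _; rewrite lee_fin.
rewrite -ge0_integralZl//; last 3 first.
- exact/measurable_EFinP.
- by move=> x _; rewrite lee_fin.
- by apply: integral_ge0 => x _; rewrite lee_fin.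
apply: ge0_le_integral => //.
- by move=> x _; rewrite lee_fin mulr_ge0// powR_ge0.
- apply/measurable_EFinP; apply: measurable_funM => //.
  exact: (measurableT_comp (measurable_powR _)).
- by apply: emeasurable_funM => //; exact/measurable_EFinP.
move=> x _; rewrite powRr1// EFinM lee_wpmul2r ?lee_fin//.
by rewrite -(integral_line_rV1 x ord0 mw w0); exact: uw.
Qed.

Lemma gns_dual_holds n : gns_dual n.
Proof. by elim: n => [|n IH]; [exact: gns_dual0|exact: gns_dualS]. Qed.

Lemma gagliardo_nirenberg1 n (u w : 'rV[R]_n.+2 -> R) :
  measurable_fun [set: 'rV[R]_n.+2] u -> measurable_fun [set: 'rV[R]_n.+2] w ->
  (forall x, 0 <= u x)%R -> cube_supported w -> line_bounded u w ->
  \int[lebesgue_rV n.+2]_x (u x `^ (1 + (n.+1%:R)^-1))%:E <=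
  (\int[lebesgue_rV n.+2]_x (w x)%:E) `^ (1 + (n.+1%:R)^-1).
Proof. by apply: gns_from_dual; exact: gns_dual_holds. Qed.

End gagliardo_nirenberg.

(** * Truncated powers and calculus along coordinate lines *)

Section positive_power.
Context {R : realType}.
Implicit Types r s : R.

(** Cutting off the negative part makes the power differentiable on the whole
    line for [r > 1], so that it can be composed with functions of any sign. *)
Definition ppow r s : R := Num.max s 0 `^ r.

Lemma ppow_ge0 r s : 0 <= ppow r s.
Proof. exact: powR_ge0. Qed.

Lemma ppow_pos r s : 0 <= s -> ppow r s = s `^ r.
Proof. by move=> s0; rewrite /ppow max_l. Qed.

Lemma ppow_neg r s : 0 < r -> s <= 0 -> ppow r s = 0.
Proof. by move=> r0 s0; rewrite /ppow max_r// powR0 ?gt_eqF. Qed.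

Lemma is_derive_ppow_pos r s : 0 < s -> is_derive s 1 (ppow r) (r * ppow (r - 1) s).
Proof.
move=> s0; rewrite ppow_pos ?ltW//.
apply: (@near_eq_is_derive _ _ _ (@powR R ^~ r)); last exact: is_derive1_powR.
by near=> t; rewrite ppow_pos//; apply/ltW; near: t; exact: lt_nbhsr.
Unshelve. end_near. Qed.

Lemma continuous_ppow r : 0 < r -> continuous (ppow r).
Proof.
move=> r0 s; have [s0|s0|->] := ltgtP s 0.
- have e : \forall t \near s, cst 0 t = ppow r t.
    by near=> t; rewrite ppow_neg//; apply/ltW; near: t; exact: lt_nbhsl.
  rewrite /continuous_at ppow_neg ?ltW//; apply: cvg_trans (near_eq_cvg e) _.
  exact: cvg_cst.
- have [h _] := is_derive_ppow_pos r s0.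
  by apply/differentiable_continuous/derivable1_diffP.
- rewrite /continuous_at ppow_neg//; apply/cvgrPdist_lt => e e0.
  near=> t; rewrite sub0r normrN ger0_norm ?ppow_ge0//.
  rewrite -[ltRHS]powRr1 ?ltW// -(@mulVf _ r) ?gt_eqF// powRrM.
  rewrite /ppow gt0_ltr_powR// ?nnegrE ?le_max ?lexx ?orbT ?powR_ge0//.
  rewrite gt_max powR_gt0// andbT; near: t; apply: lt_nbhsl.
  exact: powR_gt0.
Unshelve. all: by end_near. Qed.

Lemma is_derive_ppow r s : 1 < r -> is_derive s 1 (ppow r) (r * ppow (r - 1) s).
Proof.
move=> r1; have r0 : 0 < r by rewrite (lt_trans _ r1).
have [s0|s0|->] := ltgtP s 0.
- rewrite ppow_neg ?ltW ?subr_gt0// mulr0.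
  apply: (@near_eq_is_derive _ R R (cst 0)).
  by near=> t; rewrite ppow_neg//; apply/ltW; near: t; exact: lt_nbhsl.
- exact: is_derive_ppow_pos.
- rewrite ppow_neg ?subr_gt0// mulr0.
  have h : h^-1 *: (ppow r (h *: 1 + 0) - ppow r 0) @[h --> 0^'] --> (0 : R).
    have c : ppow (r - 1) h @[h --> 0^'] --> (0 : R).
      rewrite -[X in _ --> X](@ppow_neg (r - 1) 0) ?subr_gt0//.
      by apply: cvg_within_filter; apply: continuous_ppow; rewrite subr_gt0.
    apply: cvg_trans c; apply: near_eq_cvg; near=> h.
    have h0 : h != 0 by near: h; exact: nbhs_dnbhs_neq.
    rewrite [h *: 1]mulr1 addr0 [ppow r 0]ppow_neg// subr0 /GRing.scale/=.
    have [hp|hn] := leP 0 h.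
      by rewrite !ppow_pos// -(@mulr_powRB1 _ h r)// mulrA mulVf// mul1r.
    by rewrite !ppow_neg ?subr_gt0 ?ltW// mulr0.
  apply: DeriveDef; first by apply/cvg_ex; exists 0.
  exact/cvg_lim.
Unshelve. all: by end_near. Qed.

End positive_power.

Section line_derivatives.
Context {R : realType}.
Notation leb := (@lebesgue_measure R).

(** Integrate [h'] from a point to the left of the support of [h] up to [x]. *)
Lemma line_ftc (h h' : R -> R) (L : R) :
  (forall t : R, is_derive t 1 h (h' t)) -> continuous h' -> (forall t, L < `|t| -> h t = 0) ->
  forall x, (`|h x|%:E <= \int[leb]_t `|h' t|%:E)%E.
Proof.
move=> dh ch' hL x; have [Lx|xL] := ltP L `|x|.
  by rewrite hL// normr0; apply: integral_ge0 => t _; rewrite lee_fin.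
pose a := - (`|L| + 1).
have La : L < `|a| by rewrite /a normrN ger0_norm ?addr_ge0// (le_lt_trans (ler_norm _))// ltrDl.
have ax : a < x.
  rewrite /a ltrNl (le_lt_trans (ler_norm _))// normrN (le_lt_trans xL)//.
  by rewrite (le_lt_trans (ler_norm _))// ltrDl.
have ch t : {for t, continuous h}.
  by apply/differentiable_continuous/derivable1_diffP; case: (dh t).
have cw : {within `[a, x], continuous h'} by exact: continuous_subspaceT.
have : (\int[leb]_(t in `[a, x]) (h' t)%:E = (h x)%:E - (h a)%:E)%E.
  apply: continuous_FTC2 => //.
    split; first by move=> t _; case: (dh t).
    - by apply: cvg_at_right_filter; exact: ch.
    - by apply: cvg_at_left_filter; exact: ch.
  by move=> t _; rewrite derive1E; case: (dh t).
rewrite (hL a La) sube0 => hE.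
have mh' : measurable_fun [set: R] h' by exact: continuous_measurable_fun.
have mn : measurable_fun [set: R] (fun t => `|h' t|%:E).
  by apply/measurable_EFinP; exact: measurableT_comp.
rewrite -[leLHS]/(`|(h x)%:E|)%E -hE.
apply: le_trans (le_abse_integral _ _ _) _ => //.
  exact/measurable_EFinP/measurable_funTS.
by apply: ge0_subset_integral => //= t _; rewrite lee_fin.
Qed.

Section compactly_supported.
Context {n : nat}.
Implicit Types phi : 'rV[R]_n -> R.

(** The bounds make every integrand built from [phi] and its gradient bounded
    and supported in a cube, hence integrable. *)
Definition C1_compact phi := [/\ forall x, differentiable phi x,
   forall i, continuous (partial i phi) &
   exists M L : R, [/\ 0 <= M, 0 <= L,
     forall x, `|phi x| <= M /\ forall i, `|partial i phi x| <= M &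
     forall x : 'rV[R]_n, (exists i, L < `|x ord0 i|) -> phi x = 0 /\ forall i, partial i phi x = 0]].

Lemma partial_off_support phi i x : ~ Defs.support phi x -> partial i phi x = 0.
Proof.
move=> sx; rewrite /partial -[RHS](derive_cst (0 : R) x (delta_mx ord0 i)).
apply: near_eq_derive.
have : nbhs x (~` Defs.support phi).
  by apply: open_nbhs_nbhs; split => //; apply: closed_openC; exact: closed_closure.
apply: filterS => y /= sy; apply: contrapT => /eqP yn; apply: sy.
exact: subset_closure.
Qed.

Lemma off_support phi x : ~ Defs.support phi x -> phi x = 0.
Proof. by move=> sy; apply: contrapT => /eqP yn; apply: sy; exact: subset_closure. Qed.

Lemma bounded_off_compact (f : 'rV[R]_n -> R) (K : set 'rV[R]_n) : compact K ->
  continuous f -> (forall x, ~ K x -> f x = 0) -> exists2 M, 0 <= M & forall x, `|f x| <= M.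
Proof.
move=> cK cf f0; have /compact_bounded[M [_ hM]] : compact (f @` K).
  by apply: continuous_compact => //; exact: continuous_subspaceT.
exists (`|M| + 1); first by rewrite addr_ge0.
have MM : M < `|M| + 1 by rewrite (le_lt_trans (ler_norm _))// ltrDl.
move=> x; have [Kx|Kx] := pselect (K x); first by apply: (hM _ MM); exists x.
by rewrite f0// normr0 addr_ge0.
Qed.

Lemma test_function_C1_compact Omega phi : test_function Omega phi -> C1_compact phi.
Proof.
move=> [sphi cphi _].
have dphi x : differentiable phi x by have [] := sphi 0%N.
have cp i : continuous (partial i phi).
  move=> x; apply/differentiable_continuous.
  by have [_ /(_ i)[]] := sphi 1%N.
split=> //.
have [L L0 hL] := bounded_rV_cube (compact_bounded cphi).
have [M0 M00 hM0] : exists2 M, 0 <= M & forall x, `|phi x| <= M.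
  apply: (bounded_off_compact cphi); last exact: off_support.
  by move=> x; exact: differentiable_continuous.
have hp i : exists M, 0 <= M /\ forall x, `|partial i phi x| <= M.
  have [M M0' h] := @bounded_off_compact (partial i phi) _ cphi (cp i) (partial_off_support i).
  by exists M.
have [Mi hMi] := choice hp.
exists (M0 + \sum_i Mi i), L; split.
- by rewrite addr_ge0// sumr_ge0// => i _; have [] := hMi i.
- exact: ltW.
- move=> x; split; first by rewrite (le_trans (hM0 x))// lerDl sumr_ge0// => i _; have [] := hMi i.
  move=> i; rewrite (le_trans ((hMi i).2 x))// (bigD1 i)//= addrCA lerDl addr_ge0// sumr_ge0// => j _.
  by have [] := hMi j.
move=> x [i hi]; have sx : ~ Defs.support phi x.
  by move=> /hL /= /(_ i); rewrite -ler_norml leNgt hi.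
by split=> [|j]; [exact: off_support|exact: partial_off_support].
Qed.

Lemma upd_line (x : 'rV[R]_n) i t h : upd x i (h + t) = h *: delta_mx ord0 i + upd x i t.
Proof.
apply/rowP => j; rewrite !mxE eqxx /=.
by case: eqVneq => _; rewrite ?mulr1// mulr0 add0r.
Qed.

Lemma upd_id (x : 'rV[R]_n) i : upd x i (x ord0 i) = x.
Proof. by apply/rowP => j; rewrite mxE; case: eqVneq => // ->. Qed.

Lemma is_derive_line phi x i t : differentiable phi (upd x i t) ->
  is_derive t 1 (fun s => phi (upd x i s)) (partial i phi (upd x i t)).
Proof.
move=> dphi.
have e : (fun h => h^-1 *: (phi (upd x i (h *: 1 + t)) - phi (upd x i t))) =
         (fun h : R => h^-1 *: (phi (h *: delta_mx ord0 i + upd x i t) - phi (upd x i t))).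
  by apply/funext => h; rewrite [h *: 1]mulr1 upd_line.
apply: DeriveDef.
- rewrite /derivable /= e.
  exact: (@diff_derivable _ _ _ phi _ (delta_mx ord0 i) dphi).
- by rewrite /derive /= e.
Qed.

Lemma continuous_upd (x : 'rV[R]_n) i : continuous (upd x i).
Proof.
move=> t; rewrite (_ : upd x i = fun s => s *: delta_mx ord0 i + upd x i 0); last first.
  by apply/funext => s; rewrite -upd_line addr0.
by apply: cvgD; [apply: cvgZr_tmp; exact: cvg_id|exact: cvg_cst].
Qed.

End compactly_supported.
End line_derivatives.

(** * The Sobolev inequality for test functions *)

Section sobolev_test_functions.
Context {R : realType}.
Notation leb := (@lebesgue_measure R).

Lemma cube_supported_integral_lty n (f : 'rV[R]_n -> R) :
  measurable_fun [set: 'rV[R]_n] f -> cube_supported f ->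
  (\int[lebesgue_rV n]_x (f x)%:E < +oo)%E.
Proof.
move=> mf [M [L [M0 L0 h1 h2]]].
pose Q := [set x : 'rV[R]_n | forall i, - L <= x ord0 i <= L].
have mQ : measurable Q by exact: measurable_cube.
apply: (@le_lt_trans _ _ (\int[lebesgue_rV n]_(x in Q) M%:E)%E).
  rewrite [leRHS]integral_mkcond; apply: ge0_le_integral => //.
  - by move=> x _; rewrite lee_fin; have /andP[] := h1 x.
  - exact/measurable_EFinP.
  - exact/(measurable_restrictT _ _).1.
  move=> x _; rewrite /patch; case: ifPn => [_|].
    by rewrite lee_fin; have /andP[] := h1 x.
  rewrite notin_setE /= => hx; have -> : f x = 0; last by rewrite lexx.
  by apply: contrapT => /eqP /h2 h; apply: hx => i; rewrite -ler_norml.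
rewrite integral_cst//; apply: lte_mul_pinfty => //.
exact: lebesgue_rV_cube_lty.
Qed.

Section fixed_function.
Context {n : nat}.
Variable phi : 'rV[R]_n -> R.
Hypothesis Cphi : C1_compact phi.

(** The l^1 norm is used since it dominates every partial derivative, so that a
    single function controls [phi] along the lines of all directions. *)
Definition grad_l1 (x : 'rV[R]_n) : R := \sum_i `|partial i phi x|.

Lemma grad_l1_ge0 x : 0 <= grad_l1 x.
Proof. exact: sumr_ge0. Qed.

Lemma continuous_C1_compact : continuous phi.
Proof. by case: Cphi => d _ _ x; exact: differentiable_continuous. Qed.

Lemma measurable_C1_compact : measurable_fun [set: 'rV[R]_n] phi.
Proof. apply: continuous_measurable_rV; exact: continuous_C1_compact. Qed.

Lemma measurable_partial i : measurable_fun [set: 'rV[R]_n] (partial i phi).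
Proof. by apply: continuous_measurable_rV; case: Cphi. Qed.

Lemma measurable_grad_l1 : measurable_fun [set: 'rV[R]_n] grad_l1.
Proof.
by apply: measurable_sum => i; apply: measurableT_comp => //; exact: measurable_partial.
Qed.

Lemma cube_supported_comp (f : R -> R -> R) :
  (forall s t, 0 <= t -> 0 <= f s t) -> f 0 0 = 0 ->
  (forall M, 0 <= M -> exists2 M', 0 <= M' & forall s t, `|s| <= M -> 0 <= t <= M -> f s t <= M') ->
  cube_supported (fun x => f (phi x) (grad_l1 x)).
Proof.
move=> f0 f00 fM; have [_ _ [M [L [M0 L0 h1 h2]]]] := Cphi.
have M1 : 0 <= M + n%:R * M by rewrite addr_ge0// mulr_ge0.
have [M' M'0 hM'] := fM _ M1.
exists M', L; split=> //.
  move=> x; rewrite f0 ?grad_l1_ge0//=; apply: hM'.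
    by rewrite (le_trans (h1 x).1)// lerDl mulr_ge0.
  rewrite grad_l1_ge0/=; apply: (@le_trans _ _ (n%:R * M)); last by rewrite lerDr.
  rewrite (@le_trans _ _ (\sum_(i < n) M))//.
    by apply: ler_sum => i _; exact: (h1 x).2.
  by rewrite sumr_const card_ord mulr_natl.
move=> x fx i; rewrite leNgt; apply/negP => Li; move/negP: fx; apply; apply/eqP.
have [-> h] := h2 x (ex_intro _ i Li).
rewrite (_ : grad_l1 x = 0)//.
by rewrite /grad_l1 big1// => j _; rewrite h normr0.
Qed.

Lemma line_vanish x i : exists L, forall t, L < `|t| -> phi (upd x i t) = 0.
Proof.
have [_ _ [M [L [M0 L0 h1 h2]]]] := Cphi; exists L => t Lt.
by apply: (h2 _ _).1; exists i; rewrite mxE eqxx.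
Qed.

(** A power [A] yields the hypothesis of the Gagliardo-Nirenberg inequality that
    leads to the Sobolev inequality, the identity the one that leads to the
    Poincare inequality. *)
Lemma line_ftc_comp (A A' : R -> R) (x : 'rV[R]_n) (i : 'I_n) :
  (forall s : R, is_derive s 1 A (A' s)) -> continuous A' -> A 0 = 0 ->
  (`|A (phi x)|%:E <= \int[leb]_t (`|A' (phi (upd x i t))| * grad_l1 (upd x i t))%:E)%E.
Proof.
move=> dA cA' A0; have [dphi cp _] := Cphi.
have [L hL] := line_vanish x i.
have cl : continuous (fun t => phi (upd x i t)).
  move=> t; apply: continuous_comp; first exact: continuous_upd.
  exact: continuous_C1_compact.
have clp : continuous (fun t => partial i phi (upd x i t)).
  by move=> t; apply: continuous_comp; [exact: continuous_upd|exact: cp].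
have cAl : continuous (fun t => A' (phi (upd x i t))).
  by move=> t; apply: (continuous_comp (cl t)); exact: cA'.
have := @line_ftc R (fun t => A (phi (upd x i t)))
  (fun t => A' (phi (upd x i t)) * partial i phi (upd x i t)) L.
move=> /(_ _ _ _ (x ord0 i)); rewrite upd_id => h.
apply: le_trans (h _ _ _) _.
- move=> t; have := is_derive_line (dphi (upd x i t)) => dl.
  by have := is_derive1_comp (dA (phi (upd x i t))) dl.
- by move=> t; apply: cvgM; [exact: cAl|exact: clp].
- by move=> t /hL ->.
apply: ge0_le_integral => //=.
- apply/measurable_EFinP; apply: measurableT_comp => //.
  by apply: measurable_funM; exact: continuous_measurable_fun.
- apply/measurable_EFinP; apply: measurable_funM.
    by apply: measurableT_comp => //; exact: continuous_measurable_fun.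
  apply: measurable_sum => j; apply: measurableT_comp => //.
  apply: continuous_measurable_fun => t.
  by apply: continuous_comp; [exact: continuous_upd|exact: cp].
move=> t _; rewrite lee_fin normrM ler_wpM2l// /grad_l1 (bigD1 i)//= lerDl.
exact: sumr_ge0.
Qed.

End fixed_function.

Lemma grad_l1_Lp_lty n (phi : 'rV[R]_n -> R) p : 1 <= p -> C1_compact phi ->
  ('N[lebesgue_rV n]_p%:E[EFin \o grad_l1 phi] < +oo)%E.
Proof.
move=> p1 Cphi; have p0 : 0 < p by exact: lt_le_trans p1.
rewrite unlock /= poweR_lty//.
rewrite (eq_integral (fun x => (grad_l1 phi x `^ p)%:E)).
  apply: cube_supported_integral_lty.
    by apply: (measurableT_comp (measurable_powR _)); exact: measurable_grad_l1.
  apply: (@cube_supported_comp _ _ Cphi (fun s t => t `^ p)).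
  - by move=> s t _; exact: powR_ge0.
  - by rewrite powR0// gt_eqF.
  - move=> M M0; exists (M `^ p); first exact: powR_ge0.
    by move=> s t _ /andP[t0 tM]; rewrite ge0_ler_powR ?nnegrE// ltW.
by move=> x _; rewrite /= ger0_norm ?grad_l1_ge0.
Qed.

(** The Gagliardo-Nirenberg inequality is applied to [phi ^ gamma], whose
    gradient [gamma * phi ^ (gamma - 1) * grad phi] is split by Hoelder's
    inequality; [gamma] is the exponent for which both sides contain the same
    integral [X] of [phi ^ P]. As [X] is finite, it can be divided out. *)
Lemma sobolev_C1_compact n (phi : 'rV[R]_n.+2 -> R) (p P gamma : R) :
  1 < p -> p < n.+2%:R -> C1_compact phi ->
  P = n.+2%:R * p / (n.+2%:R - p) ->
  gamma = n.+1%:R * p / (n.+2%:R - p) ->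
  (\int[lebesgue_rV n.+2]_x (ppow P (phi x))%:E <=
   (gamma%:E * 'N[lebesgue_rV n.+2]_p%:E[EFin \o grad_l1 phi]) `^ P)%E.
Proof.
move=> p1 pN Cphi PE gammaE.
have p0 : 0 < p by rewrite (lt_trans _ p1).
pose N : R := n.+2%:R.
have NE : n.+1%:R = N - 1 :> R by rewrite /N -[n.+2%:R]natr1 addrK.
have N2 : 2 <= N by rewrite /N ler_nat.
have Np0 : 0 < N - p by rewrite subr_gt0.
rewrite -/N in PE; rewrite NE -/N in gammaE; clearbody N.
have g1 : 1 < gamma.
  rewrite gammaE ltr_pdivlMr// mul1r.
  by nra.
have P0 : 0 < P by rewrite PE divr_gt0// mulr_gt0// (lt_le_trans _ N2).
have mphi := measurable_C1_compact Cphi.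
have mg := measurable_grad_l1 Cphi.
have mpp r : 0 < r -> measurable_fun [set: 'rV[R]_n.+2] (fun x => ppow r (phi x)).
  move=> r0; apply: (measurableT_comp (f := ppow r)) => //.
  apply: continuous_measurable_fun; exact: continuous_ppow.
pose w x := gamma * ppow (gamma - 1) (phi x) * grad_l1 phi x.
have cppow r : 0 < r -> forall M : R, 0 <= M -> forall s, `|s| <= M -> ppow r s <= M `^ r.
  move=> r0 M M0 s sM; rewrite /ppow ge0_ler_powR ?nnegrE ?le_max ?lexx ?orbT//; first exact: ltW.
  by rewrite ge_max M0 andbT (le_trans (ler_norm _)).
have cw : cube_supported w.
  apply: (cube_supported_comp Cphi (f := fun s t => gamma * ppow (gamma - 1) s * t)).
  - by move=> s t t0; rewrite !mulr_ge0 ?ppow_ge0// (le_trans _ (ltW g1)).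
  - by rewrite mulr0.
  - move=> M M0; exists (gamma * M `^ (gamma - 1) * M).
      by rewrite !mulr_ge0 ?powR_ge0// (le_trans _ (ltW g1)).
    move=> s t sM /andP[t0 tM]; rewrite ler_pM ?mulr_ge0 ?ppow_ge0 ?(le_trans _ (ltW g1))//.
    by rewrite ler_wpM2l ?(le_trans _ (ltW g1))// cppow// subr_gt0.
have mw : measurable_fun [set: 'rV[R]_n.+2] w.
  apply: measurable_funM => //; apply: measurable_funM => //; apply: mpp.
  by rewrite subr_gt0.
have lw : line_bounded (fun x => ppow gamma (phi x)) w.
  move=> i x; rewrite -[ppow _ _]ger0_norm ?ppow_ge0//.
  apply: le_trans (line_ftc_comp Cphi x i (fun s => is_derive_ppow s g1) _ _) _.
  - move=> s; apply: cvgM; first exact: cvg_cst.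
    by apply: continuous_ppow; rewrite subr_gt0.
  - by rewrite ppow_neg// (lt_trans _ g1).
  rewrite le_eqVlt; apply/orP; left; apply/eqP; apply: eq_integral => t _.
  by rewrite /w ger0_norm// mulr_ge0 ?ppow_ge0// (le_trans _ (ltW g1)).
have := gagliardo_nirenberg1 (mpp gamma (lt_trans ltr01 g1)) mw
  (fun x => ppow_ge0 gamma (phi x)) cw lw.
set a : R := n.+1%:R^-1.
have aE : 1 + a = N / (N - 1).
  by rewrite /a NE; field; apply: lt0r_neq0; lra.
have a0 : 0 < a by rewrite /a invr_gt0.
have PgE : P = gamma * (1 + a).
  by rewrite PE gammaE aE; field; rewrite !gt_eqF//; lra.
rewrite (eq_integral (fun x => (ppow P (phi x))%:E)); last first.
  by move=> x _; rewrite /ppow -powRrM PgE.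
set X := (\int[_]_x _)%E => GNS.
have X0 : (0 <= X)%E by apply: integral_ge0 => x _; rewrite lee_fin ppow_ge0.
have Xfin : (X < +oo)%E.
  apply: (@cube_supported_integral_lty _ (fun x => ppow P (phi x))); first exact: mpp.
  apply: (cube_supported_comp Cphi (f := fun s t => ppow P s)).
  - by move=> s t _; exact: ppow_ge0.
  - by rewrite ppow_neg.
  - move=> M M0; exists (M `^ P); first exact: powR_ge0.
    by move=> s t sM _; exact: cppow.
set T := 'N[_]_p%:E[_]%E.
have Tfin : (T < +oo)%E by apply: grad_l1_Lp_lty => //; exact: ltW.
have T0 : (0 <= T)%E by exact: Lnorm_ge0.
have hoelderX : (\int[lebesgue_rV n.+2]_x (w x)%:E <= gamma%:E * (X `^ ((p - 1) / p) * T))%E.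
  pose q := p / (p - 1).
  have q0 : 0 < q by rewrite divr_gt0// subr_gt0.
  have pq : q^-1 + p^-1 = 1 by rewrite /q; field; rewrite !gt_eqF// subr_gt0.
  have mf : measurable_fun [set: 'rV[R]_n.+2] (fun x => ppow (gamma - 1) (phi x)).
    by apply: mpp; rewrite subr_gt0.
  have := hoelder (lebesgue_rV n.+2) mf mg q0 p0 pq.
  rewrite Lnorm1 -/T => h.
  rewrite (eq_integral (fun x => gamma%:E * `|(ppow (gamma - 1) (phi x) * grad_l1 phi x)%:E|)%E); last first.
    move=> x _; rewrite /w -mulrA EFinM; congr (_ * _)%E.
    by rewrite abse_EFin ger0_norm// mulr_ge0 ?ppow_ge0 ?grad_l1_ge0.
  rewrite ge0_integralZl//; last 2 first.
  - by apply: measurableT_comp => //; apply/measurable_EFinP; exact: measurable_funM.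
  - by rewrite lee_fin (le_trans _ (ltW g1)).
  apply: lee_wpmul2l; first by rewrite lee_fin (le_trans _ (ltW g1)).
  apply: le_trans h _; rewrite le_eqVlt; apply/orP; left; apply/eqP; congr (_ * _)%E.
  rewrite unlock /=.
  have -> : (p - 1) / p = q^-1 by rewrite /q invf_div.
  apply: (congr1 (fun t => t `^ q^-1)%E); apply: eq_integral => x _.
  rewrite /= ger0_norm ?ppow_ge0// /ppow -powRrM; congr (_ `^ _)%:E.
  rewrite /q gammaE PE; field.
  by rewrite !gt_eqF// subr_gt0.
have XX : (X <= (gamma%:E * (X `^ ((p - 1) / p) * T)) `^ (1 + a))%E.
  apply: le_trans GNS _; apply: gt0_ler_poweR.
  - by rewrite addr_ge0// ltW.
  - rewrite in_itv/= leey andbT; apply: integral_ge0 => x _; rewrite lee_fin.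
    by rewrite /w !mulr_ge0 ?ppow_ge0 ?grad_l1_ge0// (le_trans _ (ltW g1)).
  - rewrite in_itv/= leey andbT mule_ge0 ?lee_fin ?(le_trans _ (ltW g1))//.
    by rewrite mule_ge0// poweR_ge0.
  - exact: hoelderX.
move: XX X0 Xfin Tfin T0; move: X T {GNS hoelderX} => [x| |] [t| |]//.
move=> XX x0 _ _ t0; rewrite !lee_fin in x0 t0.
move: XX; rewrite poweR_EFin -!EFinM !poweR_EFin !lee_fin => XX.
have [->|xn0] := eqVneq x 0; first by rewrite powR_ge0.
have xp : 0 < x by rewrite lt_def xn0.
have g0 : 0 < gamma by rewrite (lt_trans _ g1).
(* The exponents satisfy 1 / (1 + a) = 1 / P + (p - 1) / p, so that dividing the
   root of XX by x ^ ((p - 1) / p) leaves x ^ (1 / P). *)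
have key : x `^ P^-1 <= gamma * t.
  have : x `^ (1 + a)^-1 <= gamma * (x `^ ((p - 1) / p) * t).
    set y := gamma * _ in XX *.
    have y0 : 0 <= y by rewrite !mulr_ge0 ?powR_ge0 ?(ltW g0).
    have -> : y = (y `^ (1 + a)) `^ (1 + a)^-1.
      by rewrite -powRrM mulfV ?powRr1// gt_eqF// addr_gt0.
    by rewrite ge0_ler_powR ?nnegrE ?powR_ge0// invr_ge0 addr_ge0// ltW.
  have -> : (1 + a)^-1 = P^-1 + (p - 1) / p.
    rewrite aE PE; field; rewrite !gt_eqF//; lra.
  rewrite powRD; last by rewrite xn0 implybT.
  rewrite [in leRHS]mulrCA [leRHS]mulrC; by rewrite ler_pM2r ?powR_gt0.
have -> : x = (x `^ P^-1) `^ P by rewrite -powRrM mulVf ?powRr1// gt_eqF.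
by rewrite ge0_ler_powR ?nnegrE ?powR_ge0 ?mulr_ge0 ?(ltW g0) ?(ltW P0).
Qed.

End sobolev_test_functions.

(** * Representatives of Sobolev functions *)

Section W0_representatives.
Context {R : realType} {N : nat}.
Variables (Omega : set 'rV[R]_N) (p : R) (p1 : 1 <= p).
Notation mu := (@lebesgue_rV R N).
Notation fun_grad := (('rV[R]_N -> R) * ('rV[R]_N -> 'rV[R]_N))%type.
Local Notation W := (W0 Omega p1).

Definition rep (u : W) : fun_grad := (fun_of u, nabla u).

Definition grad_norm (w : fun_grad) : R := \sum_i normLp Omega p (coordf i w.2).

Let p0 : 0 < p. Proof. exact: lt_le_trans p1. Qed.

Lemma normLp_ge0 f : 0 <= normLp Omega p f.
Proof. by rewrite fine_ge0// Lnorm_ge0. Qed.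

Lemma grad_norm_ge0 w : 0 <= grad_norm w.
Proof. by apply: sumr_ge0 => i _; exact: normLp_ge0. Qed.

Lemma grad_norm_le_normW w : grad_norm w <= normW Omega p w.
Proof. by rewrite /normW lerDr normLp_ge0. Qed.

Lemma rep_val (u : W) : rep u = val (repr (u : seminorm_quot (W0_seminorm Omega p1))).
Proof. by rewrite /rep /fun_of /nabla; case: (\val _). Qed.

Lemma rep_in_LpW (u : W) : in_LpW Omega p (rep u).
Proof. by rewrite rep_val; have /asboolP[] := valP (repr (u : seminorm_quot (W0_seminorm Omega p1))). Qed.

Lemma rep_approx (u : W) e : 0 < e -> exists phi, [/\ test_function Omega phi,
  in_LpW Omega p (graph phi) & normW Omega p (rep u - graph phi) < e].
Proof.
rewrite rep_val; have /asboolP[_] := valP (repr (u : seminorm_quot (W0_seminorm Omega p1))).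
by apply.
Qed.

Lemma norm_rep (u : W) : `|u| = normW Omega p (rep u).
Proof. by rewrite rep_val. Qed.

Lemma measurable_Lp f : in_Lp Omega p f -> measurable_fun setT (f \_ Omega).
Proof. by move=> /sub_Lfun_mfun; rewrite inE. Qed.

Lemma normLp_eq0 f : in_Lp Omega p f -> normLp Omega p f = 0 ->
  ae_in Omega (fun x => f x = 0).
Proof.
move=> Lf f0; have := normLpK p1 Lf; rewrite f0 => /esym/Lnorm_eq0_eq0.
have mf : measurable_fun setT (EFin \o (f \_ Omega)).
  by apply/measurable_EFinP; exact: measurable_Lp.
move=> /(_ mf _); rewrite lte_fin => /(_ p0).
apply: filterS => x /(_ I) /= + Ox; rewrite /patch mem_set// => -[].
exact.
Qed.

Lemma in_LpB f g : in_Lp Omega p f -> in_Lp Omega p g -> in_Lp Omega p (f - g).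
Proof. by move=> Lf Lg; rewrite addrC -scaleN1r; exact: in_LpP. Qed.

(** The representative chosen by the quotient and [v] differ by an element of
    zero seminorm, so that both components agree almost everywhere. *)
Lemma ae_rep (v : W0_pre Omega p) (u : W) :
  to_quot (W0_seminorm Omega p1) v = u ->
  ae_in Omega (fun x => fun_of u x = (val v).1 x /\ nabla u x = (val v).2 x).
Proof.
move=> vu; have : to_quot (W0_seminorm Omega p1) (repr (u : seminorm_quot (W0_seminorm Omega p1))) = u.
  by rewrite /to_quot reprK.
rewrite -{2}vu => /esym /to_quotP /eqP.
set v' := repr _.
have [Lv1 Lv2] : in_LpW Omega p (val v) by have /asboolP[] := valP v.
have [Lv1' Lv2'] : in_LpW Omega p (val v') by have /asboolP[] := valP v'.
rewrite /= /normW => /eqP; rewrite paddr_eq0 ?normLp_ge0//; last exact: (grad_norm_ge0 (val (v - v'))).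
move=> /andP[/eqP h1]; rewrite psumr_eq0; last by move=> i _; exact: normLp_ge0.
move=> /allP h2.
have a1 : ae_in Omega (fun x => (val v).1 x - (val v').1 x = 0).
  by apply: (@normLp_eq0 ((val v).1 - (val v').1)) => //; exact: in_LpB.
have a2 i : ae_in Omega (fun x => (val v).2 x ord0 i - (val v').2 x ord0 i = 0).
  have e : (fun x => (val v).2 x ord0 i - (val v').2 x ord0 i) =
      coordf i ((val v).2 - (val v').2) :> ('rV[R]_N -> R).
    by apply/funext => x; rewrite /coordf !mxE.
  apply: (@normLp_eq0 (fun x => (val v).2 x ord0 i - (val v').2 x ord0 i)).
    exact: (@in_LpB (coordf i (val v).2) (coordf i (val v').2) (Lv2 i) (Lv2' i)).
  by rewrite e; apply/eqP; apply: h2; rewrite mem_index_enum.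
apply: ae_inS2 a1 (ae_in_forall a2) => x Ox h1x h2x; split.
  by rewrite /fun_of -/v'; apply/esym/eqP; rewrite -subr_eq0 h1x.
by rewrite /nabla -/v'; apply/rowP => i; apply/esym/eqP; rewrite -subr_eq0 h2x.
Qed.

Lemma ae_scale (a : R) (u : W) :
  ae_in Omega (fun x => fun_of (a *: u) x = a * fun_of u x /\ nabla (a *: u) x = a *: nabla u x).
Proof.
have h : to_quot (W0_seminorm Omega p1) (a *: repr (u : seminorm_quot (W0_seminorm Omega p1))) = a *: u.
  by rewrite to_quotZ /to_quot reprK.
have e v : val (a *: v : W0_pre Omega p) = a *: val v by exact: linearZ.
apply: ae_inS (ae_rep h) => x Ox; rewrite e => -[-> ->]; split.
  by rewrite /fun_of.
by rewrite /nabla.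
Qed.

Lemma ae_zero : ae_in Omega (fun x => fun_of (0 : W) x = 0 /\ nabla (0 : W) x = 0).
Proof.
have h : to_quot (W0_seminorm Omega p1) 0 = (0 : W) by rewrite /to_quot raddf0.
apply: ae_inS (ae_rep h) => x Ox.
by rewrite (_ : val 0 = 0)//; exact: raddf0.
Qed.

End W0_representatives.

Section approximation.
Context {R : realType} {N : nat}.
Variables (Omega : set 'rV[R]_N) (mO : measurable Omega).
Variables (p : R) (p1 : 1 <= p).
Notation mu := (@lebesgue_rV R N).
Local Notation W := (W0 Omega p1).

Let p0 : 0 < p. Proof. exact: lt_le_trans p1. Qed.

Lemma integral_normLp f : in_Lp Omega p f ->
  (\int[mu]_(x in Omega) (`|f x| `^ p)%:E = (normLp Omega p f `^ p)%:E)%E.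
Proof.
move=> Lf; have pn0 : p != 0 by rewrite gt_eqF.
transitivity (('N[mu]_p%:E[EFin \o (f \_ Omega)]) `^ p)%E; last first.
  by rewrite -(normLpK p1 Lf) poweR_EFin.
rewrite (poweR_Lnorm _ _ pn0).
rewrite [LHS]integral_mkcond; apply: eq_integral => x _ /=.
rewrite /patch; case: ifPn => //= _.
by rewrite normr0 powR0// gt_eqF.
Qed.

Lemma normLpB f g : in_Lp Omega p f -> in_Lp Omega p g ->
  normLp Omega p (f - g) <= normLp Omega p f + normLp Omega p g.
Proof.
move=> Lf Lg; rewrite -scaleN1r; apply: le_trans (normLpD p1 Lf _) _.
  by rewrite -[_ *: _]addr0; apply: in_LpP => //; exact: in_Lp0.
by rewrite (normLpZ p1)// normrN1 mul1r.
Qed.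

(** The series of the [`|f k x| ^ p] has a finite integral, hence is finite almost
    everywhere, and its terms tend to zero there. *)
Lemma ae_cvg_of_normLp (f : nat -> 'rV[R]_N -> R) :
  (forall k, in_Lp Omega p (f k)) ->
  (forall k, normLp Omega p (f k) <= 1 / (2 ^ k.+1)%:R) ->
  ae_in Omega (fun x => f k x @[k --> \oo] --> 0).
Proof.
move=> Lf hf.
have mf k : measurable_fun Omega (f k).
  by have := measurable_Lp (Lf k); rewrite -measurable_restrictT.
have ma k : measurable_fun Omega (fun x => (`|f k x| `^ p)%:E).
  apply/measurable_EFinP; apply: (measurableT_comp (measurable_powR _)).
  exact: measurableT_comp.
pose S x := (\sum_(k <oo) (`|f k x| `^ p)%:E)%E.
have iS : mu.-integrable Omega S.
  apply/integrableP; split.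
    by apply: ge0_emeasurable_sum => // k x _ _; rewrite lee_fin powR_ge0.
  rewrite (eq_integral S); last first.
    by move=> x _; rewrite gee0_abs// nneseries_ge0// => k _ _; rewrite lee_fin powR_ge0.
  rewrite integral_nneseries//.
  apply: (@le_lt_trans _ _ 1%E); last by rewrite ltry.
  have := @epsilon_trick0 R 1 xpredT ler01.
  apply: le_trans; apply: lee_nneseries => //.
    by move=> *; apply: integral_ge0 => x _; rewrite lee_fin powR_ge0.
  move=> k *; rewrite integral_normLp// lee_fin.
  have h2 : 0 < 1 / (2 ^ k.+1)%:R :> R by rewrite divr_gt0// ltr0n expn_gt0.
  apply: (@le_trans _ _ ((1 / (2 ^ k.+1)%:R) `^ p)).
    by rewrite ge0_ler_powR ?nnegrE ?normLp_ge0 ?(ltW h2) ?(ltW p0).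
  apply: ge1r_powR => //; rewrite h2/= ler_pdivrMr ?ltr0n ?expn_gt0//.
  by rewrite mul1r ler1n expn_gt0.
have := integrable_ae mO iS; apply: ae_inS => x Ox Sfin.
have Slt : (S x < +oo)%E by rewrite ltey_eq Sfin.
have a0 k : (0 <= (`|f k x| `^ p)%:E)%E by rewrite lee_fin powR_ge0.
have := @nneseries_tail_cvg R (fun k => (`|f k x| `^ p)%:E) xpredT Slt (fun k _ => a0 k).
move=> /fine_cvgP[_] tail.
apply/cvgr0Pnorm_lt => e e0.
have ep : 0 < e `^ p by exact: powR_gt0.
move/cvgr0Pnorm_lt : tail => /(_ _ ep).
apply: filterS => k /= hk.
rewrite ltNge; apply/negP => ek; move: hk; apply/negP; rewrite -leNgt.
apply: (@le_trans _ _ (`|f k x| `^ p)).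
  by rewrite ge0_ler_powR ?nnegrE ?(ltW e0) ?(ltW p0).
have tfin : ((\sum_(k <= i <oo) (`|f i x| `^ p)%:E)%E \is a fin_num).
  rewrite ge0_fin_numE; last by apply: nneseries_ge0 => i _ _; exact: a0.
  apply: le_lt_trans Slt; rewrite /S.
  rewrite (@nneseries_split _ _ 0 k)//.
  by rewrite leeDr// sume_ge0.
apply: le_trans (ler_norm _).
rewrite -lee_fin fineK// (nneseries_split k 1)//.
by rewrite addn1 big_nat1 leeDl// nneseries_ge0.
Qed.

(** Approximating within [2 ^- k] turns convergence in norm into convergence
    almost everywhere, while the slack [e] in the gradient bound is what
    inequalities proved for test functions lose in the limit. *)
Lemma approx_ae (u : W) (e : R) : 0 < e -> exists phi : nat -> 'rV[R]_N -> R,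
  (forall k, test_function Omega (phi k) /\
     grad_norm Omega p (graph (phi k)) <= grad_norm Omega p (rep u) + e) /\
  ae_in Omega (fun x => phi k x @[k --> \oo] --> fun_of u x).
Proof.
move=> e0.
have dk k : 0 < Num.min e (1 / (2 ^ k.+1)%:R).
  by rewrite lt_min e0/= divr_gt0// ltr0n expn_gt0.
have [phi hphi] := choice (fun k => rep_approx u (dk k)).
have [Lu1 Lu2] := rep_in_LpW u.
exists phi; split=> [k|].
  have [tphi [Lp1 Lp2] hk] := hphi k; split=> //.
  have : grad_norm Omega p (rep u - graph (phi k)) <= e.
    apply: le_trans (grad_norm_le_normW _ _ _) (le_trans (ltW hk) _).
    by rewrite ge_min lexx.
  rewrite -(lerD2l (grad_norm Omega p (rep u))); apply: le_trans.
  rewrite /grad_norm -big_split/=; apply: ler_sum => i _.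
  have -> : coordf i (grad (phi k)) = coordf i (nabla u) - coordf i (nabla u - grad (phi k)) :> ('rV[R]_N -> R).
    apply/funext => x; rewrite -[RHS]/(nabla u x ord0 i - (nabla u x - grad (phi k) x) ord0 i).
    by rewrite /coordf !mxE subKr.
  apply: normLpB; first exact: Lu2.
  have -> : coordf i (nabla u - grad (phi k)) = coordf i (nabla u) - coordf i (grad (phi k)) :> ('rV[R]_N -> R).
    apply/funext => x; rewrite -[RHS]/(nabla u x ord0 i - grad (phi k) x ord0 i).
    by rewrite -[LHS]/((nabla u x - grad (phi k) x) ord0 i) !mxE.
  exact: (in_LpB p1 (Lu2 i) (Lp2 i)).
have L k : in_Lp Omega p (fun_of u - phi k).
  by have [_ [Lp1 _] _] := hphi k; exact: in_LpB.
apply: ae_inS (ae_cvg_of_normLp L _) => [x Ox h|k].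
  rewrite -[X in _ --> X]subr0.
  have -> : (fun k => phi k x) = (fun k => fun_of u x - (fun_of u - phi k) x).
    by apply/funext => k; rewrite -[RHS]/(fun_of u x - (fun_of u x - phi k x)) subKr.
  by apply: cvgB => //; exact: cvg_cst.
have [_ _ hk] := hphi k.
apply: le_trans (le_trans _ (ltW hk)) _; last by rewrite ge_min lexx orbT.
by rewrite /normW lerDl sumr_ge0// => i _; exact: normLp_ge0.
Qed.

End approximation.

(** * Poincare and Sobolev inequalities *)

Section limn_einf_bounds.
Context {R : realType}.
Local Open Scope ereal_scope.
Implicit Types (u : (\bar R)^nat) (a : \bar R).

Lemma limn_einfE_sup u : limn_einf u = ereal_sup (range (einfs u)).
Proof. by rewrite limn_einf_lim; apply/cvg_lim => //; exact: cvg_einfs_sup. Qed.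

Lemma limn_einf_ge u a : (forall k, a <= u k) -> a <= limn_einf u.
Proof.
move=> h; rewrite limn_einfE_sup.
have h1 : a <= einfs u 0%N by apply: le_ereal_inf_tmp => _ [k _ <-].
have h2 : einfs u 0%N <= ereal_sup (range (einfs u)).
  by apply: ereal_sup_ubound; exists 0%N.
exact: le_trans h1 h2.
Qed.

Lemma limn_einf_le u a : (forall k, u k <= a) -> limn_einf u <= a.
Proof.
move=> h; rewrite limn_einfE_sup; apply: ge_ereal_sup => _ [k _ <-].
by apply: le_trans (h k); apply: ereal_inf_lbound; exists k => //=.
Qed.

End limn_einf_bounds.

Section sobolev_W0.
Context {R : realType} {n : nat}.
Variables (Omega : set 'rV[R]_n.+1) (mO : measurable Omega) (bO : bounded_set Omega).
Variables (p : R) (p1 : 1 <= p) (lt1p : 1 < p).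
Notation mu := (@lebesgue_rV R n.+1).
Local Notation W := (W0 Omega p1).
Implicit Types phi : 'rV[R]_n.+1 -> R.

Let p0 : 0 < p. Proof. exact: lt_le_trans p1. Qed.

Lemma test_off_Omega phi x : test_function Omega phi -> ~ Omega x ->
  phi x = 0 /\ forall i, partial i phi x = 0.
Proof.
move=> [_ _ sO] Ox; have sx : ~ Defs.support phi x by move=> /sO.
by split=> [|i]; [exact: off_support|exact: partial_off_support].
Qed.

Lemma in_Lp_cube_supported (f : 'rV[R]_n.+1 -> R) : measurable_fun [set: 'rV[R]_n.+1] f ->
  cube_supported (fun x => `|f x|) -> (forall x, ~ Omega x -> f x = 0) ->
  in_Lp Omega p f /\ ((normLp Omega p f)%:E = 'N[mu]_p%:E[EFin \o f])%E.
Proof.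
move=> mf cf f0.
have fO : f \_ Omega = f.
  apply/funext => x; rewrite /patch; case: ifPn => //.
  by rewrite notin_setE => /f0 ->.
have Lf : in_Lp Omega p f.
  rewrite /in_Lp fO; apply/andP; split; rewrite inE//=.
  rewrite /finite_norm unlock/= poweR_lty//.
  apply: (@cube_supported_integral_lty _ _ (fun x => `|f x| `^ p)).
    by apply: (measurableT_comp (measurable_powR _)); exact: measurableT_comp.
  have [M [L [M0 L0 h1 h2]]] := cf.
  exists (M `^ p), L; split=> //; first exact: powR_ge0.
    move=> x; rewrite powR_ge0/= ge0_ler_powR ?nnegrE ?(ltW p0)//.
    by have /andP[] := h1 x.
  move=> x fx; apply: h2; apply: contra_neq fx => ->.
  by rewrite powR0// gt_eqF.
by split=> //; rewrite (normLpK p1 Lf) fO.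
Qed.

Lemma test_in_LpW phi : test_function Omega phi -> in_LpW Omega p (graph phi) /\
  forall i, ((normLp Omega p (partial i phi))%:E = 'N[mu]_p%:E[EFin \o partial i phi])%E.
Proof.
move=> tphi; have Cphi := test_function_C1_compact tphi.
have [dphi cphi [M [L [M0 L0 h1 h2]]]] := Cphi.
have hi i : in_Lp Omega p (partial i phi) /\
    ((normLp Omega p (partial i phi))%:E = 'N[mu]_p%:E[EFin \o partial i phi])%E.
  apply: in_Lp_cube_supported; first exact: measurable_partial.
    exists M, L; split=> //; first by move=> x; rewrite normr_ge0/=; exact: (h1 x).2.
    move=> x fx j; rewrite leNgt; apply/negP => Lj; move: fx.
    by rewrite (h2 x (ex_intro _ j Lj)).2 normr0 eqxx.
  by move=> x Ox; exact: (test_off_Omega tphi Ox).2.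
split; last by move=> i; exact: (hi i).2.
split=> [|i].
  apply: (in_Lp_cube_supported _ _ _).1.
  - exact: measurable_C1_compact.
  - exists M, L; split=> //; first by move=> x; rewrite normr_ge0/=; exact: (h1 x).1.
    move=> x fx j; rewrite leNgt; apply/negP => Lj; move: fx.
    by rewrite /= (h2 x (ex_intro _ j Lj)).1 normr0 eqxx.
  - by move=> x Ox; exact: (test_off_Omega tphi Ox).1.
have -> : coordf i (graph phi).2 = partial i phi.
  by apply/funext => x; rewrite /coordf/= mxE.
exact: (hi i).1.
Qed.

Lemma grad_norm_graph phi :
  grad_norm Omega p (graph phi) = \sum_i normLp Omega p (partial i phi).
Proof.
apply: eq_bigr => i _; congr normLp; apply/funext => x.
by rewrite /coordf/= mxE.
Qed.

Lemma Lnorm_grad_l1_le phi : test_function Omega phi ->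
  ('N[mu]_p%:E[EFin \o grad_l1 phi] <= (grad_norm Omega p (graph phi))%:E)%E.
Proof.
move=> tphi; have Cphi := test_function_C1_compact tphi.
have [_ hN] := test_in_LpW tphi.
rewrite grad_norm_graph -sumEFin.
rewrite (_ : grad_l1 phi = fun x => \sum_(i <- index_enum 'I_n.+1) `|partial i phi x|)//.
elim: (index_enum 'I_n.+1) => [|i s IH].
  rewrite big_nil (_ : (fun x => _) = cst 0); last by apply/funext => x; rewrite big_nil.
  by rewrite Lnorm0// gt_eqF.
rewrite big_cons (_ : (fun x => _) = (fun x => `|partial i phi x|) \+
    (fun x => \sum_(j <- s) `|partial j phi x|)); last first.
  by apply/funext => x; rewrite big_cons.
apply: le_trans (eminkowski _ _ _ _) _; rewrite ?lee_fin//.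
- by apply: measurableT_comp => //; exact: measurable_partial.
- apply: measurable_sum => j; apply: measurableT_comp => //; exact: measurable_partial.
apply: leeD => //.
rewrite hN le_eqVlt; apply/orP; left; apply/eqP.
by rewrite -[RHS]Lnorm_abse.
Qed.

Let q : R := p / (p - 1).

(** Hoelder's inequality against the indicator of [Omega], which has finite
    measure. *)
Lemma integral_grad_l1_le : exists2 C : R, 0 <= C & forall phi, test_function Omega phi ->
  (\int[mu]_x (grad_l1 phi x)%:E <= (C * grad_norm Omega p (graph phi))%:E)%E.
Proof.
have p10 : 0 < p - 1 by rewrite subr_gt0.
have q0 : 0 < q by rewrite divr_gt0.
have pq : p^-1 + q^-1 = 1 by rewrite /q; field; rewrite !gt_eqF.
have mu1 : ('N[mu]_q%:E[EFin \o \1_Omega] < +oo)%E.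
  rewrite unlock/= poweR_lty// (eq_integral (EFin \o \1_Omega)).
    by rewrite integral_indic// setIT lebesgue_rV_bounded_lty.
  move=> x _ /=; rewrite indicE; case: (_ \in _); first by rewrite normr1 powR1.
  by rewrite normr0 powR0// gt_eqF.
exists (fine ('N[mu]_q%:E[EFin \o \1_Omega])); first by rewrite fine_ge0// Lnorm_ge0.
move=> phi tphi; have Cphi := test_function_C1_compact tphi.
have := hoelder mu (measurable_grad_l1 Cphi) (measurable_indic mO) p0 q0 pq.
rewrite Lnorm1 (eq_integral (fun x => (grad_l1 phi x)%:E)); last first.
  move=> x _; have [Ox|Ox] := pselect (Omega x).
    by rewrite /= indicE mem_set// mulr1 ger0_norm ?grad_l1_ge0.
  rewrite /= (_ : grad_l1 phi x = 0) ?mul0r ?normr0//.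
  by rewrite /grad_l1 big1// => i _; rewrite (test_off_Omega tphi Ox).2 normr0.
move/le_trans; apply; rewrite [leRHS]EFinM [leRHS]muleC fineK ?ge0_fin_numE ?Lnorm_ge0//.
by rewrite lee_wpmul2r ?Lnorm_ge0// Lnorm_grad_l1_le.
Qed.

(** In the dual Gagliardo-Nirenberg inequality, let [f] be the indicator of a
    cube that contains [Omega]: the left-hand side becomes the integral of
    [`|phi|]. *)
Lemma poincare_test : exists2 C : R, 0 <= C & forall phi, test_function Omega phi ->
  (\int[mu]_(x in Omega) `|phi x|%:E <= (C * grad_norm Omega p (graph phi))%:E)%E.
Proof.
have [C C0 hC] := integral_grad_l1_le.
have [M M0 OM] := bounded_rV_cube bO.
pose Q := [set x : 'rV[R]_n.+1 | forall i, - M <= x ord0 i <= M].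
have mQ : measurable Q by exact: measurable_cube.
have muQ : (mu Q < +oo)%E by exact: lebesgue_rV_cube_lty.
exists (C * fine (mu Q `^ (n.+1%:R)^-1)%E).
  by rewrite mulr_ge0// fine_ge0// poweR_ge0.
move=> phi tphi; have Cphi := test_function_C1_compact tphi.
have mphi := measurable_C1_compact Cphi.
have := @gns_dual_holds R n (fun x => `|phi x|) (grad_l1 phi) \1_Q.
move=> /(_ _ (measurable_grad_l1 Cphi) (measurable_indic mQ)) h.
have : (\int[mu]_(x in Omega) `|phi x|%:E <= \int[mu]_x (`|phi x| * \1_Q x `^ (n.+1%:R)^-1)%:E)%E.
  rewrite [leLHS]integral_mkcond le_eqVlt; apply/orP; left; apply/eqP.
  apply: eq_integral => x _; rewrite /patch; case: ifPn.
    rewrite inE => Ox; rewrite indicE mem_set; last exact: OM.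
    by rewrite powR1 mulr1.
  by rewrite notin_setE => /(test_off_Omega tphi)[-> _]; rewrite normr0 mul0r.
move=> /le_trans; apply; apply: le_trans (h _ _ _ _ _) _.
- exact: measurableT_comp.
- by move=> x; exact: normr_ge0.
- apply: (cube_supported_comp Cphi (f := fun _ t => t)) => //.
  by move=> M' M'0; exists M' => // s t _ /andP[].
- exists 1, M; split=> //; [exact: ltW| |].
    by move=> x; rewrite indicE; case: (_ \in _); rewrite /= ?ler01 ?lexx.
  move=> x Qx i; rewrite ler_norml; move: i; apply: contrapT => nQ; move: Qx.
  by rewrite indicE memNset// eqxx.
- move=> i x; apply: le_trans (line_ftc_comp Cphi x i (fun s => is_derive_id s 1) _ erefl) _.
    by move=> s; exact: cvg_cst.
  rewrite le_eqVlt; apply/orP; left; apply/eqP.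
  by apply: eq_integral => t _; rewrite normr1 mul1r.
rewrite integral_indic// setIT mulrAC EFinM fineK; last first.
  by rewrite fin_num_poweR// ge0_fin_numE.
by rewrite lee_wpmul2r ?poweR_ge0// hC.
Qed.

(** Fatou's lemma along test functions that converge almost everywhere. *)
Lemma integral_limit (P C : R) : 0 < P -> 0 <= C ->
  (forall phi, test_function Omega phi ->
    (\int[mu]_(x in Omega) (`|phi x| `^ P)%:E <= (C * grad_norm Omega p (graph phi) `^ P)%:E)%E) ->
  forall (u : W) e, 0 < e ->
    (\int[mu]_(x in Omega) (`|fun_of u x| `^ P)%:E <=
     (C * (grad_norm Omega p (rep u) + e) `^ P)%:E)%E.
Proof.
move=> P0 C0 h u e e0.
have [phi [hphi aphi]] := approx_ae mO u e0.
have mphi k : measurable_fun Omega (fun x => (`|phi k x| `^ P)%:E).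
  apply/measurable_EFinP; apply: (measurableT_comp (measurable_powR _)).
  apply: measurableT_comp => //; apply: measurable_funTS.
  by apply: measurable_C1_compact; have [/test_function_C1_compact] := hphi k.
have phi0 k x : Omega x -> (0 <= (`|phi k x| `^ P)%:E)%E by move=> _; rewrite lee_fin powR_ge0.
have mu_ : measurable_fun Omega (fun_of u).
  have [Lu _] := rep_in_LpW u.
  by have := measurable_Lp Lu; rewrite -measurable_restrictT.
apply: le_trans (le_trans (ge0_le_integral_ae (g := fun x => limn_einf (fun k => (`|phi k x| `^ P)%:E)) _ _ _) (fatou mu mO mphi phi0)) _.
- by move=> x _; rewrite lee_fin powR_ge0.
- by move=> x _; apply: limn_einf_ge => k; rewrite lee_fin powR_ge0.
- apply: ae_inS aphi => x Ox hx.
  rewrite (_ : limn_einf _ = (`|fun_of u x| `^ P)%:E)//.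
  apply: (cvg_limn_einf_sup _).1; apply: cvg_EFin; first by apply: nearW.
  rewrite -ppow_pos//.
  have -> : fine \o (fun k => (`|phi k x| `^ P)%:E) = fun k => ppow P `|phi k x|.
    by apply/funext => k; rewrite /= ppow_pos.
  exact: (cvg_comp _ _ (cvg_norm hx) (continuous_ppow P0 (x := _))).
apply: limn_einf_le => k; have [tphi hk] := hphi k.
apply: le_trans (h _ tphi) _; rewrite lee_fin ler_wpM2l//.
by rewrite ge0_ler_powR ?nnegrE ?grad_norm_ge0 ?(ltW P0)// addr_ge0 ?grad_norm_ge0 ?ltW.
Qed.

(** The Poincare inequality in [L^1] suffices: it makes the function vanish almost
    everywhere, and then both terms of the norm are zero. *)
Theorem poincare_W0 (u : W) : grad_norm Omega p (rep u) = 0 -> u = 0.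
Proof.
move=> T0; have [C C0 hC] := poincare_test.
have int0 : (\int[mu]_(x in Omega) `|fun_of u x|%:E = 0)%E.
  apply/eqP; rewrite eq_le; apply/andP; split; last by apply: integral_ge0 => x _; rewrite lee_fin.
  apply/lee_addgt0Pr => e e0; rewrite add0e.
  have e1 : 0 < e / (C + 1) by rewrite divr_gt0// ltr_wpDl.
  have := @integral_limit 1 C ltr01 C0 _ u _ e1; rewrite T0 add0r.
  under eq_integral do rewrite powRr1//.
  move=> h; apply: le_trans (h _) _.
    move=> phi tphi; under eq_integral do rewrite powRr1//.
    by rewrite powRr1 ?grad_norm_ge0//; exact: hC.
  rewrite powRr1 ?(ltW e1)// lee_fin mulrCA ler_piMr ?(ltW e0)//.
  by rewrite ler_pdivrMr ?mul1r ?lerDl// ltr_wpDl.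
have [Lu _] := rep_in_LpW u.
have mfu : measurable_fun Omega (fun_of u).
  by have := measurable_Lp Lu; rewrite -measurable_restrictT.
have u0 : ae_in Omega (fun x => `|fun_of u x| = 0).
  have : ae_eq mu Omega (EFin \o fun_of u) (cst 0).
    apply/(ae_eq_integral_abs mu mO); first exact/measurable_EFinP.
    by rewrite -[RHS]int0; apply: eq_integral.
  by apply: ae_inS => x Ox [->]; rewrite normr0.
have nu0 : normLp Omega p (fun_of u) = 0.
  have : (\int[mu]_(x in Omega) (`|fun_of u x| `^ p)%:E = 0)%E.
    rewrite (@eq_integral_ae _ _ _ _ _ _ (cst 0%E)) ?integral0//.
    by apply: ae_inS u0 => x Ox ->; rewrite powR0// gt_eqF.
  rewrite (integral_normLp p1 Lu).
  by move=> [] /powR_eq0_eq0.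
apply/normr0_eq0; rewrite norm_rep /normW nu0 add0r; exact: T0.
Qed.

End sobolev_W0.

Section sobolev_W0_cases.
Context {R : realType}.

Lemma test_functionN n (Omega : set 'rV[R]_n) phi :
  test_function Omega phi -> test_function Omega (- phi).
Proof.
move=> tphi; rewrite (_ : - phi = -1 *: phi + 0); last by rewrite scaleN1r addr0.
by apply: test_functionP => //; exact: test_function0.
Qed.

Lemma grad_l1N n (Omega : set 'rV[R]_n) phi : test_function Omega phi ->
  grad_l1 (- phi) = grad_l1 phi.
Proof.
move=> [sphi _ _]; apply/funext => x; apply: eq_bigr => i _.
rewrite /partial deriveN ?normrN//.
by apply: diff_derivable; have [] := sphi 0%N.
Qed.

(** Positive and negative parts of a test function are handled separately. The
    slack in the passage to the limit is taken equal to the gradient norm, which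
    costs the factor [2 ^ P] and asks for that norm to be positive. *)
Lemma sobolev_W0 n (Omega : set 'rV[R]_n.+2) (p P : R) (p1 : 1 <= p) :
  measurable Omega -> 1 < p -> p < n.+2%:R -> P = n.+2%:R * p / (n.+2%:R - p) ->
  exists2 C : R, 0 <= C & forall u : W0 Omega p1, 0 < grad_norm Omega p (rep u) ->
  (\int[lebesgue_rV n.+2]_(x in Omega) (`|fun_of u x| `^ P)%:E <=
   (C * grad_norm Omega p (rep u) `^ P)%:E)%E.
Proof.
move=> mO lt1p pN PE.
pose gamma := n.+1%:R * p / (n.+2%:R - p).
have p0 : 0 < p by rewrite (lt_trans _ lt1p).
have Np0 : 0 < n.+2%:R - p by rewrite subr_gt0.
have P0 : 0 < P by rewrite PE divr_gt0// mulr_gt0.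
have g0 : 0 <= gamma by rewrite divr_ge0 ?mulr_ge0 ?(ltW p0) ?(ltW Np0).
have ht (phi psi : 'rV[R]_n.+2 -> R) : test_function Omega phi -> test_function Omega psi ->
    grad_l1 psi = grad_l1 phi -> (\int[lebesgue_rV n.+2]_x (ppow P (psi x))%:E <=
      ((gamma * grad_norm Omega p (graph phi)) `^ P)%:E)%E.
  move=> tphi tpsi e; have Cpsi := test_function_C1_compact tpsi.
  apply: le_trans (sobolev_C1_compact lt1p pN Cpsi PE erefl) _; rewrite e.
  rewrite -poweR_EFin; apply: gt0_ler_poweR.
  - exact: ltW.
  - by rewrite in_itv/= leey andbT mule_ge0 ?lee_fin ?Lnorm_ge0.
  - by rewrite in_itv/= leey andbT lee_fin mulr_ge0// grad_norm_ge0.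
  - by rewrite [leRHS]EFinM lee_wpmul2l ?lee_fin// Lnorm_grad_l1_le.
exists ((gamma `^ P + gamma `^ P) * 2 `^ P).
  by rewrite mulr_ge0 ?addr_ge0 ?powR_ge0.
move=> u T0.
have K0 : 0 <= gamma `^ P + gamma `^ P by rewrite addr_ge0 ?powR_ge0.
apply: le_trans (integral_limit mO P0 K0 _ u T0) _; last first.
  have T0' := ltW T0; move: (grad_norm _ _ _) T0' => T T0'.
  rewrite (_ : T + T = 2 * T); last by ring.
  by rewrite (@powRM _ 2 T)// mulrA.
move=> phi tphi.
have tN := test_functionN tphi.
have mpp (psi : 'rV[R]_n.+2 -> R) : test_function Omega psi ->
    measurable_fun [set: 'rV[R]_n.+2] (fun x => (ppow P (psi x))%:E).
  move=> tpsi; apply/measurable_EFinP.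
  apply: (measurableT_comp (f := ppow P)); last first.
    by apply: measurable_C1_compact; exact: test_function_C1_compact tpsi.
  apply: continuous_measurable_fun; exact: continuous_ppow.
apply: (@le_trans _ _ (\int[lebesgue_rV n.+2]_x ((ppow P (phi x))%:E + (ppow P ((- phi) x))%:E))%E).
  rewrite [leLHS]integral_mkcond; apply: ge0_le_integral_ae => //.
  - by move=> x _; rewrite /patch; case: ifPn => // _; rewrite lee_fin powR_ge0.
  - by move=> x _; rewrite -EFinD lee_fin addr_ge0 ?ppow_ge0.
  apply: aeW => x _; rewrite /patch; case: ifPn => _; last first.
    by rewrite -EFinD lee_fin addr_ge0 ?ppow_ge0.
  rewrite -EFinD lee_fin; have [x0|x0] := leP 0 (phi x).
    by rewrite ger0_norm// (ppow_pos _ x0) lerDl ppow_ge0.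
  rewrite ltr0_norm// -[(- phi) x]/(- phi x) (@ppow_pos _ _ (- phi x)); last by rewrite oppr_ge0 ltW.
  by rewrite lerDr ppow_ge0.
rewrite ge0_integralD//; last 4 first.
- by move=> x _; rewrite lee_fin ppow_ge0.
- exact: mpp.
- by move=> x _; rewrite lee_fin ppow_ge0.
- exact: mpp.
rewrite mulrDl -powRM ?grad_norm_ge0// EFinD; apply: leeD; first exact: ht.
exact: (ht _ _ tphi tN (grad_l1N tphi)).
Qed.

(** In dimension one a test function is bounded by the integral of its
    derivative. *)
Lemma sup_W0 (Omega : set 'rV[R]_1) (p : R) (p1 : 1 <= p) :
  measurable Omega -> bounded_set Omega -> 1 < p ->
  exists2 C : R, 0 <= C & forall u : W0 Omega p1, 0 < grad_norm Omega p (rep u) ->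
  ae_in Omega (fun x => `|fun_of u x| <= C * grad_norm Omega p (rep u)).
Proof.
move=> mO bO lt1p.
have [C C0 hC] := integral_grad_l1_le mO bO p1 lt1p.
exists (C * 2); first by rewrite mulr_ge0.
move=> u T0; have [phi [hphi aphi]] := approx_ae mO u T0.
apply: ae_inS aphi => x Ox hx.
have hk k : `|phi k x| <= C * 2 * grad_norm Omega p (rep u).
  have [tphi hk] := hphi k; have Cphi := test_function_C1_compact tphi.
  rewrite -lee_fin.
  apply: le_trans (line_ftc_comp Cphi x ord0 (fun s => is_derive_id s 1) _ erefl) _.
    by move=> s; exact: cvg_cst.
  under eq_integral do rewrite normr1 mul1r.
  rewrite integral_line_rV1; last 2 first.
  - exact: measurable_grad_l1.
  - by move=> y; exact: grad_l1_ge0.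
  apply: le_trans (hC _ tphi) _; rewrite lee_fin -mulrA ler_wpM2l//.
  by apply: le_trans hk _; move: (grad_norm _ _ _) => T; lra.
rewrite leNgt; apply/negP => lt.
rewrite -subr_gt0 in lt.
have hn : (`|phi k x| @[k --> \oo] --> `|fun_of u x|) by exact: cvg_norm hx.
move/cvgrPdist_lt : hn => h.
have [k _ /(_ k (leqnn k))/=] := h _ lt.
have := hk k; move: (C * 2 * _) (`|fun_of u x|) (`|phi k x|) => a b c ca.
by have := ler_norm (b - c); lra.
Qed.

End sobolev_W0_cases.

(** * Bump functions *)

Section smooth_functions.
Context {R : realType} {N : nat}.
Implicit Types f g : 'rV[R]_N -> R.

Lemma smooth_upto_differentiable k f : smooth_upto k f -> forall x, differentiable f x.
Proof. by case: k => [|k] []. Qed.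

Lemma smooth_uptoS k f : smooth_upto k.+1 f -> smooth_upto k f.
Proof.
elim: k f => [|k IH] f /= [df h]; split=> // i.
exact: IH.
Qed.

Lemma smooth_upto_cst k (c : R) : smooth_upto k (fun _ : 'rV[R]_N => c).
Proof.
have p0 i : partial i (fun _ : 'rV[R]_N => c) = 0.
  by apply/funext => x; rewrite /partial (derive_cst c).
case: k => [|k] /=; split=> //; try by move=> x; exact: differentiable_cst.
by move=> i; rewrite p0; exact: smooth_upto0.
Qed.

Lemma smooth_uptoD k f g : smooth_upto k f -> smooth_upto k g -> smooth_upto k (f + g).
Proof. by rewrite -[f]scale1r => /(smooth_uptoP 1) h /h; rewrite !scale1r. Qed.

Lemma smooth_uptoM k f g : smooth_upto k f -> smooth_upto k g ->
  smooth_upto k (fun x => f x * g x).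
Proof.
elim: k f g => [|k IH] f g sf sg.
  split=> // x; apply: differentiableM; exact: (smooth_upto_differentiable _ (k := 0)).
have df := smooth_upto_differentiable sf; have dg := smooth_upto_differentiable sg.
split=> [x|i]; first exact: differentiableM.
have -> : partial i (fun x => f x * g x) =
    (fun x => f x * partial i g x) + (fun x => g x * partial i f x).
  apply/funext => x; rewrite /partial (deriveM (f := f) (g := g)) //; exact: diff_derivable.
apply: smooth_uptoD; apply: IH.
- exact: smooth_uptoS.
- by case: sg => _; exact.
- exact: smooth_uptoS.
- by case: sf => _; exact.
Qed.

Lemma smooth_upto_prod k (I : Type) (s : seq I) (F : I -> 'rV[R]_N -> R) :
  (forall i, smooth_upto k (F i)) -> smooth_upto k (fun x => \prod_(i <- s) F i x).
Proof.
move=> sF; elim: s => [|i s IH].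
  by rewrite (_ : (fun x => _) = fun=> 1); [exact: smooth_upto_cst|apply/funext => x; rewrite big_nil].
rewrite (_ : (fun x => _) = fun x => F i x * \prod_(j <- s) F j x).
  exact: smooth_uptoM.
by apply/funext => x; rewrite big_cons.
Qed.

End smooth_functions.

Section flat_functions.
Context {R : realType}.

(** The classical blocks of bump functions, namely [x ^- n * exp (- 1 / x)] extended
    by zero. The whole family is needed because derivatives of its members are
    combinations of members. *)
Definition flat (n : nat) (x : R) : R := if 0 < x then x ^- n * expR (- x^-1) else 0.

Lemma flat_ge0 n x : 0 <= flat n x.
Proof.
by rewrite /flat; case: ifPn => // x0; rewrite mulr_ge0 ?expR_ge0// invr_ge0 exprn_ge0// ltW.
Qed.

(** The exponential beats every power: raise [y <= exp y], with
    [y = 1 / (n.+1 * x)], to the power [n.+1]. *)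
Lemma flat_le n x : 0 < x -> flat n x <= n.+1%:R ^+ n.+1 * x.
Proof.
move=> x0; rewrite /flat x0 expRN ler_pdivrMr ?expR_gt0//.
have n0 : 0 < n.+1%:R :> R by [].
have h : (n.+1%:R * x)^-1 <= expR (n.+1%:R * x)^-1.
  by apply: le_trans (expR_ge1Dx _); rewrite lerDr.
have : ((n.+1%:R * x)^-1) ^+ n.+1 <= expR x^-1.
  have -> : expR x^-1 = expR (n.+1%:R * x)^-1 ^+ n.+1.
    by rewrite -expRM_natl; congr expR; field; rewrite !gt_eqF.
  by rewrite lerXn2r ?nnegrE ?expR_ge0// invr_ge0 mulr_ge0// ltW.
rewrite exprVn exprMn invfM => h2.
apply: (@le_trans _ _ (n.+1%:R ^+ n.+1 * x * ((n.+1%:R ^+ n.+1)^-1 * (x ^+ n.+1)^-1))).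
  have C0 : n.+1%:R ^+ n.+1 != 0 :> R by rewrite expf_neq0// gt_eqF.
  have xn0 : x ^+ n != 0 by rewrite expf_neq0// gt_eqF.
  move: (n.+1%:R ^+ n.+1) C0 => C C0; rewrite [x ^+ n.+1]exprS.
  move: (x ^+ n) xn0 => y y0; rewrite (_ : C * x * _ = y^-1)//.
  by field; rewrite C0 y0 gt_eqF.
by rewrite ler_wpM2l// mulr_ge0 ?exprn_ge0// ltW.
Qed.

Lemma is_derive_flat (n : nat) (x : R) : is_derive x 1 (flat n) (flat n.+2 x - n%:R * flat n.+1 x).
Proof.
have [x0|x0|->] := ltgtP x 0.
- rewrite /flat !ltNge !(ltW x0)/= mulr0 subr0.
  apply: (@near_eq_is_derive _ R R (cst 0)).
  by near=> t; rewrite ltNge ltW//; near: t; exact: lt_nbhsl.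
- apply: (@near_eq_is_derive _ R R (fun x : R => x ^- n * expR (- x^-1))).
    near=> t; rewrite /flat ifT//; near: t; exact: lt_nbhsr.
  rewrite /flat x0.
  have xn0 : x != 0 by rewrite gt_eqF.
  have dV : is_derive x 1 (fun x : R => x^-1) (- x ^- 2).
    apply: is_derive_eq; first by apply: (@is_deriveV R id x 1 1 xn0).
    by rewrite [LHS]mulr1.
  have dE : is_derive x 1 (fun x : R => expR (- x^-1)) (expR (- x^-1) * x ^- 2).
    have dN : is_derive x 1 (fun x : R => - x^-1) (x ^- 2).
      by have := is_deriveN dV; rewrite opprK.
    exact: (is_derive1_comp (is_derive_expR _) dN).
  have dP : is_derive x 1 (fun x : R => x^-1 ^+ n) (- (n%:R * x ^- n.+1)).
    have -> : (fun x : R => x^-1 ^+ n) = (fun x : R => x^-1) ^+ n.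
      by apply/funext => y; rewrite exprfctE.
    apply: is_derive_eq.
    rewrite /GRing.scale/= mulrN; congr (- _).
    case: n => [|n]; first by rewrite !mul0r.
    by rewrite -mulrA; congr (_ * _); rewrite exprVn -invfM -exprD addn2.
  have -> : (fun x : R => x ^- n * expR (- x^-1)) = (fun x : R => x^-1 ^+ n) * (fun x : R => expR (- x^-1)).
    by apply/funext => y; rewrite -exprVn.
  apply: is_derive_eq.
  rewrite /GRing.scale/= -!exprVn !exprS expr0.
  by move: (expR _) => e; move: (x^-1 ^+ n) => y; move: (x^-1) => z; ring.
- rewrite /flat ltxx mulr0 subr0.
  have h : h^-1 *: (flat n (h *: 1 + 0) - flat n 0) @[h --> 0^'] --> (0 : R).
    apply/cvgrPdist_le => e e0.
    pose K : R := n.+2%:R ^+ n.+2.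
    have K0 : 0 < K by rewrite exprn_gt0.
    near=> h; have h0 : h != 0 by near: h; exact: nbhs_dnbhs_neq.
    rewrite sub0r normrN [h *: 1]mulr1 addr0 [flat n 0]/flat ltxx subr0.
    have [hp|hn] := ltP 0 h; last first.
      by rewrite /flat ltNge hn/= scaler0 normr0 ltW.
    rewrite (_ : h^-1 *: flat n h = flat n.+1 h); last first.
      by rewrite /flat hp /GRing.scale/= exprS invfM mulrA.
    rewrite ger0_norm ?flat_ge0// (le_trans (flat_le _ hp))// -/K -ler_pdivlMl//.
    apply: (le_trans (ler_norm _)); near: h.
    apply: dnbhs0_le; rewrite mulr_gt0// invr_gt0//.
  apply: DeriveDef; first by apply/cvg_ex; exists 0.
  exact/cvg_lim.
Unshelve. all: by end_near. Qed.

Lemma smooth_upto_flat N k n (i : 'I_N) (c d : R) :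
  smooth_upto k (fun x : 'rV[R]_N => flat n (c * x ord0 i + d)).
Proof.
pose l (x : 'rV[R]_N) := c * x ord0 i + d.
have dl x v : is_derive x v l (c * v ord0 i).
  have e : (fun h => h^-1 *: (l (h *: v + x) - l x)) @ 0^' --> c * v ord0 i.
    have : cst (c * v ord0 i) @ (0 : R)^' --> c * v ord0 i by exact: cvg_cst.
    apply: cvg_trans; apply: near_eq_cvg; near=> h.
    have h0 : h != 0 by near: h; exact: nbhs_dnbhs_neq.
    by rewrite /l /= !mxE /GRing.scale/=; field.
  apply: DeriveDef; first by apply/cvg_ex; eexists; exact: e.
  exact/cvg_lim.
have difl x : differentiable l x.
  apply: differentiableD => //; apply: differentiableM => //.
  exact: differentiable_coord.
have dfl m x : differentiable (fun x : 'rV[R]_N => flat m (l x)) x.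
  apply: (differentiable_comp (f := l) (g := flat m)) => //.
  by apply/derivable1_diffP; case: (is_derive_flat m (l x)).
elim: k n => [|k IH] n; first by split=> // x; exact: dfl.
split=> [x|j]; first exact: dfl.
have -> : partial j (fun x : 'rV[R]_N => flat n (l x)) =
    (c * (delta_mx ord0 j : 'rV[R]_N) ord0 i) *: (fun x => flat n.+2 (l x)) +
    ((c * (delta_mx ord0 j : 'rV[R]_N) ord0 i * - n%:R) *: (fun x => flat n.+1 (l x)) + 0).
  apply/funext => x; rewrite addr0.
  have [df dfE] := is_derive_flat n (l x).
  rewrite /partial deriveE; last exact: dfl.
  rewrite (_ : (fun x => flat n (l x)) = flat n \o l)// diff_comp//; last exact/derivable1_diffP.
  have [_ dlE] := dl x (delta_mx ord0 j).
  rewrite /comp deriv1E// derive1E dfE -deriveE// dlE.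
  rewrite -[RHS]/(c * delta_mx ord0 j ord0 i * flat n.+2 (l x) +
    c * delta_mx ord0 j ord0 i * - n%:R * flat n.+1 (l x)) /GRing.scale/=.
  by move: (delta_mx _ _ _ _) => t; ring.
apply: smooth_uptoP; first exact: IH.
apply: smooth_uptoP; first exact: IH.
exact: smooth_upto0.
Unshelve. all: by end_near. Qed.

End flat_functions.

Section box_bumps.
Context {R : realType} {N : nat}.
Implicit Types (a b x : 'rV[R]_N).

Definition closed_box a b : set 'rV[R]_N :=
  [set x | forall i, a ord0 i <= x ord0 i <= b ord0 i].

(** Smooth functions supported in the closed box that tend to the indicator of
    the open one: each side carries a factor vanishing flatly at either end, and
    [m] rescales the distance to the ends. *)
Definition bump a b (m : nat) x : R := \prod_(i < N)
  (flat 0 (m.+1%:R * x ord0 i + - (m.+1%:R * a ord0 i)) *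
   flat 0 (- m.+1%:R * x ord0 i + m.+1%:R * b ord0 i)).

Lemma flat0_le1 (t : R) : flat 0 t <= 1.
Proof.
rewrite /flat; case: ifPn => // t0; rewrite expr0 invr1 mul1r.
by rewrite -expR0 ler_expR oppr_le0 invr_ge0 ltW.
Qed.

Lemma bump_ge0 a b m x : 0 <= bump a b m x.
Proof. by apply: prodr_ge0 => i _; rewrite mulr_ge0 ?flat_ge0. Qed.

Lemma bump_le1 a b m x : bump a b m x <= 1.
Proof.
apply: prodr_ile1 => i _; rewrite mulr_ge0 ?flat_ge0//=.
by rewrite mulr_ile1 ?flat_ge0 ?flat0_le1.
Qed.

Lemma bump_out a b m x : ~ open_box a b x -> bump a b m x = 0.
Proof.
move=> /existsNP[i /negP]; rewrite negb_and -!leNgt => h.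
have f0 (t : R) : t <= 0 -> flat 0 t = 0 by rewrite /flat ltNge => ->.
rewrite /bump (bigD1 i)//=; case/orP : h => h.
  by rewrite f0 ?mul0r// subr_le0 ler_wpM2l.
by rewrite [X in _ * X * _]f0 ?mulr0 ?mul0r// mulNr addrC subr_le0 ler_wpM2l.
Qed.

Lemma bump_cvg a b x : open_box a b x -> bump a b m x @[m --> \oo] --> (1 : R).
Proof.
move=> abx.
have c t : 0 < t -> flat 0 (m.+1%:R * t) @[m --> \oo] --> (1 : R).
  move=> t0.
  have -> : (fun m : nat => flat 0 (m.+1%:R * t)) = (fun m => expR (- (t^-1 * m.+1%:R^-1))).
    by apply/funext => m; rewrite /flat mulr_gt0// expr0 invr1 mul1r invfM mulrC.
  have h : - (t^-1 * m.+1%:R^-1) @[m --> \oo] --> - (t^-1 * 0).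
    by apply: cvgN; apply: cvgM; [exact: cvg_cst|exact: cvg_harmonic].
  rewrite mulr0 oppr0 in h.
  by have := cvg_comp _ _ h (continuous_expR (x := 0)); rewrite expR0.
rewrite /bump; elim: (index_enum 'I_N) => [|i s IH].
  by under eq_fun do rewrite big_nil; exact: cvg_cst.
have /andP[ax xb] := abx i.
have h1 : flat 0 (m.+1%:R * x ord0 i + - (m.+1%:R * a ord0 i)) @[m --> \oo] --> (1 : R).
  by under eq_fun do rewrite -mulrBr; apply: c; rewrite subr_gt0.
have h2 : flat 0 (- m.+1%:R * x ord0 i + m.+1%:R * b ord0 i) @[m --> \oo] --> (1 : R).
  by under eq_fun do rewrite mulNr addrC -mulrBr; apply: c; rewrite subr_gt0.
under eq_fun do rewrite big_cons.
have h3 := cvgM (cvgM h1 h2) IH; rewrite !mulr1 in h3.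
exact: h3.
Qed.

Lemma compact_closed_box a b : compact (closed_box a b).
Proof.
have -> : closed_box a b = [set x | forall i, `[a ord0 i, b ord0 i]%classic (x ord0 i)].
  by apply/seteqP; split=> x /= h i; have := h i; rewrite in_itv.
by apply: (rV_compact (A := fun i => `[a ord0 i, b ord0 i]%classic)) => i; exact: segment_compact.
Qed.

Lemma test_function_bump (Omega : set 'rV[R]_N) a b m : closed_box a b `<=` Omega ->
  test_function Omega (bump a b m).
Proof.
move=> abO; have sub : Defs.support (bump a b m) `<=` closed_box a b.
  rewrite /Defs.support (closure_id (closed_box a b)).1; last first.
    by apply: compact_closed; [exact: norm_hausdorff|exact: compact_closed_box].
  apply: closure_subset => x /= h i.
  have /(_ i)/andP[ax xb] : open_box a b x.
    by apply: contrapT => /bump_out; move/eqP: h => h /(_ m).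
  by rewrite !ltW.
split.
- move=> k; apply: smooth_upto_prod => i.
  by apply: smooth_uptoM; exact: smooth_upto_flat.
- apply: (@subclosed_compact _ _ (closed_box a b)) => //.
    exact: closed_closure.
  exact: compact_closed_box.
- exact: subset_trans sub abO.
Qed.

End box_bumps.

(** * The fundamental lemma of the calculus of variations *)

Section fundamental_lemma.
Context {R : realType} {N : nat}.
Notation mu := (@lebesgue_rV R N).

Let boxes : set (set 'rV[R]_N) := [set A | exists a b, A = open_box a b].

Let box_measurable_coord i :
  measurable_fun [set: g_sigma_algebraType boxes] (fun x : g_sigma_algebraType boxes => (x : 'rV[R]_N) ord0 i).
Proof.
apply: (measurability _ (RGenOpens.measurableE R)).
move=> _ [_ [a [b ->] <-]]; rewrite setTI.
pose lo (k : nat) : 'rV[R]_N := \row_j (if j == i then a else - k%:R).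
pose hi (k : nat) : 'rV[R]_N := \row_j (if j == i then b else k%:R).
rewrite (_ : _ @^-1` _ = \bigcup_k open_box (lo k) (hi k)).
  apply: (@bigcupT_measurable _ (g_sigma_algebraType boxes)) => k.
  by apply: sub_sigma_algebra; exists (lo k), (hi k).
apply/seteqP; split=> [x /=|x [k _ /(_ i)]]; rewrite /= in_itv/=; last by rewrite !mxE eqxx.
move=> xab; exists (Num.truncn `|x|).+1 => // j; rewrite !mxE; case: eqVneq => [->//|_].
have : `|x ord0 j| < (Num.truncn `|x|).+1%:R.
  by apply: (rV_norm_lt x _).1 => //; exact: truncnS_gt.
by rewrite ltr_norml.
Qed.

Lemma measurable_boxes : @measurable _ 'rV[R]_N = <<s boxes >>.
Proof.
apply/seteqP; split.
  apply: smallest_sub; first exact: smallest_sigma_algebra.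
  move=> A; rewrite -bigcup_seq => -[i _ [B mB <-]]; rewrite setTI.
  by have := box_measurable_coord i measurableT mB; rewrite setTI.
apply: smallest_sub; first exact: sigma_algebra_measurable.
by move=> A [a [b ->]]; exact: measurable_open_box.
Qed.

Lemma open_boxI (a b a' b' : 'rV[R]_N) : open_box a b `&` open_box a' b' =
  open_box (\row_i Num.max (a ord0 i) (a' ord0 i)) (\row_i Num.min (b ord0 i) (b' ord0 i)).
Proof.
apply/seteqP; split=> [x [h1 h2] i|x h].
  by rewrite !mxE gt_max lt_min; have /andP[-> ->] := h1 i; have /andP[-> ->] := h2 i.
by split=> i; have := h i; rewrite !mxE gt_max lt_min => /andP[/andP[? ?] /andP[? ?]]; apply/andP.
Qed.

Variables (Omega : set 'rV[R]_N) (oO : open Omega) (k : 'rV[R]_N -> R).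
Hypothesis ik : mu.-integrable Omega (EFin \o k).
Hypothesis k0 : forall phi, test_function Omega phi ->
  (\int[mu]_(x in Omega) (k x * phi x)%:E = 0)%E.

Let mO : measurable Omega. Proof. exact: open_measurable_rV. Qed.

(** Dominated convergence along the bump functions of the box. *)
Lemma integral_box_eq0 (a b : 'rV[R]_N) : closed_box a b `<=` Omega ->
  (\int[mu]_(x in open_box a b) (k x)%:E = 0)%E.
Proof.
move=> abO.
have bO : open_box a b `<=` Omega.
  by move=> x h; apply: abO => i; have /andP[? ?] := h i; rewrite !ltW.
have mk : measurable_fun Omega k by apply/measurable_EFinP; case/integrableP : ik.
have mB : measurable (open_box a b) by exact: measurable_open_box.
have mbump m : measurable_fun [set: 'rV[R]_N] (bump a b m).
  apply: continuous_measurable_rV => x; apply/differentiable_continuous.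
  by have [sb _ _] := test_function_bump m abO; have [] := sb 0%N.
have dc := @dominated_convergence _ _ _ mu Omega mO
  (fun m x => (k x * bump a b m x)%:E) (fun x => (k x * \1_(open_box a b) x)%:E)
  (fun x => `|k x|%:E)
  (fun m => (measurable_EFinP _ _).2 (measurable_funM mk (measurable_funTS (mbump m))))
  ((measurable_EFinP _ _).2 (measurable_funM mk (measurable_funTS (measurable_indic mB)))).
have [] := dc.
- apply: aeW => x Ox; apply: cvg_EFin; first by apply: nearW.
  apply: cvgM; first exact: cvg_cst.
  rewrite indicE; have [Bx|Bx] := pselect (open_box a b x).
    by rewrite mem_set//; exact: bump_cvg.
  rewrite (memNset Bx); have -> : (fun m => bump a b m x) = cst 0; last exact: cvg_cst.
  by apply/funext => m; exact: bump_out.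
- have := integrable_norm ik; exact.
- apply: aeW => x m Ox; rewrite lee_fin normrM ler_piMr//.
  by rewrite ger0_norm ?bump_ge0 ?bump_le1.
move=> _ _.
rewrite (_ : [sequence _]_n = cst 0%E); last first.
  by apply/funext => m /=; apply: k0; exact: test_function_bump.
have -> : (\int[mu]_(x in Omega) (k x * \1_(open_box a b) x)%:E =
           \int[mu]_(x in open_box a b) (k x)%:E)%E.
  rewrite [LHS]integral_mkcond [RHS]integral_mkcond; apply: eq_integral => x _.
  rewrite /patch indicE; have [Bx|Bx] := pselect (open_box a b x).
    by rewrite !mem_set//= ?mulr1//; exact: bO.
  by rewrite (memNset Bx) mulr0; case: ifP.
move=> h; have h0 : (0%E @[m --> \oo] --> (0%E : \bar R)) by exact: cvg_cst.
by apply/esym; exact: (cvg_unique _ h0 h).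
Qed.

(** Open boxes form a pi-system that generates the Borel sets, so the integral of
    [k] vanishes on every Borel subset of a small box in [Omega], and [k] is zero
    almost everywhere in it. Countably many of these boxes cover [Omega]. *)
Lemma ae_eq0_of_test : ae_in Omega (fun x => k x = 0).
Proof.
have mk : measurable_fun Omega k by apply/measurable_EFinP; case/integrableP : ik.
have hbox (q : 'rV[rat]_N) m : rat_box q m 2 `<=` Omega ->
    {ae mu, forall x, rat_box q m 1 x -> k x = 0}.
  move=> qO; pose Q := rat_box q m (1 : R).
  have mQ : measurable Q by exact: measurable_open_box.
  have m0 : 0 < m.+1%:R^-1 :> R by rewrite invr_gt0.
  have QO (a b : 'rV[R]_N) :
      let a' := \row_i Num.max (ratr (q ord0 i) - 1 * m.+1%:R^-1) (a ord0 i) in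
      let b' := \row_i Num.min (ratr (q ord0 i) + 1 * m.+1%:R^-1) (b ord0 i) in
      closed_box a' b' `<=` Omega.
    move=> a' b' x h; apply: qO => i; have := h i; rewrite !mxE ge_max le_min.
    move=> /andP[/andP[h1 _] /andP[h2 _]].
    move: (ratr _) (x ord0 i) (m.+1%:R^-1) m0 h1 h2 => r y c c0 h1 h2.
    by apply/andP; split; lra.
  have QsubO : Q `<=` Omega.
    move=> x h; apply: qO; apply/rat_boxP => i; move/rat_boxP : h => /(_ i) h.
    by rewrite (lt_le_trans h)// ler_wpM2r ?(ltW m0)// ler1n.
  have iQ S : measurable S -> mu.-integrable (Q `&` S) (EFin \o k).
    move=> mS; apply: integrableS ik => //; first exact: measurableI.
    by move=> x [/QsubO].
  have hQ S : measurable S -> (\int[mu]_(x in Q `&` S) (k x)%:E = 0)%E.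
    rewrite [X in X S]measurable_boxes; move: S.
    apply: (@dynkin_induction _ _ boxes (fun S => (\int[mu]_(x in Q `&` S) (k x)%:E = 0)%E) measurable_boxes).
    - by move=> _ _ [a [b ->]] [a' [b' ->]]; rewrite open_boxI; eexists; eexists.
    - rewrite setIT; apply: integral_box_eq0.
      apply: subset_trans (QO (\row_i (ratr (q ord0 i) - 1 * m.+1%:R^-1)) (\row_i (ratr (q ord0 i) + 1 * m.+1%:R^-1))).
      by move=> x h i; have := h i; rewrite !mxE !maxxx !minxx.
    - move=> _ [a [b ->]]; rewrite /Q /rat_box open_boxI; apply: integral_box_eq0.
      by apply: subset_trans (QO a b) => x h i; have := h i; rewrite !mxE.
    - move=> S mS S0.
      have QT : (\int[mu]_(x in Q `&` setT) (k x)%:E = 0)%E.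
        rewrite setIT; apply: integral_box_eq0.
        apply: subset_trans (QO (\row_i (ratr (q ord0 i) - 1 * m.+1%:R^-1)) (\row_i (ratr (q ord0 i) + 1 * m.+1%:R^-1))).
        by move=> x h i; have := h i; rewrite !mxE !maxxx !minxx.
      move: QT; rewrite -(setUv S) setIUr integral_setU.
      + by rewrite S0 add0e.
      + exact: measurableI.
      + by apply: measurableI => //; exact: measurableC.
      + rewrite -setIUr setUv.
        by have /integrableP[] := iQ setT measurableT.
      + by apply/disj_setPS => x [[_ ?] [_ ?]].
    - move=> F mF tF F0; rewrite setI_bigcupr integral_bigcup.
      + by apply: eseries0 => i _ _; exact: F0.
      + apply/trivIsetP => i j _ _ ij; rewrite setIACA setIid.
        by move/trivIsetP : tF => /(_ _ _ I I ij) ->; rewrite setI0.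
      + by move=> i; exact: measurableI.
      + by rewrite -setI_bigcupr; apply: iQ; exact: bigcupT_measurable.
  have : ae_eq mu Q (EFin \o k) (cst 0%E).
    apply: integral_ae_eq => //.
    - by have := iQ setT measurableT; rewrite setIT.
    - move=> E EQ mE; rewrite integral0.
      by have := hQ _ mE; rewrite setIC (setIidl EQ).
  by apply: filterS => x h /h[].
have hall := @ae_foralln _ _ _ mu (fun i x => if @unpickle ('rV[rat]_N * nat)%type i is Some qm then
  rat_box qm.1 qm.2 2 `<=` Omega -> rat_box qm.1 qm.2 1 x -> k x = 0 else True).
have {}hall := hall _; apply: filterS (hall _) => [x hx Ox|i].
  move: Ox; rewrite (open_bigcup_rat_box oO) => -[[q m] /= qO xq].
  by have := hx (pickle (q, m)); rewrite pickleK; exact.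
case: unpickle => [[q m]|]; last exact: aeW.
have [qO|qO] := pselect (rat_box q m 2 `<=` Omega); last by apply: aeW => x /qO.
by apply: filterS (hbox q m qO) => x + _; exact.
Qed.

End fundamental_lemma.

(** * Primitives of Caratheodory functions *)

Section primitive_of_continuous.
Context {R : realType}.
Notation leb := (@lebesgue_measure R).
Variables (h : R -> R).
Hypothesis ch : continuous h.

Let ih a b : leb.-integrable `[a, b] (EFin \o h).
Proof.
apply: continuous_compact_integrable; first exact: segment_compact.
exact: continuous_subspaceT.
Qed.

Lemma primitive_from (a s : R) : a < 0 -> a < s ->
  primitive h s = \int[leb]_(t in `[a, s]) h t - \int[leb]_(t in `[a, 0]) h t.
Proof.
move=> a0 as_; rewrite /primitive; case: leP => s0.
  rewrite (@Rintegral_itvB _ h (BLeft a) (BRight s) 0) ?bnd_simp ?(ltW a0)//.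
  rewrite Rintegral_itv_obnd_cbnd//.
  by apply: integrableS (ih 0 s) => //; exact: subset_itv_oc_cc.
rewrite -[RHS]opprB; congr (- _).
rewrite (@Rintegral_itvB _ h (BLeft a) (BRight 0) s) ?bnd_simp ?(ltW as_) ?(ltW s0)//.
rewrite Rintegral_itv_obnd_cbnd//.
by apply: integrableS (ih s 0) => //; exact: subset_itv_oc_cc.
Qed.

Lemma is_derive_primitive (s : R) : is_derive s 1 (primitive h) (h s).
Proof.
pose a := - (`|s| + 1).
have a0 : a < 0 by rewrite /a oppr_lt0 ltr_wpDl.
have as_ : a < s.
  rewrite /a ltrNl (le_lt_trans (ler_norm _))// normrN ltrDl.
  exact: ltr01.
have s1 : s < s + 1 by rewrite ltrDl.
have [d e] := continuous_FTC1_closed s1 (ih a (s + 1)) as_ (ch (x := s)).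
set F := (fun x => \int[leb]_(t in `[a, x]) h t)%R in d e.
apply: (@near_eq_is_derive _ _ _ (F - cst (\int[leb]_(t in `[a, 0]) h t))).
  near=> t; rewrite (@primitive_from a t)//.
  by near: t; exact: lt_nbhsr.
apply: is_derive_eq.
  apply: is_deriveB.
  by apply: DeriveDef; [exact: d|rewrite -derive1E; exact: e].
by rewrite subr0.
Unshelve. all: by end_near. Qed.

Lemma primitive_MVT (s s' : R) : exists2 c,
  Num.min s s' <= c <= Num.max s s' & primitive h s - primitive h s' = h c * (s - s').
Proof.
have cp : continuous (primitive h).
  move=> x; apply/differentiable_continuous/derivable1_diffP.
  by case: (is_derive_primitive x).
have MV (a b : R) : a <= b -> exists2 c, a <= c <= b & primitive h b - primitive h a = h c * (b - a).
  move=> ab; have := @MVT_segment R (primitive h) h a b ab.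
  move=> [x _||c cab e]; [exact: is_derive_primitive|exact: continuous_subspaceT|].
  by exists c => //; move: cab; rewrite in_itv.
have [ss|ss] := leP s s'; last first.
  by have [c c1 c2] := MV _ _ (ltW ss); exists c.
have [c c1 c2] := MV _ _ ss; exists c => //.
by rewrite -[LHS]opprB c2 -mulrN opprB.
Qed.

Lemma primitive_0 : primitive h 0 = 0.
Proof. by rewrite /primitive lexx set_itv1 Rintegral_set1. Qed.

End primitive_of_continuous.

Section caratheodory.
Context {R : realType} {N : nat}.
Notation leb := (@lebesgue_measure R).
Notation mu := (@lebesgue_rV R N).
Variables (Omega : set 'rV[R]_N) (mO : measurable Omega) (g : 'rV[R]_N -> R -> R).
Hypothesis mg : forall s, lebesgue_measurable Omega (g ^~ s).
Hypothesis cg : ae_in Omega (fun x => continuous (g x)).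

Let grid (n : nat) (s : R) : R := (Num.floor (s * n.+1%:R))%:~R / n.+1%:R.

Let cvg_grid s : grid n s @[n --> \oo] --> s.
Proof.
apply/cvgrPdist_le => e e0; near=> n.
have n0 : 0 < n.+1%:R :> R by [].
have -> : s - grid n s = (s * n.+1%:R - (Num.floor (s * n.+1%:R))%:~R) / n.+1%:R.
  by rewrite /grid mulrBl mulfK ?gt_eqF.
rewrite normrM [`|_^-1|]gtr0_norm ?invr_gt0// ler_pdivrMr// ger0_norm ?subr_ge0 ?floor_le//.
apply: (@le_trans _ _ 1).
  by rewrite lerBlDl ltW// (lt_le_trans (floorD1_gt _))// intrD.
rewrite -ler_pdivrMl// mulr1 (@le_trans _ _ n%:R)// ?ler_nat//.
near: n; exact: nbhs_infty_ger.
Unshelve. all: by end_near. Qed.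

(** A continuous function is the limit of its values at the grid points below its
    argument; these are countably many, so the exceptional null sets of the
    Borel versions of [g ^~ s] add up to a null set. *)
Lemma joint_version : exists k : 'rV[R]_N * measurableTypeR R -> \bar R,
  measurable_fun [set: _] k /\ ae_in Omega (fun x => forall s, k (x, s) = (g x s)%:E).
Proof.
have /choice[h0 hh0] : forall s, exists h : 'rV[R]_N -> R,
    measurable_fun Omega h /\ ae_in Omega (fun x => g x s = h x).
  by move=> s; have [h ? ?] := mg s; exists h.
pose kn n (z : 'rV[R]_N * measurableTypeR R) := (h0 (grid n z.2) \_ Omega) z.1.
have mkn n : measurable_fun [set: _] (kn n).
  move=> _ Y mY; rewrite setTI.
  rewrite (_ : _ @^-1` _ = \bigcup_(j : int) (((h0 (j%:~R / n.+1%:R) \_ Omega) @^-1` Y) `*`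
     [set s : measurableTypeR R | Num.floor (s * n.+1%:R) = j])); last first.
    apply/seteqP; split=> [[x s] /= h|[x s] [j _ [/= h1 h2]]].
      by exists (Num.floor (s * n.+1%:R)).
    by rewrite /kn/= /grid h2.
  apply: countable_bigcupT_measurable => // j; apply: measurableX.
    rewrite -[X in measurable X]setTI.
    by apply: (measurable_restrictT _ mO).1 => //; exact: (hh0 _).1.
  rewrite (_ : [set s | _] = [set s : measurableTypeR R | `[j%:~R, (j + 1)%:~R[%classic (s * n.+1%:R)]).
    rewrite -[X in measurable X]setTI.
    have ms : measurable_fun [set: measurableTypeR R] (fun s : R => s * n.+1%:R).
      exact: measurable_funM.
    exact: (ms measurableT _ (measurable_itv _)).
  apply/seteqP; split=> s /=; rewrite in_itv/=.
    by move=> <-; rewrite floor_le floorD1_gt.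
  by move=> h; apply/eqP; rewrite floor_eq.
exists (fun z => limn_esup (fun n => (kn n z)%:E)); split.
  by apply: measurable_fun_limn_esup => n; exact/measurable_EFinP.
have hgrid := @ae_in_forallN R N Omega (fun i x => if @unpickle (int * nat)%type i is Some jn then
   g x (jn.1%:~R / jn.2.+1%:R) = h0 (jn.1%:~R / jn.2.+1%:R) x else True).
have {}hgrid := hgrid (fun i => match @unpickle (int * nat)%type i as o return
   ae_in Omega (fun x => if o is Some jn then
   g x (jn.1%:~R / jn.2.+1%:R) = h0 (jn.1%:~R / jn.2.+1%:R) x else True) with
   | Some jn => (hh0 _).2 | None => ae_in_all (fun _ _ => I) end).
apply: ae_inS2 hgrid cg => x Ox hx cx s.
rewrite (cvg_limn_einf_sup (l := (g x s)%:E) _).2//.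
apply: cvg_EFin; first by apply: nearW.
have -> : fine \o (fun n => (kn n (x, s))%:E) = fun n => g x (grid n s).
  apply/funext => n; rewrite /= /kn/= /patch mem_set//.
  by have := hx (pickle (Num.floor (s * n.+1%:R), n)); rewrite pickleK => /esym.
exact: (cvg_comp _ _ (cvg_grid (s := s)) (cx s)).
Qed.

(** The primitive integrates the joint version over the region between [0] and
    the graph of [v]: its measurability is part of Tonelli's theorem, applied to
    the positive and the negative part. *)
Lemma primitive_measurable_version (v : 'rV[R]_N -> R) : measurable_fun [set: 'rV[R]_N] v ->
  lebesgue_measurable Omega (fun x => primitive (g x) (v x)).
Proof.
move=> mv; have [k [mk hk]] := joint_version.
pose part (D : set ('rV[R]_N * measurableTypeR R)) (x : 'rV[R]_N) : \bar R :=
  (\int[leb]_t ((k \_ D)^\+ (x, t)) - \int[leb]_t ((k \_ D)^\- (x, t)))%E.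
have mpart D : measurable D -> measurable_fun [set: 'rV[R]_N] (fun x => fine (part D x)).
  move=> mD; have mkD : measurable_fun [set: _] (k \_ D).
    by apply: (measurable_restrictT _ mD).1; exact: measurable_funTS.
  apply: (measurableT_comp (fine_measurable measurableT)).
  apply: emeasurable_funB.
    apply: (@measurable_fun_fubini_tonelli_F _ _ _ _ _ leb (k \_ D)^\+%E) => //.
    exact: measurable_funepos.
  apply: (@measurable_fun_fubini_tonelli_F _ _ _ _ _ leb (k \_ D)^\-%E) => //.
  exact: measurable_funeneg.
pose D1 := [set z : 'rV[R]_N * measurableTypeR R | 0 <= z.2 <= v z.1].
pose D2 := [set z : 'rV[R]_N * measurableTypeR R | v z.1 <= z.2 <= 0].
have mv1 : measurable_fun [set: 'rV[R]_N * measurableTypeR R] (fun z => v z.1).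
  exact: measurableT_comp mv measurable_fst.
have m2 : measurable_fun [set: 'rV[R]_N * measurableTypeR R] (fun z => z.2 : R).
  exact: measurable_snd.
have mD1 : measurable D1.
  have mb : measurable_fun [set: 'rV[R]_N * measurableTypeR R] (fun z => 0 <= (z.2 : R) <= v z.1).
    by apply: measurable_and; apply: measurable_fun_ler.
  by rewrite -[X in measurable X]setTI; exact: (mb measurableT [set true]).
have mD2 : measurable D2.
  have mb : measurable_fun [set: 'rV[R]_N * measurableTypeR R] (fun z => v z.1 <= (z.2 : R) <= 0).
    by apply: measurable_and; apply: measurable_fun_ler.
  by rewrite -[X in measurable X]setTI; exact: (mb measurableT [set true]).
exists (fun x => if 0 <= v x then fine (part D1 x) else - fine (part D2 x)).
  apply: measurable_funTS; apply: measurable_fun_ifT.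
  - exact: measurable_fun_ler.
  - exact: mpart.
  - by apply: measurable_funN; exact: mpart.
have partE D x a b : (forall t, D (x, t) <-> a <= t <= b) ->
  (forall t, k (x, t) = (g x t)%:E) -> fine (part D x) = \int[leb]_(t in `[a, b]) g x t.
  move=> hD hkx; rewrite /part /Rintegral; congr fine.
  rewrite integral_mkcond integralE.
  have e t : (k \_ D) (x, t) = ((fun t => (g x t)%:E) \_ `[a, b]) t.
    rewrite /patch; have [Dt|Dt] := pselect (D (x, t)).
      by rewrite !mem_set//= in_itv/=; exact/hD.
    by rewrite !memNset//= in_itv/=; move=> /hD.
  by congr (_ - _)%E; apply: eq_integral => t _; rewrite ?funeposE ?funenegE e.
apply: ae_inS hk => x Ox hkx; rewrite /primitive; case: ifPn => v0.
  by rewrite (@partE D1 x 0 (v x)).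
by rewrite (@partE D2 x (v x) 0).
Qed.

End caratheodory.

(** * Alexander-Spanier cohomology at an isolated point *)

Section isolated_point.
Context {T : topologicalType} (G : zmodType).
Variables (X : set T) (x0 : T).
Hypothesis hT : hausdorff_space T.
Hypothesis X0 : X x0.
Hypothesis isoX : exists2 U, nbhs x0 U & forall x, X x -> U x -> x = x0.

Let cst_tuple q : 'I_q.+1 -> T := fun _ => x0.

(** Near an isolated point the only tuple of points of [X] is the constant one. *)
Lemma locally_zero_isolated q (phi : @cochain T G q) :
  locally_zero X phi <-> locally_zero (X `\ x0) phi /\ phi (@cst_tuple q) = 0.
Proof.
split=> [h|[h0 hc] x Xx].
  split=> [x [Xx _]|].
    by have [U xU hU] := h _ Xx; exists U => // t ht; apply: hU => i; have [[]] := ht i.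
  have [U xU hU] := h _ X0; apply: hU => i; split => //.
  exact: nbhs_singleton.
have [->|xx0] := eqVneq x x0.
  have [U x0U hU] := isoX; exists U => // t ht.
  rewrite (_ : t = @cst_tuple q) //; apply/funext => i.
  by have [? ?] := ht i; exact: hU.
have Xx0 : (X `\ x0) x by split => //; exact/eqP.
have [U xU hU] := h0 _ Xx0.
exists (U `&` ~` [set x0]).
  apply: filterI => //; apply: open_nbhs_nbhs; split; last exact/eqP.
  by apply: closed_openC; apply: accessible_closed_set1; exact: hausdorff_accessible.
by move=> t ht; apply: hU => i; have [Xt [Ut tx0]] := ht i.
Qed.

Lemma sum_alternating (a : G) n :
  \sum_(i < n) a *~ (-1) ^+ i = if odd n then a else 0.
Proof.
elim: n => [|n IH]; first by rewrite big_ord0.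
rewrite big_ord_recr /= IH -signr_odd.
by case: (odd n); rewrite /= ?expr0 ?expr1 ?mulrN1z ?subrr// mulr1z add0r.
Qed.

Lemma differential_cst q (phi : @cochain T G q) :
  differential phi (@cst_tuple q.+1) = if odd q then phi (@cst_tuple q) else 0.
Proof.
rewrite /differential (eq_bigr (fun i : 'I_q.+2 => phi (@cst_tuple q) *~ (-1) ^+ i))//.
by rewrite sum_alternating /= negbK.
Qed.

Let H q := AS_cohomology G X (X `\ x0) q.

Let point_cochain q (a : G) : @cochain T G q := fun t => if `[< t = @cst_tuple q >] then a else 0.

Let point_cochain_cst q a : @point_cochain q a (@cst_tuple q) = a.
Proof. by rewrite /point_cochain asboolT. Qed.

Let point_cochain_away q (t : 'I_q.+1 -> T) a i : t i <> x0 -> point_cochain a t = 0.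
Proof. by move=> ti; rewrite /point_cochain asboolF// => tE; apply: ti; rewrite tE. Qed.

Let point_cochain0 q a : locally_zero (X `\ x0) (@point_cochain q a).
Proof.
move=> x Xx; exists setT; first exact: filterT.
move=> t /(_ ord0)[[_ ht] _]; exact: point_cochain_away ht.
Qed.

(** A relative cocycle of degree zero amounts to its value at the isolated point. *)
Lemma AS_cohomology_isolated0 : zmod_isomorphic (H 0) G.
Proof.
pose ev (c : H 0) : G := val (repr c) (@cst_tuple 0).
have evE (phi : @cocycle_type T G X (X `\ x0) 0) :
    ev (\pi_(H 0) phi)%qT = val phi (@cst_tuple 0).
  rewrite /ev; set psi := repr _.
  have : (\pi_(H 0) psi = \pi_(H 0) phi)%qT by rewrite /psi reprK.
  move/eqP; rewrite eqmodE => /asboolP /= /locally_zero_isolated[_].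
  by move/eqP; rewrite /= subr_eq0 => /eqP.
have evD : zmod_morphism ev.
  move=> c d; rewrite -[c]reprK -[d]reprK.
  rewrite -(raddfB (\pi_(H 0))%qT) !evE; exact: erefl.
pose evA : {additive H 0 -> G} := HB.pack ev (GRing.isZmodMorphism.Build _ _ ev evD).
exists evA.
have cP a : @point_cochain 0 a \in cocycle X (X `\ x0) (q:=0).
  apply/asboolP; split=> //; apply/locally_zero_isolated; split.
    move=> x Xx; exists (~` [set x0]).
      apply: open_nbhs_nbhs; split; last by case: Xx.
      by apply: closed_openC; apply: accessible_closed_set1; exact: hausdorff_accessible.
    move=> t ht; rewrite /differential big1// => i _.
    rewrite (@point_cochain_away _ _ _ ord0) ?mul0rz//=.
    by have [_] := ht (lift i ord0).
  by rewrite differential_cst.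
exists (fun a => \pi_(H 0) (exist (fun phi => phi \in cocycle X (X `\ x0) (q:=0)) _ (cP a)))%qT.
  move=> c; rewrite -[c]reprK; set phi := repr c.
  apply/eqP; rewrite eqmodE; apply/asboolP => /=.
  apply/locally_zero_isolated; split.
    have /asboolP[h _] := valP phi.
    exact: (locally_zeroB (@point_cochain0 0 _) h).
  transitivity (@point_cochain 0 (ev (\pi_(H 0) phi)%qT) (@cst_tuple 0) - val phi (@cst_tuple 0)) => //.
  by rewrite point_cochain_cst evE subrr.
by move=> a; rewrite /= evE /= point_cochain_cst.
Qed.

(** Evaluation at constant tuples identifies the relative complex with
    [G -> G -> G -> G ...], whose maps are alternately zero and the identity since
    they are alternating sums of equal terms. It is exact in positive degrees. *)
Lemma AS_cohomology_isolatedS q (c : H q.+1) : c = 0.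
Proof.
rewrite -[c]reprK; set phi := repr c.
have /asboolP[phi0 /locally_zero_isolated[_ dphi]] := valP phi.
transitivity (\pi_(H q.+1) 0)%qT; last by rewrite raddf0.
apply/eqP; rewrite eqmodE; apply/asboolP; rewrite subr0 /=.
pose a := val phi (@cst_tuple q.+1).
exists (@point_cochain q a); split=> //; apply/locally_zero_isolated; split.
  apply: locally_zeroB => // x Xx; exists (~` [set x0]).
    apply: open_nbhs_nbhs; split; last by case: Xx.
    by apply: closed_openC; apply: accessible_closed_set1; exact: hausdorff_accessible.
  move=> t ht; rewrite /differential big1// => i _.
  rewrite (@point_cochain_away _ _ _ ord0) ?mul0rz//=.
  by have [_] := ht (lift i ord0).
rewrite -[LHS]/(a - differential (@point_cochain q a) (@cst_tuple q.+1)).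
rewrite differential_cst point_cochain_cst.
move: dphi; rewrite differential_cst /= -/a.
by case: (odd q) => /= h; rewrite ?subrr ?h ?subrr ?subr0//.
Qed.

End isolated_point.

(** * Growth of the convex integrand *)

Section convex_integrand.
Context {R : realType} {N : nat}.
Implicit Types (F Psi : 'rV[R]_N -> R) (xi : 'rV[R]_N).

Lemma enormZ (s : R) xi : enorm (s *: xi) = `|s| * enorm xi.
Proof.
rewrite /enorm (eq_bigr (fun i => s ^+ 2 * xi ord0 i ^+ 2)); last first.
  by move=> i _; rewrite mxE exprMn.
by rewrite -mulr_sumr sqrtrM ?sqr_ge0// sqrtr_sqr.
Qed.

Lemma enorm_ge0 xi : 0 <= enorm xi.
Proof. exact: sqrtr_ge0. Qed.

Lemma coord_le_enorm xi i : `|xi ord0 i| <= enorm xi.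
Proof.
rewrite -sqrtr_sqr ler_sqrt; last by rewrite sumr_ge0// => j _; rewrite sqr_ge0.
by rewrite (bigD1 i)//= lerDl sumr_ge0// => j _; rewrite sqr_ge0.
Qed.

Lemma enorm_le_sum xi : enorm xi <= \sum_i `|xi ord0 i|.
Proof.
have s0 : 0 <= \sum_i `|xi ord0 i| by exact: sumr_ge0.
have -> : \sum_i `|xi ord0 i| = Num.sqrt ((\sum_i `|xi ord0 i|) ^+ 2).
  by rewrite sqrtr_sqr ger0_norm.
rewrite /enorm ler_wsqrtr// {s0}.
suff [] : \sum_i xi ord0 i ^+ 2 <= (\sum_i `|xi ord0 i|) ^+ 2 /\ 0 <= \sum_i `|xi ord0 i| by [].
elim/big_rec2: _ => [|i x y _ [h y0]]; first by rewrite expr0n.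
have a0 := normr_ge0 (xi ord0 i).
split; last exact: addr_ge0.
rewrite -[xi ord0 i ^+ 2]ger0_norm ?sqr_ge0// normrX; move: a0 h y0.
by move: (`|_|) => a a0 h y0; nra.
Qed.

Lemma convex_along_ray F xi (s : R) : convex_function setT F -> F 0 = 0 ->
  0 <= s <= 1 -> F (s *: xi) <= s * F xi.
Proof.
move=> cF F0 /andP[s0 s1].
have := cF (Itv01 s0 s1) xi 0 (mem_setT _) (mem_setT _).
rewrite convRE /= F0 mulr0 addr0.
by rewrite [X in F X](_ : _ = s *: xi)//= /conv/= scaler0 addr0.
Qed.

(** Convexity gives [F (s *: xi) / s <= F xi] for small [s], and the left-hand
    side tends to zero. *)
Lemma convex_ge0 F xi : convex_function setT F -> F 0 = 0 ->
  s^-1 * F (s *: xi) @[s --> 0^'+] --> 0 -> 0 <= F xi.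
Proof.
move=> cF F0 h; rewrite leNgt; apply/negP => Fneg.
have e0 : 0 < - F xi by rewrite oppr_gt0.
move/cvgr0Pnorm_lt : h => /(_ _ e0) h.
have [s [/= hs [s0 s1]]] : exists s : R, `|s^-1 * F (s *: xi)| < - F xi /\ (0 < s /\ s < 1).
  apply: (@filter_ex _ (at_right (0 : R))); near=> s; split; first by near: s.
  by split; near: s; [exact: nbhs_right_gt|exact: nbhs_right_lt].
move: hs; apply/negP; rewrite -leNgt.
have s01 : 0 <= s <= 1 by rewrite (ltW s0) (ltW s1).
have h1 := convex_along_ray xi cF F0 s01.
have : s^-1 * F (s *: xi) <= F xi by rewrite ler_pdivrMl.
move=> h2; rewrite ltr0_norm ?lerN2//; exact: le_lt_trans h2 Fneg.
Unshelve. all: by end_near. Qed.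

Section integrand.
Variables (p : R) (p1 : 1 < p) (Psi : 'rV[R]_N -> R).
Hypothesis hPsi : Psi_assumptions p Psi.

Let p0 : 0 < p. Proof. exact: lt_trans p1. Qed.

Lemma Psi_p0Z (s : R) xi : 0 <= s -> Psi_p0 p (s *: xi) = s `^ p * Psi_p0 p xi.
Proof. by move=> s0; rewrite /Psi_p0 enormZ ger0_norm// powRM ?enorm_ge0// mulrCA. Qed.

Lemma Psi_p0_cvg xi : s^-1 * Psi_p0 p (s *: xi) @[s --> 0^'+] --> 0.
Proof.
have c : ppow (p - 1) s * Psi_p0 p xi @[s --> 0^'+] --> 0 * Psi_p0 p xi.
  apply: cvgM; last exact: cvg_cst.
  rewrite -[X in _ --> X](@ppow_neg _ (p - 1) 0) ?subr_gt0//.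
  by apply: cvg_at_right_filter; apply: continuous_ppow; rewrite subr_gt0.
rewrite mul0r in c; apply: cvg_trans c; apply: near_eq_cvg; near=> s.
have s0 : 0 < s by near: s; exact: nbhs_right_gt.
rewrite Psi_p0Z ?(ltW s0)// (ppow_pos _ (ltW s0)) -(@mulr_powRB1 _ s p) ?(ltW s0)//.
by rewrite -!mulrA mulKf// gt_eqF.
Unshelve. all: by end_near. Qed.

Lemma Psi_p0_0 : Psi_p0 p (0 : 'rV[R]_N) = 0.
Proof. by rewrite -(scale0r 0) Psi_p0Z// powR0 ?mul0r// gt_eqF. Qed.

Lemma Psi_cvg xi : s^-1 * Psi (s *: xi) @[s --> 0^'+] --> 0.
Proof.
have [[dPsi _] Psi0 gPsi _ _] := hPsi.
have D0 : 'D_xi Psi 0 = 0.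
  rewrite deriveE// [xi in LHS]row_sum_delta linear_sum big1// => i _.
  rewrite linearZ/= -deriveE//.
  by move/rowP : gPsi => /(_ i); rewrite !mxE /partial => ->; rewrite scaler0.
have : derivable Psi 0 xi by exact: diff_derivable.
move=> /cvg_ex[l hl]; have := cvg_lim _ hl; rewrite -/('D_xi Psi 0) D0 => l0.
have {l0} l0 : 0 = l by exact: l0.
rewrite -l0 in hl; apply: cvg_trans (cvg_dnbhs_at_right hl).
apply: near_eq_cvg; near=> s.
by rewrite /= addr0 Psi0 subr0.
Unshelve. all: by end_near. Qed.

(** The function [Psi - nu * Psi_p0] is convex and vanishes with its derivative at
    the origin. It is therefore nonnegative and, along the ray, at most [1 - t]
    times its value at [xi]; since [(1 - t) ^ p <= 1 - t], the multiple of
    [Psi_p0] decreases by at least the fraction [t] when [xi] shrinks by [1 - t]. *)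
Lemma Psi_bounds : exists nu C : R, [/\ 0 < nu, 0 <= C,
  forall xi (t : R), 0 <= t <= 1 -> nu * (t * enorm xi `^ p) <= Psi xi - Psi ((1 - t) *: xi) &
  forall xi, 0 <= Psi xi <= C * enorm xi `^ p].
Proof.
have [_ Psi0 _ [nu [C [nu0 nuC c1 c2]]] _] := hPsi.
have C0 : 0 < C by exact: lt_le_trans nuC.
have lower xi (t : R) : 0 <= t <= 1 -> nu / p * (t * enorm xi `^ p) <= Psi xi - Psi ((1 - t) *: xi).
  move=> /andP[t0 t1]; have t10 : 0 <= 1 - t by rewrite subr_ge0.
  have t11 : 1 - t <= 1 by lra.
  have F0 : Psi 0 - nu * Psi_p0 p (0 : 'rV[R]_N) = 0 by rewrite Psi0 Psi_p0_0; ring.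
  have ray := @convex_along_ray (fun xi => Psi xi - nu * Psi_p0 p xi) xi (1 - t) c1 F0.
  have := ray (introT andP (conj t10 t11)); rewrite Psi_p0Z//.
  have Fge0 : 0 <= Psi xi - nu * Psi_p0 p xi.
    apply: (@convex_ge0 (fun xi => Psi xi - nu * Psi_p0 p xi)) => //.
    have h : s^-1 * Psi (s *: xi) - nu * (s^-1 * Psi_p0 p (s *: xi)) @[s --> 0^'+] --> 0 - nu * 0.
      by apply: cvgB; [exact: Psi_cvg|apply: cvgM; [exact: cvg_cst|exact: Psi_p0_cvg]].
    rewrite mulr0 subr0 in h; apply: cvg_trans h; apply: near_eq_cvg; near=> s.
    by rewrite /= mulrBr mulrCA.
  have pw : (1 - t) `^ p <= 1 - t.
    have [->|tn] := eqVneq (1 - t) 0; first by rewrite powR0 ?gt_eqF.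
    by apply: ge1r_powR; rewrite ?lt_def ?tn ?t10//= ltW.
  have pp : nu / p * (t * enorm xi `^ p) = nu * (t * Psi_p0 p xi).
    by rewrite /Psi_p0; field; rewrite gt_eqF.
  have P0 : 0 <= Psi_p0 p xi by rewrite /Psi_p0 mulr_ge0 ?powR_ge0 ?invr_ge0 ?(ltW p0).
  rewrite pp; move: Fge0 pw P0 nu0 t0 t1.
  move: (Psi xi) (Psi_p0 p xi) (Psi ((1 - t) *: xi)) ((1 - t) `^ p) => a b c d Fge0 pw P0 nu0 t0 t1 h.
  have : nu * (d * b) <= nu * ((1 - t) * b) by rewrite ler_wpM2l ?(ltW nu0)// ler_wpM2r.
  have : 0 <= t * (a - nu * b) by rewrite mulr_ge0.
  by move: h; clear; lra.
exists (nu / p), (C / p); split=> //.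
- by rewrite divr_gt0.
- by rewrite divr_ge0 ?ltW.
- move=> xi; apply/andP; split.
    have := lower xi 1; rewrite subrr scale0r Psi0 subr0 ler01 lexx => /(_ erefl).
    by apply: le_trans; rewrite mulr_ge0 ?divr_ge0 ?mul1r ?powR_ge0 ?ltW.
  have Fge0 : 0 <= C * Psi_p0 p xi - Psi xi.
    apply: (@convex_ge0 (fun xi => C * Psi_p0 p xi - Psi xi)) => //.
      by rewrite Psi0 Psi_p0_0; ring.
    have h : C * (s^-1 * Psi_p0 p (s *: xi)) - s^-1 * Psi (s *: xi) @[s --> 0^'+] --> C * 0 - 0.
      by apply: cvgB; [apply: cvgM; [exact: cvg_cst|exact: Psi_p0_cvg]|exact: Psi_cvg].
    rewrite mulr0 subr0 in h; apply: cvg_trans h; apply: near_eq_cvg; near=> s.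
    by rewrite /= mulrBr mulrCA.
  by rewrite -mulrA -subr_ge0.
Unshelve. all: by end_near. Qed.

End integrand.

End convex_integrand.

(** * Superlinear smallness of the lower-order term *)

Section superlinear_majorant.
Context {R : realType}.

(** The first summand serves [s <= T], the second [T <= s]. If the integral of
    [s ^ P] is of order [T ^ P], the powers of [T] make both of order [T ^ r]. *)
Lemma powR_interpolate (s T r P : R) : 0 <= s -> 0 < T -> 0 < r -> r <= P ->
  s `^ r <= T `^ r + T `^ (r - P) * s `^ P.
Proof.
move=> s0 T0 r0 rP; have [sT|Ts] := leP s T.
  apply: (@le_trans _ _ (T `^ r)); first by rewrite ge0_ler_powR ?nnegrE ?(ltW r0) ?(ltW T0).
  by rewrite lerDl mulr_ge0 ?powR_ge0.
have sp : 0 < s by exact: lt_trans Ts.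
apply: (@le_trans _ _ (T `^ (r - P) * s `^ P)); last by rewrite lerDr powR_ge0.
have -> : s `^ r = s `^ (r - P) * s `^ P.
  by rewrite -powRD ?subrK// (gt_eqF sp) implybT.
rewrite ler_wpM2r ?powR_ge0// -(opprB P r) !powRN lef_pV2 ?posrE ?powR_gt0//.
by rewrite ge0_ler_powR ?nnegrE ?subr_ge0 ?(ltW T0) ?(ltW sp) ?(ltW Ts).
Qed.

Lemma lipschitz_at0 (h : R -> R) (C : R) : (forall s, derivable h s 1) -> h 0 = 0 ->
  (forall s, `|s| <= 1 -> `|derive1 h s| <= C) -> forall s, `|s| <= 1 -> `|h s| <= C * `|s|.
Proof.
move=> dh h0 hC s s1.
have dd (t : R) : is_derive t 1 h (derive1 h t).
  by apply: DeriveDef => //; rewrite derive1E.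
have ch : continuous h.
  by move=> t; apply/differentiable_continuous/derivable1_diffP.
have [s0|s0] := leP 0 s.
  have [c|c cs e] := @MVT_segment R h (derive1 h) 0 s s0 (fun x _ => dd x).
    exact: continuous_subspaceT.
  move: e; rewrite h0 !subr0 => ->; rewrite normrM ler_wpM2r// hC//.
  move: cs s1; rewrite in_itv/= => /andP[c0 cs]; rewrite !ger0_norm//; exact: le_trans.
have [c|c cs e] := @MVT_segment R h (derive1 h) s 0 (ltW s0) (fun x _ => dd x).
  exact: continuous_subspaceT.
move: e; rewrite h0 !sub0r => /(congr1 (@Num.norm _ _)); rewrite normrN normrM normrN => ->.
rewrite ler_wpM2r// hC//.
move: cs s1; rewrite in_itv/= => /andP[c0 cs].
by rewrite (ltr0_norm s0) (ler0_norm cs); apply: le_trans; rewrite lerN2.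
Qed.

(** Where [`|u| <= 1], the derivative bound and [g x 0 = 0] give
    [`|g x s| <= C1 * `|s|], hence a majorant of order [`|u| ^ 2 <= `|u| ^ r] for
    [r <= 2]. Where [`|u| > 1], the growth of [g] gives one of order [`|u| ^ P] with
    [P] the critical Sobolev exponent. As [p < 2] and [p < P], one can take
    [r = min 2 P > p]. In dimension one, [u] is uniformly small instead and
    [r = 2]; in higher dimensions [p < 2] keeps [p] below the
    dimension. *)
Lemma superlinear_majorant n (Omega : set 'rV[R]_n.+1) (p : R) (p1 : 1 <= p)
    (g : 'rV[R]_n.+1 -> R -> R) :
  measurable Omega -> bounded_set Omega -> 1 < p -> p < 2 -> g_assumptions p Omega g ->
  ae_in Omega (fun x => g x 0 = 0) ->
  exists r K T0 : R, [/\ p < r, 0 <= K, 0 < T0 & forall u : W0 Omega p1,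
    0 < grad_norm Omega p (rep u) -> grad_norm Omega p (rep u) < T0 ->
    exists B : 'rV[R]_n.+1 -> R, [/\ measurable_fun Omega B, forall x, 0 <= B x,
      (\int[lebesgue_rV n.+1]_(x in Omega) (B x)%:E <= (K * grad_norm Omega p (rep u) `^ r)%:E)%E &
      ae_in Omega (fun x => forall s, `|s| <= `|fun_of u x| -> `|g x s| * `|fun_of u x| <= B x)]].
Proof.
move=> mO bO lt1p ltp2 [_ g1 [g2 _ _] g3] g0.
have [C1 C10 hC1] := g3 1 ltr01.
have p0 : 0 < p by exact: lt_trans lt1p.
have lip : ae_in Omega (fun x => forall s, `|s| <= 1 -> `|g x s| <= C1 * `|s|).
  by apply: ae_inS3 g1 hC1 g0 => x Ox [dg _] hg gx0; apply: lipschitz_at0.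
have muO : (lebesgue_rV n.+1 Omega < +oo)%E by exact: lebesgue_rV_bounded_lty.
pose m := fine (lebesgue_rV n.+1 Omega).
have mE : (lebesgue_rV n.+1 Omega = m%:E)%E by rewrite fineK// ge0_fin_numE.
have m0 : 0 <= m by rewrite fine_ge0.
case: n => [|n] in Omega g mO bO g1 g2 g3 g0 hC1 lip muO m mE m0 *.
  have [C C0 hC] := sup_W0 p1 mO bO lt1p.
  exists 2, (C1 * C ^+ 2 * m), (C + 1)^-1; split=> //.
  - by rewrite !mulr_ge0 ?sqr_ge0// ltW.
  - by rewrite invr_gt0 ltr_wpDl.
  move=> u T0 TC; set T := grad_norm Omega p (rep u) in T0 TC *.
  have CT : C * T <= 1.
    have := TC; rewrite -[ltRHS]mul1r ltr_pdivlMr ?ltr_wpDl// => h.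
    by apply: le_trans (ltW h); rewrite mulrC; nra.
  exists (fun=> C1 * (C * T) ^+ 2); split=> //.
  - by move=> x; rewrite mulr_ge0 ?sqr_ge0// ltW.
  - have -> : (\int[lebesgue_rV 1]_(x in Omega) (C1 * (C * T) ^+ 2)%:E = (C1 * (C * T) ^+ 2 * m)%:E)%E.
      by rewrite [RHS]EFinM -mE; exact: integral_cst.
    rewrite lee_fin powR_mulrn ?(ltW T0)//.
    by rewrite le_eqVlt; apply/orP; left; apply/eqP; ring.
  apply: ae_inS2 lip (hC u T0) => x Ox hg hu s su.
  have uT : `|fun_of u x| <= C * T by [].
  have s1 : `|s| <= 1 by apply: le_trans su (le_trans uT CT).
  apply: (@le_trans _ _ (C1 * `|s| * `|fun_of u x|)); first by rewrite ler_wpM2r// hg.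
  rewrite -mulrA ler_wpM2l ?(ltW C10)// expr2 ler_pM//; exact: le_trans su uT.
have pN : p < n.+2%:R by rewrite (lt_le_trans ltp2)// ler_nat.
have Np0 : 0 < n.+2%:R - p :> R by rewrite subr_gt0.
pose P : R := n.+2%:R * p / (n.+2%:R - p).
have pP : p < P.
  by rewrite /P ltr_pdivlMr// mulrC ltr_pM2r// ltrBlDr ltrDl.
have P0 : 0 < P by exact: lt_trans pP.
have [C [q [C0 q0 qP hC]]] := g2 pN.
have [Cs Cs0 hCs] := sobolev_W0 p1 mO lt1p pN (erefl P).
pose r := Num.min 2 P.
have pr : p < r by rewrite lt_min ltp2 pP.
have r0 : 0 < r by exact: lt_trans pr.
have rP : r <= P by rewrite ge_min lexx orbT.
have r2 : r <= 2 by rewrite ge_min lexx.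
pose A := C1 + 2 * C.
have A0 : 0 <= A by rewrite addr_ge0 ?mulr_ge0 ?ltW.
exists r, (A * (m + 2 * Cs)), 1; split=> //.
  by rewrite mulr_ge0// addr_ge0// mulr_ge0.
move=> u; set T := grad_norm Omega p (rep u) => T0 T1.
have [Lu _] := rep_in_LpW u.
have mfu : measurable_fun Omega (fun_of u).
  by have := measurable_Lp Lu; rewrite -measurable_restrictT.
have mpow s : measurable_fun Omega (fun x => `|fun_of u x| `^ s).
  by apply: (measurableT_comp (measurable_powR _)); exact: measurableT_comp.
(* powR_interpolate applied to `|u| ^ r, plus the term for `|u| > 1. *)
pose B x := A * T `^ r + A * (T `^ (r - P) + 1) * `|fun_of u x| `^ P.
have c0 : 0 <= A * (T `^ (r - P) + 1) by rewrite mulr_ge0// addr_ge0 ?powR_ge0.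
exists B; split.
- by apply: measurable_funD => //; exact: measurable_funM.
- by move=> x; apply: addr_ge0; apply: mulr_ge0 => //; exact: powR_ge0.
- rewrite (eq_integral (fun x => A%:E * (T `^ r)%:E + (A * (T `^ (r - P) + 1))%:E * (`|fun_of u x| `^ P)%:E)%E); last first.
    by move=> x _; rewrite -!EFinM -EFinD.
  rewrite ge0_integralD//; last 3 first.
  + by move=> x _; rewrite -EFinM lee_fin mulr_ge0 ?powR_ge0.
  + by move=> x _; rewrite -EFinM lee_fin mulr_ge0 ?powR_ge0.
  + by apply/measurable_EFinP; exact: measurable_funM.
  have -> : (\int[lebesgue_rV n.+2]_(x in Omega) (A%:E * (T `^ r)%:E) = (A * T `^ r * m)%:E)%E.
    by rewrite [RHS]EFinM -mE -EFinM; exact: integral_cst.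
  rewrite ge0_integralZl//; last first.
  + exact/measurable_EFinP.
  apply: (@le_trans _ _ ((A * T `^ r * m)%:E + (A * (T `^ (r - P) + 1))%:E * (Cs * T `^ P)%:E)%E).
    by rewrite leeD2l// lee_wpmul2l ?lee_fin//; exact: hCs.
  rewrite -EFinM -EFinD lee_fin.
  have e1 : T `^ (r - P) * T `^ P = T `^ r.
    by rewrite -powRD ?subrK// (gt_eqF T0) implybT.
  have e2 : T `^ P <= T `^ r by apply: ger_powR => //; rewrite T0 ltW.
  have e3 : A * Cs * T `^ P <= A * Cs * T `^ r by rewrite ler_wpM2l// mulr_ge0.
  have -> : A * T `^ r * m + A * (T `^ (r - P) + 1) * (Cs * T `^ P) =
    A * T `^ r * m + A * Cs * (T `^ (r - P) * T `^ P) + A * Cs * T `^ P by ring.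
  rewrite e1; apply: le_trans (_ : A * T `^ r * m + A * Cs * T `^ r + A * Cs * T `^ r <= _).
    by rewrite lerD2l.
  by rewrite le_eqVlt; apply/orP; left; apply/eqP; ring.
apply: ae_inS2 lip hC => x Ox hl hg s su.
set v := `|fun_of u x| in su *.
have v0 : 0 <= v by exact: normr_ge0.
have BE : B x = A * (T `^ r + T `^ (r - P) * v `^ P) + A * v `^ P by rewrite /B -/v; ring.
have [v1|v1] := leP v 1.
  apply: (@le_trans _ _ (A * v `^ r)); last first.
    rewrite BE ler_wpDr ?mulr_ge0 ?powR_ge0// ler_wpM2l//.
    exact: powR_interpolate.
  have s1 : `|s| <= 1 by exact: le_trans su v1.
  apply: (@le_trans _ _ (C1 * `|s| * v)); first by rewrite ler_wpM2r// hl.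
  have vr : v ^+ 2 <= v `^ r.
    have [->|vn] := eqVneq v 0; first by rewrite expr0n/= powR_ge0.
    rewrite -powR_mulrn//; apply: ger_powR => //.
    by rewrite lt_def vn v0.
  apply: (@le_trans _ _ (C1 * v ^+ 2)).
    by rewrite -mulrA ler_wpM2l ?(ltW C10)// expr2 ler_wpM2r.
  apply: (@le_trans _ _ (C1 * v `^ r)); first by rewrite ler_wpM2l ?(ltW C10).
  by rewrite ler_wpM2r ?powR_ge0// /A lerDl mulr_ge0// ltW.
have v1' : 1 <= v by exact: ltW.
apply: (@le_trans _ _ (A * v `^ P)); last first.
  by rewrite BE lerDr mulr_ge0// addr_ge0 ?mulr_ge0 ?powR_ge0.
apply: (@le_trans _ _ (2 * C * v `^ (P - 1) * v)).
  rewrite ler_wpM2r// (le_trans (hg s))// (_ : 2 * C * _ = C * (v `^ (P - 1) + v `^ (P - 1))); last by ring.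
  rewrite ler_wpM2l ?(ltW C0)// lerD//.
    apply: (@le_trans _ _ (v `^ 0)); first by rewrite powRr0.
    by rewrite ler_powR// (le_trans (ltW q0)).
  apply: (@le_trans _ _ (v `^ q)); last by rewrite ler_powR.
  by rewrite ge0_ler_powR ?nnegrE// ltW.
have -> : 2 * C * v `^ (P - 1) * v = 2 * C * v `^ P.
  by rewrite -mulrA [_ * v]mulrC mulr_powRB1.
by rewrite ler_wpM2r ?powR_ge0// /A lerDr ltW.
Qed.

End superlinear_majorant.

(** * The energy along rays *)

Section ae_integrable.
Context {R : realType} {N : nat}.
Variables (Omega : set 'rV[R]_N) (mO : measurable Omega).
Notation mu := (@lebesgue_rV R N).
Implicit Types f h : 'rV[R]_N -> R.

(** Integrands that involve [g] agree with Borel functions only almost everywhere. *)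
Definition ae_integrable f := exists2 f0, mu.-integrable Omega (EFin \o f0) &
  ae_in Omega (fun x => f x = f0 x).

Lemma eq_Rintegral_ae f h : ae_in Omega (fun x => f x = h x) ->
  \int[mu]_(x in Omega) f x = \int[mu]_(x in Omega) h x.
Proof.
move=> fh; congr fine; apply: eq_integral_ae.
by apply: ae_inS fh => x _ ->.
Qed.

Lemma integrable_ae_integrable f : mu.-integrable Omega (EFin \o f) -> ae_integrable f.
Proof. by move=> i; exists f => //; exact: ae_in_all. Qed.

Lemma ae_integrable_bound f B : lebesgue_measurable Omega f ->
  measurable_fun Omega B -> (\int[mu]_(x in Omega) (B x)%:E < +oo)%E ->
  ae_in Omega (fun x => `|f x| <= B x) -> ae_integrable f.
Proof.
move=> [f0 mf0 ff0] mB Blt fB; exists f0 => //.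
apply/integrableP; split; first exact/measurable_EFinP.
apply: le_lt_trans (_ : (\int[mu]_(x in Omega) `|B x|%:E < +oo)%E).
  apply: ge0_le_integral_ae => //.
  apply: ae_inS2 ff0 fB => x Ox e h; rewrite /= lee_fin -e.
  by apply: le_trans h (ler_norm _).
rewrite (@eq_integral_ae _ _ _ _ _ _ (fun x => (B x)%:E))//.
by apply: ae_inS fB => x Ox h; rewrite ger0_norm// (le_trans _ h).
Qed.

Lemma ae_integrableB f h : ae_integrable f -> ae_integrable h ->
  ae_integrable (fun x => f x - h x) /\
  \int[mu]_(x in Omega) (f x - h x) = \int[mu]_(x in Omega) f x - \int[mu]_(x in Omega) h x.
Proof.
move=> [f0 if0 ff0] [h0 ih0 hh0].
have e : ae_in Omega (fun x => f x - h x = f0 x - h0 x).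
  by apply: ae_inS2 ff0 hh0 => x _ -> ->.
split; first by exists (fun x => f0 x - h0 x) => //; exact: (integrableB mO if0 ih0).
rewrite (eq_Rintegral_ae e) (eq_Rintegral_ae ff0) (eq_Rintegral_ae hh0).
exact: RintegralB.
Qed.

Lemma le_Rintegral_ae f h : ae_integrable f -> ae_integrable h ->
  ae_in Omega (fun x => f x <= h x) ->
  \int[mu]_(x in Omega) f x <= \int[mu]_(x in Omega) h x.
Proof.
move=> fi hi fh; rewrite -subr_ge0.
have [[k ik kE] <-] := ae_integrableB hi fi.
rewrite (eq_Rintegral_ae kE).
rewrite (@eq_Rintegral_ae _ (fun x => Num.max (k x) 0)).
  by apply: Rintegral_ge0 => x _; rewrite le_max lexx orbT.
apply: ae_inS2 fh kE => x _ h1 h2; rewrite max_l// -h2 subr_ge0//.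
Qed.

Lemma ae_integrableZ (c : R) f : ae_integrable f ->
  ae_integrable (fun x => c * f x) /\
  \int[mu]_(x in Omega) (c * f x) = c * \int[mu]_(x in Omega) f x.
Proof.
move=> [f0 if0 ff0].
have e : ae_in Omega (fun x => c * f x = c * f0 x) by apply: ae_inS ff0 => x _ ->.
split; first by exists (fun x => c * f0 x) => //; exact: (integrableZl mO c if0).
by rewrite (eq_Rintegral_ae e) (eq_Rintegral_ae ff0) RintegralZl.
Qed.

End ae_integrable.

Section energy_along_rays.
Context {R : realType} {N : nat}.
Variables (Omega : set 'rV[R]_N) (mO : measurable Omega).
Variables (p : R) (p1 : 1 <= p) (lt1p : 1 < p).
Variables (Psi : 'rV[R]_N -> R) (g : 'rV[R]_N -> R -> R).
Hypothesis hPsi : Psi_assumptions p Psi.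
Hypothesis hg : g_assumptions p Omega g.
Notation mu := (@lebesgue_rV R N).
Local Notation W := (W0 Omega p1).
Local Notation E := (energy Omega p1 Psi g).

Let p0 : 0 < p. Proof. exact: lt_le_trans p1. Qed.

Lemma ae_continuous_g : ae_in Omega (fun x => continuous (g x)).
Proof.
have [_ g1 _ _] := hg; apply: ae_inS g1 => x _ [dg _] t.
by apply/differentiable_continuous/derivable1_diffP.
Qed.

Lemma measurable_comp_nabla (F : 'rV[R]_N -> R) (u : W) (s : R) : continuous F ->
  measurable_fun Omega (fun x => F (s *: nabla u x)).
Proof.
move=> cF; have [_ Lu] := rep_in_LpW u.
have mn : measurable_fun [set: 'rV[R]_N] (fun x => \row_i (s * (coordf i (nabla u) \_ Omega) x)).
  apply: measurable_fun_rVP => i.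
  rewrite (_ : _ \o _ = fun x => s * (coordf i (nabla u) \_ Omega) x).
    by apply: measurable_funM => //; exact: (measurable_Lp (Lu i)).
  by apply/funext => x; rewrite /rV_coord /= mxE.
have mF : measurable_fun [set: 'rV[R]_N] F by exact: continuous_measurable_rV.
apply: eq_measurable_fun (measurable_funTS (measurableT_comp mF mn)) => x.
rewrite inE => Ox /=; congr F; apply/rowP => i.
by rewrite !mxE /patch mem_set.
Qed.

Lemma pow_sum_le (a : 'I_N -> R) (S : R) : (forall i, 0 <= a i) -> (forall i, a i `^ p <= S) ->
  0 <= S -> (\sum_i a i) `^ p <= N%:R `^ p * S.
Proof.
move=> a0 aS S0.
have h i : a i <= S `^ p^-1.
  have -> : a i = (a i `^ p) `^ p^-1 by rewrite -powRrM mulfV ?powRr1// gt_eqF.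
  by rewrite ge0_ler_powR ?nnegrE ?powR_ge0// invr_ge0 ltW.
have -> : N%:R `^ p * S = (N%:R * S `^ p^-1) `^ p.
  by rewrite powRM ?powR_ge0// -powRrM mulVf ?powRr1// gt_eqF.
rewrite ge0_ler_powR ?nnegrE ?(ltW p0)//; first exact: sumr_ge0.
  by rewrite mulr_ge0// powR_ge0.
apply: (@le_trans _ _ (\sum_(i < N) S `^ p^-1)); first exact: ler_sum.
by rewrite sumr_const card_ord mulr_natl.
Qed.

Lemma continuous_enorm : continuous (@enorm R N).
Proof.
move=> x; apply: (continuous_comp (f := fun x : 'rV[R]_N => \sum_i x ord0 i ^+ 2) (g := @Num.sqrt R)).
  have csq (i : 'I_N) : continuous (fun y : 'rV[R]_N => y ord0 i ^+ 2).
    move=> y; apply: (continuous_comp (f := fun y : 'rV[R]_N => y ord0 i) (g := fun t : R => t ^+ 2)).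
      exact: coord_continuous.
    exact: exprn_continuous.
  elim: (index_enum _) => [|i r IH].
    rewrite (_ : (fun _ => _) = cst 0); first exact: cst_continuous.
    by apply/funext => y; rewrite big_nil.
  rewrite (_ : (fun _ => _) = (fun y : 'rV[R]_N => y ord0 i ^+ 2 + \sum_(j <- r) y ord0 j ^+ 2)).
    by apply: continuousD; [exact: csq|exact: IH].
  by apply/funext => y; rewrite big_cons.
exact: sqrt_continuous.
Qed.

Lemma integrable_enorm_nabla (u : W) :
  mu.-integrable Omega (EFin \o (fun x => enorm (nabla u x) `^ p)).
Proof.
have [_ Lu] := rep_in_LpW u.
have mi i : measurable_fun Omega (coordf i (nabla u)).
  by have := measurable_Lp (Lu i); rewrite -measurable_restrictT.
have mc i : measurable_fun Omega (fun x => `|coordf i (nabla u) x| `^ p).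
  by apply: (measurableT_comp (measurable_powR _)); exact: measurableT_comp.
apply/integrableP; split.
  apply/measurable_EFinP; apply: (measurableT_comp (measurable_powR _)).
  have := measurable_comp_nabla u 1 continuous_enorm.
  by under eq_fun do rewrite scale1r.
apply: (@le_lt_trans _ _ (\int[mu]_(x in Omega) ((N%:R `^ p)%:E * \sum_i (`|coordf i (nabla u) x| `^ p)%:E))%E).
  apply: ge0_le_integral_ae => //.
    by move=> x _; rewrite mule_ge0 ?lee_fin ?powR_ge0// sume_ge0// => i _; rewrite lee_fin powR_ge0.
  apply: aeW => x _; rewrite gee0_abs ?lee_fin ?powR_ge0// sumEFin -EFinM lee_fin.
  apply: (@le_trans _ _ ((\sum_i `|nabla u x ord0 i|) `^ p)).
    by rewrite ge0_ler_powR ?nnegrE ?enorm_ge0 ?enorm_le_sum ?sumr_ge0 ?(ltW p0).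
  apply: pow_sum_le => //.
    by move=> i; rewrite (bigD1 i)//= lerDl sumr_ge0// => j _; exact: powR_ge0.
  by rewrite sumr_ge0// => j _; exact: powR_ge0.
rewrite ge0_integralZl//; last 2 first.
- by apply: emeasurable_sum => i; exact/measurable_EFinP.
- by move=> x _; rewrite sume_ge0// => i _; rewrite lee_fin powR_ge0.
rewrite ge0_integral_sum//; last first.
  by move=> i; exact/measurable_EFinP.
under eq_bigr do rewrite (integral_normLp p1 (Lu _)).
by rewrite sumEFin -EFinM ltry.
Qed.

Lemma grad_norm_le_integral (u : W) : grad_norm Omega p (rep u) `^ p <=
  N%:R `^ p * \int[mu]_(x in Omega) (enorm (nabla u x) `^ p).
Proof.
have [_ Lu] := rep_in_LpW u.
apply: pow_sum_le.
- by move=> i; exact: normLp_ge0.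
- move=> i; rewrite -[leLHS]/(fine (normLp Omega p (coordf i (rep u).2) `^ p)%:E).
  rewrite -(integral_normLp p1 (Lu i)); apply: le_Rintegral_ae => //.
  + apply: integrable_ae_integrable; apply/integrableP; split.
      apply/measurable_EFinP; apply: (measurableT_comp (measurable_powR _)).
      apply: measurableT_comp => //.
      by have := measurable_Lp (Lu i); rewrite -measurable_restrictT.
    rewrite (eq_integral (fun x => (`|coordf i (rep u).2 x| `^ p)%:E)).
      by rewrite (integral_normLp p1 (Lu i)) ltry.
    by move=> x _; rewrite /= ger0_norm ?powR_ge0.
  + by apply: integrable_ae_integrable; exact: integrable_enorm_nabla.
  + apply: ae_in_all => x _.
    by rewrite ge0_ler_powR ?nnegrE ?enorm_ge0 ?coord_le_enorm ?(ltW p0).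
- by apply: Rintegral_ge0 => x _; exact: powR_ge0.
Qed.

Lemma energy_scale (s : R) (u : W) : E (s *: u) =
  \int[mu]_(x in Omega) Psi (s *: nabla u x)
  - \int[mu]_(x in Omega) primitive (g x) (s * fun_of u x).
Proof.
rewrite /energy; apply: (congr2 (fun a b : R => a - b)); apply: eq_Rintegral_ae.
  by apply: ae_inS (ae_scale s u) => x _ [_ ->].
by apply: ae_inS (ae_scale s u) => x _ [-> _].
Qed.

Lemma integrable_Psi_nabla (s : R) (u : W) :
  mu.-integrable Omega (EFin \o (fun x => Psi (s *: nabla u x))).
Proof.
have [nu [C [_ C0 _ hC]]] := Psi_bounds lt1p hPsi.
have [[dPsi _] _ _ _ _] := hPsi.
have i2 : mu.-integrable Omega (EFin \o (fun x => C * (`|s| `^ p * enorm (nabla u x) `^ p))).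
  exact: (integrableZl mO C (integrableZl mO (`|s| `^ p) (integrable_enorm_nabla u))).
apply: (le_integrable mO _ _ i2).
  apply/measurable_EFinP; apply: measurable_comp_nabla.
  by move=> x; exact: differentiable_continuous.
move=> x Ox; rewrite /= lee_fin; have /andP[h1 h2] := hC (s *: nabla u x).
rewrite (ger0_norm h1) ger0_norm; last by rewrite !mulr_ge0 ?powR_ge0.
by apply: (le_trans h2); rewrite enormZ (powRM _ (normr_ge0 _) (enorm_ge0 _)).
Qed.

Lemma measurable_primitive (s : R) (u : W) :
  lebesgue_measurable Omega (fun x => primitive (g x) (s * fun_of u x)).
Proof.
have [g0 _ _ _] := hg.
pose v := (fun x => s * (fun_of u \_ Omega) x).
have mv : measurable_fun [set: 'rV[R]_N] v.
  apply: measurable_funM => //; have [Lu _] := rep_in_LpW u; exact: (measurable_Lp Lu).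
have [h mh hE] := primitive_measurable_version mO g0 ae_continuous_g mv.
exists h => //; apply: ae_inS hE => x Ox <-.
by rewrite /v /patch mem_set.
Qed.

(** By the mean value theorem, [t * B x] then bounds the change of the primitive
    term at [x] along the whole segment between [u] and [(1 - t) *: u]. *)
Definition majorant (u : W) (B : 'rV[R]_N -> R) := [/\ measurable_fun Omega B,
  forall x, 0 <= B x, (\int[mu]_(x in Omega) (B x)%:E < +oo)%E &
  ae_in Omega (fun x => forall s, `|s| <= `|fun_of u x| -> `|g x s| * `|fun_of u x| <= B x)].

Lemma integrable_majorant u B : majorant u B -> mu.-integrable Omega (EFin \o B).
Proof.
move=> [mB B0 Blt _]; apply/integrableP; split; first exact/measurable_EFinP.
by rewrite (eq_integral (EFin \o B))// => x _; rewrite /= ger0_norm.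
Qed.

Lemma ae_primitive_diff u B (t : R) : majorant u B -> 0 <= t <= 1 ->
  ae_in Omega (fun x => `|primitive (g x) (1 * fun_of u x)
    - primitive (g x) ((1 - t) * fun_of u x)| <= t * B x).
Proof.
move=> [_ _ _ hB] /andP[t0 t1]; apply: ae_inS2 ae_continuous_g hB => x Ox cg h.
rewrite mul1r; move: (fun_of u x) h => a h.
have [c hc ->] := primitive_MVT cg a ((1 - t) * a).
have -> : a - (1 - t) * a = t * a by ring.
have ca : `|c| <= `|a|.
  have [a0|a0] := leP 0 a.
    have ta : (1 - t) * a <= a by nra.
    have ta0 : 0 <= (1 - t) * a by rewrite mulr_ge0// subr_ge0.
    move: hc; rewrite min_r// max_l// => /andP[c1 c2].
    by rewrite !ger0_norm// (le_trans ta0).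
  have ta : a <= (1 - t) * a by nra.
  have ta0 : (1 - t) * a <= 0 by nra.
  move: hc; rewrite min_l// max_r// => /andP[c1 c2].
  by rewrite (ler0_norm (le_trans c2 ta0)) (ltr0_norm a0) lerN2.
by rewrite normrM normrM (ger0_norm t0) mulrCA ler_wpM2l// h.
Qed.

Lemma ae_integrable_primitive u B (s : R) : majorant u B -> 0 <= s <= 1 ->
  ae_integrable Omega (fun x => primitive (g x) (s * fun_of u x)).
Proof.
move=> MB /andP[s0 s1]; have [mB B0 Blt hB] := MB.
apply: (ae_integrable_bound (measurable_primitive s u) mB Blt).
apply: ae_inS2 ae_continuous_g hB => x Ox cg h.
move: (fun_of u x) h => a h.
have [c hc e] := primitive_MVT cg (s * a) 0.
move: e; rewrite primitive_0 !subr0 => ->.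
have ca : `|c| <= `|a|.
  have [a0|a0] := leP 0 a.
    have ta : s * a <= a by nra.
    have ta0 : 0 <= s * a by rewrite mulr_ge0.
    move: hc; rewrite min_r// max_l// => /andP[c1 c2].
    by rewrite !ger0_norm// (le_trans c2).
  have ta : a <= s * a by nra.
  have ta0 : s * a <= 0 by nra.
  move: hc; rewrite min_l// max_r// => /andP[c1 c2].
  by rewrite (ler0_norm c2) (ltr0_norm a0) lerN2 (le_trans ta).
rewrite normrM normrM (ger0_norm s0) mulrCA.
apply: le_trans (h c ca); rewrite ler_piMl// mulr_ge0//.
Qed.

(** The convex term decreases by at least a multiple of [t * `|grad u| ^ p] when
    [u] shrinks to [(1 - t) *: u], while the primitive term changes by at most
    [t * B]. *)
Lemma energy_ray : exists2 nu : R, 0 < nu & forall u B (t : R), majorant u B -> 0 <= t <= 1 ->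
  t * (nu * grad_norm Omega p (rep u) `^ p - \int[mu]_(x in Omega) B x) <=
  E u - E ((1 - t) *: u).
Proof.
have [nu [C [nu0 C0 hnu hC]]] := Psi_bounds lt1p hPsi.
have N1 : 0 < N%:R `^ p + 1 :> R by rewrite ltr_wpDl// powR_ge0.
(* The factor compares the sum of the norms of the partial derivatives with the
   norm of the gradient; adding 1 avoids dividing by zero if N = 0. *)
exists (nu / (N%:R `^ p + 1)); first by rewrite divr_gt0.
move=> u B t MB t01; have /andP[t0 t1] := t01.
have t101 : 0 <= 1 - t <= 1 by apply/andP; split; lra.
rewrite -{2}(scale1r u) !energy_scale.
set I := \int[mu]_(x in Omega) (enorm (nabla u x) `^ p).
have [h1 h2] := ae_integrableB mO (integrable_ae_integrable (integrable_Psi_nabla 1 u))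
  (integrable_ae_integrable (integrable_Psi_nabla (1 - t) u)).
have i1 : ae_integrable Omega (fun x => primitive (g x) (1 * fun_of u x)).
  by apply: (ae_integrable_primitive MB); rewrite ler01 lexx.
have i2 := ae_integrable_primitive MB t101.
have [k1 k2] := ae_integrableB mO i1 i2.
set a := \int[mu]_(x in Omega) Psi (1 *: nabla u x).
set b := \int[mu]_(x in Omega) primitive (g x) (1 * fun_of u x).
set c := \int[mu]_(x in Omega) Psi ((1 - t) *: nabla u x).
set d := \int[mu]_(x in Omega) primitive (g x) ((1 - t) * fun_of u x).
have -> : a - b - (c - d) = (a - c) - (b - d) by ring.
rewrite /a /b /c /d -h2 -k2.
have iI : ae_integrable Omega (fun x => enorm (nabla u x) `^ p).
  by apply: integrable_ae_integrable; exact: integrable_enorm_nabla.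
have P1 : nu * (t * I) <= \int[mu]_(x in Omega) (Psi (1 *: nabla u x) - Psi ((1 - t) *: nabla u x)).
  have [j1 <-] := ae_integrableZ mO t iI; have [j2 <-] := ae_integrableZ mO nu j1.
  apply: le_Rintegral_ae => //; apply: ae_in_all => x _.
  by rewrite scale1r; exact: hnu.
have iB := integrable_ae_integrable (integrable_majorant MB).
have P2 : \int[mu]_(x in Omega) (primitive (g x) (1 * fun_of u x) - primitive (g x) ((1 - t) * fun_of u x))
    <= t * \int[mu]_(x in Omega) B x.
  have [j1 <-] := ae_integrableZ mO t iB.
  apply: le_Rintegral_ae => //; apply: ae_inS (ae_primitive_diff MB t01) => x _.
  by apply: le_trans; exact: ler_norm.
have P3 : nu / (N%:R `^ p + 1) * grad_norm Omega p (rep u) `^ p <= nu * I.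
  rewrite -mulrA ler_wpM2l ?(ltW nu0)// mulrC ler_pdivrMr//.
  apply: le_trans (grad_norm_le_integral u) _; rewrite -/I.
  have I0 : 0 <= I by apply: Rintegral_ge0 => x _; exact: powR_ge0.
  by rewrite [leRHS]mulrC ler_wpM2r// lerDl.
have P4 := ler_wpM2l t0 P3.
rewrite mulrBr; apply: lerB P2; rewrite mulrCA in P1; exact: le_trans P4 P1.
Qed.

End energy_along_rays.

(** * Criticality of zero forces the source to vanish *)

Section critical_points.
Context {R : realType} {V : normedModType R}.

(** The remainder of the differential along one direction, in a form that can be
    tested with a single small [t]. *)
Lemma critical_point_small_o (f : V -> R) (u v : V) (e : R) : critical_point f u -> 0 < e ->
  exists2 d, 0 < d & forall t : R, `|t| < d -> `|f (t *: v + u) - f u| <= e * `|t|.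
Proof.
move=> [df d0] e0.
have dv : derivable f u v by exact: diff_derivable.
have : h^-1 *: (f (h *: v + u) - f u) @[h --> 0^'] --> (0 : R).
  suff {2}<- : 'D_v f u = 0 by exact: dv.
  by rewrite deriveE.
move/cvgrPdist_lt => /(_ _ e0); rewrite near_withinE => /nbhs_ballP[d d_gt0 hd].
exists d => // t td; have [->|t0] := eqVneq t 0.
  by rewrite scale0r add0r subrr !normr0 mulr0.
have := hd t; rewrite /ball /= sub0r normrN => /(_ td t0).
rewrite sub0r normrN => /ltW; rewrite normrZ normfV ler_pdivrMl ?normr_gt0//.
by rewrite mulrC.
Qed.

End critical_points.

Section source_vanishes_at0.
Context {R : realType} {n : nat}.
Variables (Omega : set 'rV[R]_n.+1) (oO : open Omega) (bO : bounded_set Omega).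
Variables (p : R) (p1 : 1 <= p) (lt1p : 1 < p) (ltp2 : p < 2).
Variables (Psi : 'rV[R]_n.+1 -> R) (g : 'rV[R]_n.+1 -> R -> R).
Hypothesis hPsi : Psi_assumptions p Psi.
Hypothesis hg : g_assumptions p Omega g.
Notation mu := (@lebesgue_rV R n.+1).
Local Notation W := (W0 Omega p1).
Local Notation E := (energy Omega p1 Psi g).

Let mO : measurable Omega. Proof. exact: open_measurable_rV. Qed.
Let muO : (mu Omega < +oo)%E. Proof. exact: lebesgue_rV_bounded_lty. Qed.
Let p0 : 0 < p. Proof. exact: lt_trans lt1p. Qed.

Lemma test_function_W0 phi : test_function Omega phi ->
  exists v : W, ae_in Omega (fun x => fun_of v x = phi x /\ nabla v x = grad phi x).
Proof.
move=> tphi; have [Lphi _] := test_in_LpW p1 tphi.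
have hW : graph phi \in W0_pred Omega p.
  apply/asboolP; split=> // e e0; exists phi; split=> //.
  rewrite subrr -(scale0r (graph phi)) (normWZ p1)// normr0 mul0r//.
pose v : W0_pre Omega p := exist (fun w => w \in W0_pred Omega p) (graph phi) hW.
exists (to_quot (W0_seminorm Omega p1) v).
exact: (@ae_rep _ _ _ _ p1 v _ erefl).
Qed.

Lemma ae_bounded_source_at0 : exists2 C : R, 0 <= C & ae_in Omega (fun x => `|g x 0| <= C).
Proof.
have [_ _ [h1 h2 h3] _] := hg.
have aux : (exists C q : R, [/\ 0 < C, 0 < q &
        ae_in Omega (fun x => forall s, `|g x s| <= C * (1 + `|s| `^ q))]) ->
    exists2 C : R, 0 <= C & ae_in Omega (fun x => `|g x 0| <= C).
  move=> [C [q [C0 q0 hC]]]; exists C; first exact: ltW.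
  apply: ae_inS hC => x _ /(_ 0).
  by rewrite normr0 powR0 ?gt_eqF// addr0 mulr1.
have [pN|Np|pN] := ltgtP p (n.+1%:R : R).
- have [C [q [C0 q0 _ hC]]] := h1 pN; by apply: aux; exists C, q.
- have [C C0 hC] := h3 Np 1 ltr01; exists C; first exact: ltW.
  by apply: ae_inS hC => x _; apply; rewrite normr0.
- by apply: aux; exact: h2.
Qed.

Lemma energy0 : E 0 = 0.
Proof.
rewrite -(scale0r 0) energy_scale.
have [_ Psi0 _ _ _] := hPsi.
rewrite (@eq_Rintegral_ae _ _ _ _ (cst 0)); last first.
  by apply: ae_in_all => x _; rewrite scale0r.
rewrite (@eq_Rintegral_ae _ _ _ (fun x => primitive _ _) (cst 0)); last first.
  by apply: ae_in_all => x _; rewrite mul0r primitive_0.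
by rewrite /Rintegral integral0 subrr.
Qed.

Lemma ae_bounded_integrable (f : 'rV[R]_n.+1 -> R) (c : R) : measurable_fun Omega f ->
  ae_in Omega (fun x => `|f x| <= c) -> mu.-integrable Omega (EFin \o f).
Proof.
move=> mf fc; apply/integrableP; split; first exact/measurable_EFinP.
apply: (@le_lt_trans _ _ (\int[mu]_(x in Omega) (cst `|c|%:E x))%E).
  apply: ge0_le_integral_ae => //.
    by move=> x _; rewrite lee_fin.
  by apply: ae_inS fc => x _ h; rewrite /= lee_fin (le_trans h)// ler_norm.
by rewrite integral_cst// lte_mul_pinfty.
Qed.

Lemma norm_Rintegral_le (f : 'rV[R]_n.+1 -> R) (c : R) : 0 <= c -> ae_integrable Omega f ->
  ae_in Omega (fun x => `|f x| <= c) -> `|\int[mu]_(x in Omega) f x| <= c * fine (mu Omega).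
Proof.
move=> c0 fi fc.
have ic d : mu.-integrable Omega (EFin \o cst d) by apply: (@ae_bounded_integrable _ `|d|) => //; exact: ae_in_all.
rewrite ler_norml; apply/andP; split.
  rewrite -mulNr -(@Rintegral_cst _ _ _ mu)//; apply: le_Rintegral_ae => //.
    exact: (integrable_ae_integrable (ic (- c))).
  by apply: ae_inS fc => x _; rewrite ler_norml => /andP[].
rewrite -(@Rintegral_cst _ _ _ mu)//; apply: le_Rintegral_ae => //.
  exact: (integrable_ae_integrable (ic c)).
by apply: ae_inS fc => x _; rewrite ler_norml => /andP[].
Qed.

(** For a test function [phi] the energy of [s *: phi] is minus [s] times the
    integral of [g x 0 * phi x], up to an error of order [s ^ p]: the convex term
    is of that order, and the mean value theorem bounds the rest by a multiple of
    [s ^ 2 <= s ^ p]. As [1 < p], criticality of zero makes that integral vanish,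
    and [phi] is arbitrary. *)
Lemma ae_source_at0_eq0 : critical_point E 0 -> ae_in Omega (fun x => g x 0 = 0).
Proof.
move=> crit; have [g0 g1 _ g3] := hg.
have [k mk gk] := g0 0.
have [C0 C00 hC0] := ae_bounded_source_at0.
have [C1 C10 hC1] := g3 1 ltr01.
have [nu [C [_ C_ge0 _ hC]]] := Psi_bounds lt1p hPsi.
have kC0 : ae_in Omega (fun x => `|k x| <= C0) by apply: ae_inS2 gk hC0 => x _ ->.
have ik := ae_bounded_integrable mk kC0.
have : ae_in Omega (fun x => k x = 0); last by apply: ae_inS2 gk => x _ ->.
apply: (ae_eq0_of_test oO ik) => phi tphi.
have [dphi _ [M [L [M0 _ hM _]]]] := test_function_C1_compact tphi.
have mphi : measurable_fun Omega phi.
  apply: measurable_funTS; apply: continuous_measurable_rV => x.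
  exact: differentiable_continuous.
have ikphi : mu.-integrable Omega (EFin \o (fun x => k x * phi x)).
  apply: (@ae_bounded_integrable _ (C0 * M)); first exact: measurable_funM.
  by apply: ae_inS kC0 => x _ h; rewrite normrM ler_pM//; case: (hM x).
set J := (\int[mu]_(x in Omega) _)%E.
have Jfin : J \is a fin_num by exact: integrable_fin_num ikphi.
rewrite -(fineK Jfin); congr EFin.
have Jdef : fine J = \int[mu]_(x in Omega) (k x * phi x) by [].
move: (fine J) Jdef => {Jfin}j jdef.
have [v hv] := test_function_W0 tphi.
pose I := \int[mu]_(x in Omega) (enorm (nabla v x) `^ p).
have I0 : 0 <= I by apply: Rintegral_ge0 => x _; exact: powR_ge0.
pose m := fine (mu Omega); have m0 : 0 <= m by rewrite fine_ge0.
have sM1 : 0 < (M + 1)^-1 by rewrite invr_gt0 ltr_wpDl.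
pose A := C * I + C1 * M ^+ 2 * m.
have A0 : 0 <= A by rewrite addr_ge0 ?mulr_ge0 ?sqr_ge0// ltW.
have expansion s : 0 < s -> s < 1 -> s < (M + 1)^-1 -> `|E (s *: v) + s * j| <= A * s `^ p.
  move=> s0 s1 sM; have sM' : s * M <= 1.
    by have := sM; rewrite -[ltRHS]mul1r ltr_pdivlMr ?ltr_wpDl//; nra.
  pose F x := primitive (g x) (s * fun_of v x).
  have hF : ae_in Omega (fun x => `|F x - s * (k x * phi x)| <= C1 * M ^+ 2 * s ^+ 2).
    have := ae_inS3 (fun _ _ a b c => conj a (conj b c)) hC1 gk hv.
    apply: ae_inS2 g1 => x _ [dg _] [hg1 [gk0 [vphi _]]]; rewrite /F vphi.
    have cg : continuous (g x) by move=> t; apply/differentiable_continuous/derivable1_diffP.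
    have [c hc] := primitive_MVT cg (s * phi x) 0.
    rewrite primitive_0 !subr0 => ->.
    have [hMx _] := hM x.
    have sphi : `|s * phi x| <= s * M by rewrite normrM (gtr0_norm s0) ler_wpM2l// ltW.
    have cphi : `|c| <= `|s * phi x|.
      have [a0|a0] := leP 0 (s * phi x).
        move: hc; rewrite min_r// max_l// => /andP[c1 c2].
        by rewrite (ger0_norm c1) (ger0_norm a0).
      move: hc; rewrite min_l ?max_r ?(ltW a0)// => /andP[c1 c2].
      by rewrite (ler0_norm c2) (ltr0_norm a0) lerN2.
    have lip : `|g x c - g x 0| <= C1 * `|c|.
      apply: (@lipschitz_at0 _ (fun t => g x t - g x 0)).
      - by move=> t; exact: derivableB.
      - by rewrite subrr.
      - move=> t t1; rewrite derive1E deriveB// derive_cst subr0 -derive1E; exact: hg1.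
      - exact: le_trans cphi (le_trans sphi sM').
    have -> : g x c * (s * phi x) - s * (k x * phi x) = (g x c - g x 0) * (s * phi x).
      by rewrite gk0; ring.
    rewrite normrM; have -> : C1 * M ^+ 2 * s ^+ 2 = (C1 * (s * M)) * (s * M) by ring.
    rewrite ler_pM// (le_trans lip)// ler_wpM2l ?(ltW C10)//.
    exact: le_trans cphi sphi.
  have iF : ae_integrable Omega F.
    apply: (@ae_integrable_bound _ _ _ _ (cst (C1 * M ^+ 2 * s ^+ 2 + s * (C0 * M)))).
    - exact: measurable_primitive.
    - exact: measurable_cst.
    - set K := (X in cst X); have -> : (\int[mu]_(x in Omega) (cst K x)%:E = K%:E * mu Omega)%E by exact: (integral_cst mu mO K%:E).
      by rewrite ltey_eq fin_numM// ge0_fin_numE.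
    - apply: ae_inS2 hF kC0 => x _ h1 h2.
      rewrite -[F x](subrK (s * (k x * phi x))) (le_trans (ler_normD _ _))// lerD//.
      rewrite normrM (gtr0_norm s0) ler_wpM2l ?(ltW s0)// normrM ler_pM//.
      by case: (hM x).
  have [iK eK] := ae_integrableZ mO s (integrable_ae_integrable ikphi).
  have [iD eD] := ae_integrableB mO iF iK.
  have B1 : `|\int[mu]_(x in Omega) F x - s * j| <= C1 * M ^+ 2 * s ^+ 2 * m.
    rewrite jdef -eK -eD; apply: norm_Rintegral_le => //.
    by rewrite !mulr_ge0 ?sqr_ge0// ltW.
  have iI : ae_integrable Omega (fun x => enorm (nabla v x) `^ p).
    by apply: integrable_ae_integrable; exact: integrable_enorm_nabla.
  have [iI1 eI1] := ae_integrableZ mO (s `^ p) iI.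
  have [iI2 eI2] := ae_integrableZ mO C iI1.
  have B2 : `|\int[mu]_(x in Omega) Psi (s *: nabla v x)| <= C * (s `^ p * I).
    rewrite -eI1 -eI2 ger0_norm.
      apply: le_Rintegral_ae => //.
        by apply: integrable_ae_integrable; exact: integrable_Psi_nabla.
      apply: ae_in_all => x _; have /andP[_ h] := hC (s *: nabla v x).
      by apply: le_trans h _; rewrite enormZ powRM ?enorm_ge0// (gtr0_norm s0).
    by apply: Rintegral_ge0 => x _; have /andP[] := hC (s *: nabla v x).
  rewrite energy_scale -/F.
  set X := \int[mu]_(x in Omega) Psi _ in B2 *; set Y := \int[mu]_(x in Omega) F x in B1 *.
  have -> : X - Y + s * j = X - (Y - s * j) by ring.
  apply: le_trans (ler_normB _ _) _.
  have -> : A * s `^ p = C * (s `^ p * I) + C1 * M ^+ 2 * s `^ p * m by rewrite /A; ring.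
  apply: lerD => //; apply: (le_trans B1).
  rewrite ler_wpM2r// ler_wpM2l ?mulr_ge0 ?sqr_ge0 ?(ltW C10)//.
  by rewrite -powR_mulrn ?(ltW s0)//; apply: ger_powR; rewrite ?(ltW ltp2)// s0 ltW.
apply/eqP; apply: contraT => j0; have a0 : 0 < `|j| by rewrite normr_gt0.
have e0 : 0 < `|j| / 4 by rewrite divr_gt0.
have [d d0 hd] := critical_point_small_o v crit e0.
have A1 : 0 < A + 1 by rewrite ltr_wpDl.
(* For s ^ (p - 1) <= z the error A * s ^ p is below s * `|j| / 4; the other
   bounds on s are those of the expansion and of criticality. *)
pose z := `|j| / (4 * (A + 1)).
have z0 : 0 < z by rewrite divr_gt0// mulr_gt0.
have q0 : 0 < p - 1 by rewrite subr_gt0.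
pose s := Num.min (Num.min (d / 2) (1 / 2)) (Num.min ((M + 1)^-1 / 2) (z `^ (p - 1)^-1)).
have s0 : 0 < s by rewrite !lt_min !divr_gt0//= powR_gt0.
have half_lt (a : R) : 0 < a -> a / 2 < a by move=> ?; rewrite ltr_pdivrMr// ltr_pMr// ltr1n.
have sd : s < d.
  by apply: le_lt_trans (half_lt _ d0); rewrite /s !ge_min lexx.
have s1 : s < 1.
  by apply: le_lt_trans (half_lt _ ltr01); rewrite /s !ge_min lexx !orbT.
have sM : s < (M + 1)^-1.
  by apply: le_lt_trans (half_lt _ sM1); rewrite /s !ge_min lexx !orbT.
have sz : s <= z `^ (p - 1)^-1 by rewrite /s !ge_min lexx !orbT.
have szp : s `^ (p - 1) <= z.
  have -> : z = (z `^ (p - 1)^-1) `^ (p - 1).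
    by rewrite -powRrM mulVf ?powRr1 ?gt_eqF// ltW.
  by rewrite ge0_ler_powR ?nnegrE ?powR_ge0// ltW.
have H1 := expansion s s0 s1 sM.
have := hd s; rewrite addr0 energy0 subr0 (gtr0_norm s0) => /(_ sd) H2.
have H3 : s * `|j| <= A * s `^ p + `|j| / 4 * s.
  rewrite -{1}(gtr0_norm s0) -normrM.
  have -> : s * j = (E (s *: v) + s * j) - E (s *: v) by ring.
  by apply: le_trans (ler_normB _ _) _; apply: lerD.
have H4 : A * s `^ p <= s * (`|j| / 4).
  rewrite -mulr_powRB1 ?(ltW s0)// mulrCA ler_wpM2l ?(ltW s0)//.
  apply: (@le_trans _ _ (A * z)); first by rewrite ler_wpM2l.
  have -> : `|j| / 4 = (A + 1) * z by rewrite /z; field; rewrite gt_eqF.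
  by rewrite ler_wpM2r ?(ltW z0)// lerDl.
have : 0 < s * `|j| by rewrite mulr_gt0.
by move: H3 H4; clear; nra.
Qed.

End source_vanishes_at0.

(** * Morse indices of a trivial space *)

Section trivial_index.
Context {R : realType} {V : lmodType R}.
Local Open Scope ereal_scope.

Lemma dimension_sub0 (S : set V) : S `<=` [set 0%R] -> dimension S = 0.
Proof.
move=> S0; rewrite /dimension (_ : [set _ | _ in _] = [set 0]) ?ereal_sup1//.
apply/seteqP; split=> [_ [[|k] [e ie Se] <-]|_ ->] //.
  have := ie (fun=> 1%R); rewrite big1 => [/(_ erefl ord0)/eqP|i _].
    by rewrite oner_eq0.
  by rewrite (S0 _ (Se i)) scaler0.
exists 0%N => //; exists (fun=> 0%R); last by case.
by move=> a _; case.
Qed.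

(** The shape shared by both Morse indices, [P] being the sign condition on the
    quadratic form. *)
Lemma index_sub0 (X : set V) (P : set V -> Prop) : X `<=` [set 0%R] -> X 0%R ->
  P [set 0%R] ->
  ereal_sup [set dimension S | S in [set S | [/\ is_subspace S, S `<=` X & P S]]] = 0.
Proof.
move=> X0 X00 P0; rewrite (_ : [set _ | _ in _] = [set 0]) ?ereal_sup1//.
apply/seteqP; split=> [_ [S [_ SX _] <-]|_ ->].
  by apply: dimension_sub0; exact: subset_trans X0.
exists [set 0%R]; last exact: dimension_sub0.
split=> //; last by move=> _ ->.
by split=> // a _ _ -> ->; rewrite scaler0 addr0.
Qed.

End trivial_index.

(** * The critical point zero *)

Section zero_critical_point.
Context {R : realType} {n : nat}.
Variables (Omega : set 'rV[R]_n.+1) (oO : open Omega) (bO : bounded_set Omega).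
Variables (p : R) (p1 : 1 <= p) (lt1p : 1 < p) (ltp2 : p < 2).
Variables (Psi : 'rV[R]_n.+1 -> R) (g : 'rV[R]_n.+1 -> R -> R).
Hypothesis hPsi : Psi_assumptions p Psi.
Hypothesis hg : g_assumptions p Omega g.
Notation mu := (@lebesgue_rV R n.+1).
Local Notation W := (W0 Omega p1).
Local Notation E := (energy Omega p1 Psi g).
Hypothesis crit : critical_point E 0.

Let mO : measurable Omega. Proof. exact: open_measurable_rV. Qed.
Let p0 : 0 < p. Proof. exact: lt_trans lt1p. Qed.

(** In the bound of [energy_ray], the majorant contributes at most [K * T ^ r] with
    [r > p], where [T] is the gradient norm of [u]; this is below [nu * T ^ p] for
    small positive [T], and [T] is positive by the Poincare inequality. *)
Lemma energy_gap : exists2 d : R, 0 < d & forall u : W, u != 0 -> `|u| < d ->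
  exists2 c : R, 0 < c & forall t : R, 0 <= t <= 1 -> t * c <= E u - E ((1 - t) *: u).
Proof.
have g0 := ae_source_at0_eq0 oO bO lt1p ltp2 hPsi hg crit.
have [r [K [T0 [pr K0 T00 hB]]]] := superlinear_majorant p1 mO bO lt1p ltp2 hg g0.
have [nu nu0 hnu] := energy_ray mO p1 lt1p hPsi hg.
have K1 : 0 < K + 1 by rewrite ltr_wpDl.
have rp : 0 < r - p by rewrite subr_gt0.
pose z := nu / (K + 1); have z0 : 0 < z by rewrite divr_gt0.
exists (Num.min T0 (z `^ (r - p)^-1)); first by rewrite lt_min T00 powR_gt0.
move=> u un0; set T := grad_norm Omega p (rep u); rewrite lt_min => /andP[uT uz].
have Tu : T <= `|u| by rewrite norm_rep; exact: grad_norm_le_normW.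
have Tp : 0 < T.
  rewrite lt_def grad_norm_ge0 andbT; apply: contra un0 => /eqP TE.
  by apply/eqP; exact: (poincare_W0 mO bO lt1p TE).
have [B [mB B0 IB hgB]] := hB u Tp (le_lt_trans Tu uT).
have MB : majorant g u B by split=> //; exact: le_lt_trans IB (ltry _).
exists (nu * T `^ p - \int[mu]_(x in Omega) B x); last by move=> t; exact: hnu.
have IB' : \int[mu]_(x in Omega) B x <= K * T `^ r.
  rewrite -lee_fin fineK//.
  exact: integrable_fin_num (integrable_majorant MB).
rewrite subr_gt0; apply: (le_lt_trans IB').
have -> : T `^ r = T `^ p * T `^ (r - p).
  by rewrite -powRD 1?addrC ?subrK// (gt_eqF Tp) implybT.
rewrite mulrCA mulrC ltr_pM2r ?powR_gt0//.
have Tz : T `^ (r - p) < z.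
  have -> : z = (z `^ (r - p)^-1) `^ (r - p).
    by rewrite -powRrM mulVf ?powRr1 ?gt_eqF// ltW.
  by rewrite gt0_ltr_powR ?nnegrE ?powR_ge0 ?(ltW Tp)//; exact: le_lt_trans uz.
apply: (@le_lt_trans _ _ ((K + 1) * T `^ (r - p))).
  by rewrite ler_wpM2r ?powR_ge0// lerDl.
by rewrite mulrC -ltr_pdivlMr.
Qed.

Lemma zero_strict_local_min : strict_local_min E 0.
Proof.
have [d d0 hd] := energy_gap; exists d => // u un0; rewrite subr0 => ud.
have [c c0 hc] := hd u un0 ud.
have h1 : (0 : R) <= 1 <= (1 : R) by rewrite ler01/=.
have := hc 1 h1.
have -> : (1 - 1) *: u = 0 by rewrite subrr scale0r.
rewrite mul1r -subr_gt0; exact: lt_le_trans.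
Qed.

(** At a critical point [u] the difference quotients of the energy along
    [(1 - t) *: u] tend to zero, whereas [energy_gap] keeps them above [c]. *)
Lemma zero_isolated_critical_point : isolated_critical_point E 0.
Proof.
split=> //; have [d d0 hd] := energy_gap; exists d => // u; rewrite subr0 => ud cu.
apply/eqP; apply: contraT => un0.
have [c c0 hc] := hd u un0 ud.
have c20 : 0 < c / 2 by rewrite divr_gt0.
have [s s0 hs] := critical_point_small_o u cu c20.
pose t := Num.min (s / 2) 1.
have t0 : 0 < t by rewrite lt_min divr_gt0//=.
have t1 : 0 <= t <= 1 by rewrite ltW//= ge_min lexx orbT.
have ts : `|- t| < s.
  rewrite normrN gtr0_norm//; apply: (@le_lt_trans _ _ (s / 2)); first by rewrite ge_min lexx.
  by rewrite ltr_pdivrMr// ltr_pMr// ltr1n.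
have := hs (- t) ts; rewrite normrN (gtr0_norm t0).
have -> : - t *: u + u = (1 - t) *: u by rewrite scalerBl scale1r addrC scaleNr.
rewrite distrC => /(le_trans (ler_norm _)) h1; have h2 := hc t t1.
have := le_trans h2 h1; rewrite mulrC (ler_pM2r t0).
by rewrite leNgt ltr_pdivrMr// ltr_pMr// ltr1n.
Qed.

Lemma sublevel_isolated : exists2 U, nbhs (0 : W) U &
  forall u, sublevel E (E 0) u -> U u -> u = 0.
Proof.
have [e e0 he] := zero_strict_local_min.
exists (ball (0 : W) e); first exact: nbhsx_ballx.
move=> u Eu; rewrite -ball_normE/= sub0r normrN => ue.
apply/eqP; apply: contraT => un0.
have := he u un0; rewrite subr0 => /(_ ue); rewrite ltNge.
by move: Eu; rewrite /sublevel/= => ->.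
Qed.

Lemma ae_notin_regular_set :
  {ae mu, forall x, ~ (Omega `\` Z_set (0 : W)) x}.
Proof.
have := ae_zero Omega p1; rewrite /ae_in; apply: filterS => x h [Ox nZ].
by apply: nZ; split=> //; have [] := h Ox.
Qed.

(** The gradient of the zero class vanishes almost everywhere, so its singular set
    is all of [Omega] up to a null set: admissible directions have zero gradient. *)
Lemma X_space_zero : X_space (0 : W) `<=` [set 0].
Proof.
move=> v [Zv _]; have lt12 : 1 < 2 :> R by rewrite ltr1n.
have nv : ae_in Omega (fun x => nabla v x = 0).
  move: Zv ae_notin_regular_set; rewrite /ae_in; apply: filterS2 => x h1 h2 Ox.
  by apply: h1; apply: contrapT => nZ; apply: h2.
have [_ Lv] := rep_in_LpW v.
apply: (poincare_W0 mO bO lt12); apply: big1 => i _.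
have := integral_normLp (one_le2 (R := R)) (Lv i).
rewrite (@eq_integral_ae _ _ _ _ _ _ (cst 0%E)); last first.
  by apply: ae_inS nv => x _ h; rewrite /coordf /rep/= h mxE normr0 powR0.
rewrite integral0 => /esym[] /eqP; rewrite powR_eq0 => /andP[/eqP].
by [].
Qed.

Lemma zero_in_X_space : X_space (0 : W) 0.
Proof.
have noreg := ae_notin_regular_set.
split.
  have := ae_zero Omega (one_le2 (R := R)); rewrite /ae_in.
  by apply: filterS => x h [Ox _]; have [] := h Ox.
have measurable_ratio (F1 F2 : 'rV[R]_n.+1 -> R) : measurable_fun Omega F1 ->
    measurable_fun Omega F2 ->
    measurable_fun Omega (fun x => (F1 x ^+ 2 / F2 x `^ (2 - p))%:E).
  move=> m1 m2; apply/measurable_EFinP; apply: measurable_funM; first exact: measurable_funX.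
  under eq_fun do rewrite -powRN.
  exact: (measurableT_comp (measurable_powR _)).
apply/integrableP; split.
  apply: (measurable_funS mO (@subDsetl _ _ _)).
  have m1 : measurable_fun Omega (fun x => enorm (nabla (0 : W0 Omega (one_le2 (R := R))) x)).
    have := measurable_comp_nabla (0 : W0 Omega (one_le2 (R := R))) 1 (@continuous_enorm R n.+1).
    by under eq_fun do rewrite scale1r.
  have m2 : measurable_fun Omega (fun x => enorm (nabla (0 : W) x)).
    have := measurable_comp_nabla (0 : W) 1 (@continuous_enorm R n.+1).
    by under eq_fun do rewrite scale1r.
  exact: measurable_ratio m1 m2.
rewrite (@eq_integral_ae _ _ _ _ _ _ (cst 0%E)) ?integral0//.
by move: noreg; apply: filterS => x h /h.
Qed.

Lemma Q_form_zero : Q_form Psi g (0 : W) 0 = 0.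
Proof.
have ez := ae_zero Omega (one_le2 (R := R)).
rewrite /Q_form (@eq_Rintegral_ae _ _ _ _ (cst 0)); last first.
  by move: ae_notin_regular_set; apply: filterS => x h /h.
rewrite (@eq_Rintegral_ae _ _ Omega _ (cst 0)); last first.
  by apply: ae_inS ez => x _ [-> _]; rewrite expr0n mulr0.
by rewrite /Rintegral !integral0 subrr.
Qed.

Lemma zero_morse : morse Omega p1 Psi g 0 = 0%E.
Proof.
apply: (index_sub0 (P := fun S => forall v, S v -> v != 0 -> Q_form Psi g (0 : W) v < 0)).
- exact: X_space_zero.
- exact: zero_in_X_space.
- by move=> _ ->; rewrite eqxx.
Qed.

Lemma zero_large_morse : large_morse Omega p1 Psi g 0 = 0%E.
Proof.
apply: (index_sub0 (P := fun S => forall v, S v -> Q_form Psi g (0 : W) v <= 0)).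
- exact: X_space_zero.
- exact: zero_in_X_space.
- by move=> _ ->; rewrite Q_form_zero.
Qed.

End zero_critical_point.

Theorem theorem2p7 (R : realType) (N : nat) (hN : (0 < N)%N)
    (Omega : set 'rV[R]_N) (p alpha : R) (hp1 : 1 < p) (hp2 : p < 2)
    (Psi : 'rV[R]_N -> R) (g : 'rV[R]_N -> R -> R) (G : zmodType)
    (hOpen : open Omega) (hBounded : bounded_set Omega)
    (halpha : 0 < alpha <= 1) (hBoundary : C1alpha_boundary alpha Omega)
    (hPsi : Psi_assumptions p Psi) (hg : g_assumptions p Omega g)
    (hcrit : critical_point (energy Omega (ltW hp1) Psi g) 0) :
  [/\ morse Omega (ltW hp1) Psi g 0 = 0%E,
      large_morse Omega (ltW hp1) Psi g 0 = 0%E,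
      strict_local_min (energy Omega (ltW hp1) Psi g) 0,
      isolated_critical_point (energy Omega (ltW hp1) Psi g) 0 &
      forall m : nat,
        (m = 0%N ->
          zmod_isomorphic (critical_group G (energy Omega (ltW hp1) Psi g) 0 m) G) /\
        (m <> 0%N ->
          forall c : critical_group G (energy Omega (ltW hp1) Psi g) 0 m, c = 0)].
Proof.
case: N => // n in hN Omega Psi g hOpen hBounded hBoundary hPsi hg hcrit *.
have iso := sublevel_isolated hOpen hBounded hp1 hp2 hPsi hg hcrit.
split.
- exact: zero_morse.
- exact: zero_large_morse.
- exact: zero_strict_local_min.
- exact: zero_isolated_critical_point.
- have X0 : sublevel (energy Omega (ltW hp1) Psi g) (energy Omega (ltW hp1) Psi g 0) 0.
    exact: lexx.
  case=> [|m]; split=> // _.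
    exact: (AS_cohomology_isolated0 G (@norm_hausdorff _ _) X0 iso).
  move=> c; exact: (AS_cohomology_isolatedS (@norm_hausdorff _ _) X0 iso c).
Qed.
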